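(* Let $\mathcal{B}=\{B_t\}_{t\in G}$ be a Fell bundle over a discrete group $G$. Then $\mathcal{B}$ is exact if and only if every Fourier ideal in the reduced cross-sectional algebra $C^*_r(\mathcal{B})$ is graded.
   Context: Ideals in $C^*$-algebras are closed and two-sided; products of subspaces of a $C^*$-algebra denote closed linear spans of products of elements. A Fell bundle $\mathcal{B}=\{B_t\}_{t\in G}$ over a discrete group $G$ with unit $e$ is a collection of closed subspaces of a $C^*$-algebra such that $B_t^*=B_{t^{-1}}$ and $B_tB_s\subseteq B_{ts}$ for all $s,t\in G$; in particular $B_e$ is a $C^*$-algebra. The (external) direct sum $\bigoplus_{t\in G}B_t$ is a $*$-algebra. Among the $C^*$-norms on it satisfying $\|a_e\|\le\|\sum_t a_t\|$ for all $\sum_t a_t\in\bigoplus_t B_t$ ($a_t\in B_t$) there is a minimal one; the corresponding completion is the reduced cross-sectional algebra $C^*_r(\mathcal{B})$. The canonical projections $\bigoplus_s B_s\to B_t$ extend to contractive linear maps $F_t:C^*_r(\mathcal{B})\to B_t$, $t\in G$. An ideal in $\mathcal{B}$ is a collection $\mathcal{J}=\{J_t\}_{t\in G}$ of closed subspaces $J_t\subseteq B_t$ with $B_sJ_t\subseteq J_{st}$ and $J_sB_t\subseteq J_{st}$ for all $s,t\in G$. Then $\mathcal{J}$ and $\mathcal{B}/\mathcal{J}:=\{B_t/J_t\}_{t\in G}$ are Fell bundles. $\mathcal{B}$ is exact if for every ideal $\mathcal{J}$ in $\mathcal{B}$ the sequence $0\to C^*_r(\mathcal{J})\to C^*_r(\mathcal{B})\to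 C^*_r(\mathcal{B}/\mathcal{J})\to 0$, with maps induced by the inclusions $J_t\subseteq B_t$ and the quotient maps $B_t\to B_t/J_t$, is exact. An ideal $J$ in $C^*_r(\mathcal{B})$ is graded if it is generated as an ideal by $J\cap B_e$ (equivalently, $J=\overline{\bigoplus_{t\in G}J\cap B_t}$), and it is Fourier if $F_t(J)\subseteq J$ for all $t\in G$. *)

(* Defs.v *)
From HB Require Import structures.
From mathcomp Require Import all_boot all_order all_algebra.
From mathcomp Require Import complex.
From mathcomp Require Import all_classical all_reals all_analysis.

Set Implicit Arguments.
Unset Strict Implicit.
Unset Printing Implicit Defensive.

Import Order.TTheory GRing.Theory Num.Theory.
Import numFieldNormedType.Exports.

Local Open Scope classical_set_scope.
Local Open Scope ring_scope.

(* Complex C*-algebras, not necessarily unital; in particular the zero algebra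
   is allowed.  Norms of normed modules over R[i] take their values in R[i]. *)
HB.mixin Record isCStarAlgebra (R : realType) A
    of CompleteNormedModule R[i] A := {
  cmul : A -> A -> A;
  cstar : A -> A;
  cmulA : associative cmul;
  cmulDl : forall x y z : A, cmul (x + y) z = cmul x z + cmul y z;
  cmulDr : forall x y z : A, cmul x (y + z) = cmul x y + cmul x z;
  cmulZl : forall (c : R[i]) (x y : A), cmul (c *: x) y = c *: cmul x y;
  cmulZr : forall (c : R[i]) (x y : A), cmul x (c *: y) = c *: cmul x y;
  cstarK : involutive cstar;
  cstarD : forall x y : A, cstar (x + y) = cstar x + cstar y;
  cstarZ : forall (c : R[i]) (x : A), cstar (c *: x) = c^* *: cstar x;
  cstarM : forall x y : A, cstar (cmul x y) = cmul (cstar y) (cstar x);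
  cnormM : forall x y : A, `|cmul x y| <= `|x| * `|y|;
  cnorm_star : forall x : A, `|cmul (cstar x) x| = `|x| ^+ 2
}.

#[short(type="cstarAlgType")]
HB.structure Definition CStarAlgebra (R : realType) :=
  {A of isCStarAlgebra R A & CompleteNormedModule R[i] A}.

Section CStarAlgebras.
Variables (R : realType).

Definition closed_subspace (A : cstarAlgType R) (S : set A) : Prop :=
  [/\ closed S, S 0 &
      forall (c : R[i]) (x y : A), S x -> S y -> S (c *: x + y)].

Definition cstar_ideal (A : cstarAlgType R) (I : set A) : Prop :=
  closed_subspace I /\
  forall x y : A, I y -> I (cmul x y) /\ I (cmul y x).

Definition star_hom (A C : cstarAlgType R) (phi : A -> C) : Prop :=
  [/\ linear phi,
      forall x y : A, phi (cmul x y) = cmul (phi x) (phi y) &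
      forall x : A, phi (cstar x) = cstar (phi x)].

Definition short_exact (A C D : cstarAlgType R) (phi : A -> C) (psi : C -> D)
    : Prop :=
  [/\ injective phi, range phi = psi @^-1` [set 0] & range psi = setT].

End CStarAlgebras.

Section FellBundles.
Variables (R : realType) (G : groupType).

Section Bundle.
Variable A : cstarAlgType R.
Implicit Types (B J : G -> set A) (f g : G -> A).

(* The fibres are subspaces of one C*-algebra but they need not be linearly
   independent there, nor even distinct. *)
Definition fell_bundle B : Prop :=
  [/\ forall t, closed_subspace (B t),
      forall t, cstar @` B t = B (t^-1)%g &
      forall s t a b, B s a -> B t b -> B (s * t)%g (cmul a b)].

Definition bundle_ideal B J : Prop :=
  [/\ forall t, closed_subspace (J t),
      forall t, J t `<=` B t &
      forall s t a b,
        (B s a -> J t b -> J (s * t)%g (cmul a b)) /\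
        (J s a -> B t b -> J (s * t)%g (cmul a b))].

(* The external direct sum of the B t: its elements are the finitely supported
   sections, and its operations are the pointwise linear ones together with
   the following product and involution. *)
Definition dsum B : set (G -> A) :=
  [set f | (forall t, B t (f t)) /\ finite_set [set t | f t != 0]].

Definition dsum_mul f g : G -> A :=
  fun t => \sum_(s \in [set: G]) cmul (f s) (g (s^-1 * t)%g).

Definition dsum_star f : G -> A := fun t => cstar (f (t^-1)%g).

Definition dsum_single (t : G) (a : A) : G -> A :=
  fun s => if s == t then a else 0.

Definition dsum_cstar_norm B (p : (G -> A) -> R[i]) : Prop :=
  [/\ forall f g, dsum B f -> dsum B g -> p (f + g) <= p f + p g,
      forall (c : R[i]) f, dsum B f -> p (c *: f) = `|c| * p f,
      forall f, dsum B f -> p f = 0 -> f = 0,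
      forall f g, dsum B f -> dsum B g -> p (dsum_mul f g) <= p f * p g &
      forall f, dsum B f -> p (dsum_mul (dsum_star f) f) = p f ^+ 2].

Definition topologically_graded_norm B (p : (G -> A) -> R[i]) : Prop :=
  dsum_cstar_norm B p /\ forall f, dsum B f -> `|f 1%g| <= p f.

Definition reduced_norm B (p : (G -> A) -> R[i]) : Prop :=
  topologically_graded_norm B p /\
  forall q, topologically_graded_norm B q -> forall f, dsum B f -> p f <= q f.

(* C, together with the *-homomorphism iota, is a completion of the direct sum
   for the reduced norm, that is, a copy of the reduced cross-sectional
   algebra.  Only the values of iota on dsum B matter. *)
Definition reduced_algebra B (C : cstarAlgType R) (iota : (G -> A) -> C)
    : Prop :=
  [/\ forall (c : R[i]) f g, dsum B f -> dsum B g ->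
        iota (c *: f + g) = c *: iota f + iota g,
      forall f g, dsum B f -> dsum B g ->
        iota (dsum_mul f g) = cmul (iota f) (iota g),
      forall f, dsum B f -> iota (dsum_star f) = cstar (iota f),
      reduced_norm B (fun f => `|iota f|) &
      closure (iota @` dsum B) = setT].

Section Ideals.
Variables (B : G -> set A) (C : cstarAlgType R) (iota : (G -> A) -> C).

(* The contractive linear extension to C of the projection of the direct sum
   onto B t.  It exists and is unique when reduced_algebra B iota holds, by
   density of the direct sum. *)
Definition fourier_coef (t : G) : C -> A :=
  get [set F : C -> A |
    [/\ linear F,
        forall x, `|F x| <= `|x|,
        forall x, B t (F x) &
        forall f, dsum B f -> F (iota f) = f t]].

Definition fourier_ideal (I : set C) : Prop :=
  cstar_ideal I /\
  forall t x, I x -> I (iota (dsum_single t (fourier_coef t x))).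

Definition graded_ideal (I : set C) : Prop :=
  cstar_ideal I /\
  I = smallest (@cstar_ideal R C)
        (I `&` (fun b => iota (dsum_single 1%g b)) @` B 1%g).

End Ideals.
End Bundle.

(* Q, with the maps q t : B t -> Q t, is a copy of the Fell bundle B/J with
   fibres the Banach spaces B t / J t, realised inside a C*-algebra D. *)
Definition quotient_bundle (A D : cstarAlgType R) (B J : G -> set A)
    (Q : G -> set D) (q : G -> A -> D) : Prop :=
  [/\ fell_bundle Q,
      forall t (c : R[i]) a b, B t a -> B t b ->
        q t (c *: a + b) = c *: q t a + q t b,
      forall t, q t @` B t = Q t,
      forall t b, B t b ->
        [/\ q t b = 0 <-> J t b,
            complex.Re `|q t b| = inf [set complex.Re `|b - j| | j in J t] &
            q (t^-1)%g (cstar b) = cstar (q t b)] &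
      forall s t a b, B s a -> B t b ->
        q (s * t)%g (cmul a b) = cmul (q s a) (q t b)].

(* The quotient bundle and the three reduced algebras are determined up to
   canonical isomorphism, and phi and psi by density, so the choice of copies
   is immaterial; asking for their existence keeps the condition from holding
   vacuously. *)
Definition exact_bundle (A : cstarAlgType R) (B : G -> set A) : Prop :=
  forall J : G -> set A, bundle_ideal B J ->
  exists (D : cstarAlgType R) (Q : G -> set D) (q : G -> A -> D)
    (CJ CB CQ : cstarAlgType R) (iJ : (G -> A) -> CJ) (iB : (G -> A) -> CB)
    (iQ : (G -> D) -> CQ) (phi : CJ -> CB) (psi : CB -> CQ),
  [/\ quotient_bundle B J Q q,
      [/\ reduced_algebra J iJ, reduced_algebra B iB & reduced_algebra Q iQ],
      star_hom phi /\ (forall f, dsum J f -> phi (iJ f) = iB f),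
      star_hom psi /\
        (forall f, dsum B f -> psi (iB f) = iQ (fun t => q t (f t))) &
      short_exact phi psi].

End FellBundles.

(* Main.v *)
From HB Require Import structures.
Require Import Defs.
From mathcomp Require Import all_boot all_order all_algebra.
From mathcomp Require Import complex.
From mathcomp Require Import all_classical all_reals all_analysis.
From mathcomp Require Import lra finmap.

Set Implicit Arguments.
Unset Strict Implicit.
Unset Printing Implicit Defensive.

Import Order.TTheory GRing.Theory Num.Theory.
Import numFieldNormedType.Exports.

Local Open Scope classical_set_scope.
Local Open Scope ring_scope.
Local Open Scope complex_scope.

(** Why the theorem holds.  Write F_t for the coefficient maps on C = C*_r(B) and,
    for an ideal J of the bundle, K_J for the set of all x with F_t(x) in J_t for
    every t.  This is a closed ideal which is Fourier and meets B_t in J_t.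

    The reduced norm is characterized by its coefficients: a completion of the
    direct sum for a topologically graded norm is the reduced one if and only if
    an element with zero coefficients is zero (faithful_reduced,
    reduced_faithful).  By this criterion C/K_J is the reduced algebra of B/J and
    the closure of the direct sum of J is the reduced algebra of J.  Therefore
    exactness at J says that K_J is that closure, which is the ideal generated by
    J_1: it says that K_J is graded.  If all Fourier ideals are graded then so are
    the K_J (graded_exact_at).  Conversely a Fourier ideal I lies in K_J for J_t
    the intersection of I with B_t, and it contains the ideal generated by J_1;
    if the latter is K_J, then I is graded (exact_graded).

    One half of the criterion is soft: dividing by the closed ideal of elements
    with zero coefficients gives a topologically graded norm, which cannot be
    smaller than the minimal one.  For the other half suppose that q is another
    topologically graded norm with q(f) < |f|, scaled so that q(f) < 1 < |f|, and
    let h = f^* f.  The positive part of h - 1 is a nonzero square x^2 dominated by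
    a constant times h^n for every n (square_below_powers).  The unit coefficient
    is positive, so that of x^2 is bounded by a constant times
    |F_1(h^n)| <= q(f)^(2n), which tends to 0; since |F_t(x)|^2 <= |F_1(x^* x)|, all
    coefficients of x vanish.

    The C*-theory that this needs has a direct elementary route.  The equation
    2y = z + y^2 has a solution whenever |z| <= 1 (half_sqrt), and
    |x|^2 <= |x^2 + y^2| for commuting self-adjoint x, y (two_squares).  Together
    they give the continuity of C*-seminorms (cseminorm_le), and, in the
    unitization, square roots, the order, positivity of x^* x (pos_starM) and
    approximate units adapted to a single element (approx_unit), hence the
    C*-identity in quotients. *)

Local Notation "x ** y" := (cmul x y) (at level 40, left associativity).

(** * Norms, completeness and sequences with real values *)

Section Norms.
Variable R : realType.

(** Norms over R[i] take their values in R[i].  Their real parts carry the same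
    information and are open to linear arithmetic. *)
Definition nrm (V : normedModType R[i]) (x : V) : R := complex.Re `|x|.

Definition cabs (c : R[i]) : R := complex.Re `|c|.

Lemma ge0_ReK (z : R[i]) : 0 <= z -> (complex.Re z)%:C = z.
Proof. by case: z => a b; rewrite lecE /= => /andP[/eqP -> _]. Qed.

Lemma cabsE c : `|c| = (cabs c)%:C.
Proof. by rewrite ge0_ReK ?normr_ge0. Qed.

Lemma cabsR (r : R) : cabs r%:C = `|r|.
Proof. by rewrite /cabs normc_def /= expr0n /= addr0 sqrtr_sqr. Qed.

Lemma cabs0 : cabs 0 = 0.
Proof. by rewrite /cabs normr0. Qed.

Lemma cabsN1 : cabs (- 1) = 1.
Proof. by rewrite /cabs normrN normr1. Qed.

Lemma cabs_ge0 c : 0 <= cabs c.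
Proof. by rewrite -lecR -cabsE normr_ge0. Qed.

Lemma cabs_eq0 c : cabs c = 0 -> c = 0.
Proof. by move=> h; apply/eqP; rewrite -normr_eq0 cabsE h. Qed.

Lemma cabsM c d : cabs (c * d) = cabs c * cabs d.
Proof. by apply: (@complexI R); rewrite rmorphM /= -!cabsE normrM. Qed.

Lemma cabs_conj c : cabs (c^*)%R = cabs c.
Proof. by apply: (@complexI R); rewrite -!cabsE norm_conjC. Qed.

Section NormedModule.
Variable V : normedModType R[i].
Implicit Types x y : V.

Lemma nrmE x : `|x| = (nrm x)%:C.
Proof. by rewrite ge0_ReK ?normr_ge0. Qed.

Lemma nrm_ge0 x : 0 <= nrm x.
Proof. by rewrite -lecR -nrmE normr_ge0. Qed.

Lemma nrm0 : nrm (0 : V) = 0.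
Proof. by rewrite /nrm normr0. Qed.

Lemma nrm_eq0 x : nrm x = 0 -> x = 0.
Proof. by move=> h; apply/eqP; rewrite -normr_eq0 nrmE h. Qed.

Lemma nrm_gt0 x : x <> 0 -> 0 < nrm x.
Proof.
by move=> x0; rewrite lt_neqAle nrm_ge0 andbT; apply/eqP => /esym /nrm_eq0.
Qed.

Lemma ler_nrmD x y : nrm (x + y) <= nrm x + nrm y.
Proof. by rewrite -lecR rmorphD /= -!nrmE ler_normD. Qed.

Lemma nrmN x : nrm (- x) = nrm x.
Proof. by rewrite /nrm normrN. Qed.

Lemma nrmB x y : nrm (x - y) = nrm (y - x).
Proof. by rewrite /nrm distrC. Qed.

Lemma ler_nrmB x y : nrm (x - y) <= nrm x + nrm y.
Proof. by rewrite -[nrm y]nrmN; exact: ler_nrmD. Qed.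

Lemma ler_nrm_dist z x y : nrm (x - y) <= nrm (x - z) + nrm (z - y).
Proof. by rewrite -[x - y](subrKA z); exact: ler_nrmD. Qed.

Lemma ler_dist_nrm x y : nrm x <= nrm y + nrm (x - y).
Proof. by rewrite -{1}[x](subrK y) addrC; exact: ler_nrmD. Qed.

Lemma nrmZ c x : nrm (c *: x) = cabs c * nrm x.
Proof. by apply: (@complexI R); rewrite rmorphM /= -nrmE normrZ nrmE cabsE. Qed.

Lemma nrmZR (r : R) x : nrm (r%:C *: x) = `|r| * nrm x.
Proof. by rewrite nrmZ cabsR. Qed.

Lemma closureP (S : set V) x :
  closure S x <-> forall e, 0 < e -> exists2 y, S y & nrm (x - y) < e.
Proof.
split=> [cx e e0|h U].
- have eC : (0 : R[i]) < e%:C by rewrite ltcR.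
  have [y [Sy]] := cx _ (nbhsx_ballx x _ eC).
  by rewrite -ball_normE /= nrmE ltcR; exists y.
- move/nbhs_ballP => [e /= e0]; have e0' := ltW e0.
  rewrite -(ge0_ReK e0') ltcR in e0 *.
  move=> sub; have [y Sy xy] := h _ e0.
  by exists y; split=> //; apply: sub; rewrite -ball_normE /= nrmE ltcR.
Qed.

Lemma closedP (S : set V) : closed S <->
  forall x, (forall e, 0 < e -> exists2 y, S y & nrm (x - y) < e) -> S x.
Proof.
split=> [cS x h|h x /closureP]; last exact: h.
by apply: cS; apply/closureP.
Qed.

Definition tends (u : nat -> V) x :=
  forall e, 0 < e -> exists N, forall n, (N <= n)%N -> nrm (x - u n) < e.

Lemma closed_tends (S : set V) u x :
  closed S -> (forall n, S (u n)) -> tends u x -> S x.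
Proof.
move=> /closedP cS Su ux; apply: cS => e e0.
by have [N h] := ux e e0; exists (u N); rewrite ?h.
Qed.

Lemma inv_lt (e : R) : 0 < e -> exists N, forall n, (N <= n)%N -> n.+1%:R^-1 < e.
Proof.
move=> e0; exists (Num.bound e^-1) => n Nn.
rewrite -[ltRHS]invrK ltf_pV2 ?posrE ?invr_gt0 //.
apply: lt_trans (archi_boundP _) _; first by rewrite invr_ge0 ltW.
by rewrite ltr_nat ltnS.
Qed.

Lemma tends_uniq u x y : tends u x -> tends u y -> x = y.
Proof.
move=> ux uy; apply/subr0_eq/nrm_eq0/eqP; apply: contraT => n0.
have e0 : 0 < nrm (x - y) / 2 by rewrite divr_gt0 // lt_neqAle eq_sym n0 nrm_ge0.
have [N hN] := ux _ e0; have [M hM] := uy _ e0.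
have h1 := hN _ (leq_maxl N M); have h2 := hM _ (leq_maxr N M).
have := ler_nrm_dist (u (maxn N M)) x y; rewrite [nrm (u _ - y)]nrmB => h3.
by lra.
Qed.

End NormedModule.

Lemma nrm_le (V W : normedModType R[i]) (x : V) (w : W) :
  (`|x| <= `|w|) = (nrm x <= nrm w).
Proof. by rewrite !nrmE lecR. Qed.

Lemma mono_cauchy (r : nat -> R) M : (forall n, r n <= r n.+1) ->
  (forall n, r n <= M) ->
  forall e, 0 < e -> exists N, forall n, (N <= n)%N -> r n - r N < e.
Proof.
move=> rS rM e e0.
have hs : has_sup (range r).
  by split; [exists (r 0%N), 0%N | exists M => _ [n _ <-]].
have [_ [N _ <-] hN] := sup_adherent e0 hs.
exists N => n _; have : r n <= sup (range r).
  by apply: sup_upper_bound => //; exists n.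
by lra.
Qed.

Lemma telescope_le (V : normedModType R[i]) (u : nat -> V) (r : nat -> R) :
  (forall n, nrm (u n.+1 - u n) <= r n.+1 - r n) ->
  forall N n, (N <= n)%N -> nrm (u n - u N) <= r n - r N.
Proof.
move=> ur N n; elim: n => [|n IH]; first by rewrite leqn0 => /eqP ->; rewrite !subrr nrm0.
rewrite leq_eqVlt => /predU1P[->|]; first by rewrite !subrr nrm0.
rewrite ltnS => /IH h.
have := ler_nrm_dist (u n) (u n.+1) (u N); have := ur n; lra.
Qed.

(** In a complete space a sequence whose steps are dominated by those of a
    bounded monotone real sequence converges. *)
Lemma dominated_tends (V : completeNormedModType R[i]) (u : nat -> V)
    (r : nat -> R) M :
  (forall n, nrm (u n.+1 - u n) <= r n.+1 - r n) -> (forall n, r n <= M) ->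
  exists x, tends u x.
Proof.
move=> ur rM.
have rS n : r n <= r n.+1 by have := ur n; have := nrm_ge0 (u n.+1 - u n); lra.
have cu : cauchy (u @ \oo).
  apply: cauchy_exP => _/posnumP[e]; have e0 := ltW [gt0 of e%:num].
  have : (0 : R[i]) < e%:num by [].
  rewrite -(ge0_ReK e0) ltcR => e0'.
  have [N hN] := mono_cauchy rS rM e0'.
  exists (u N); exists N => // n /= Nn.
  rewrite -ball_normE /= nrmE ltcR nrmB.
  by apply: le_lt_trans (telescope_le ur Nn) _; exact: hN.
have /cauchy_cvg/(cvg_ex _).1 [x ux] := cu.
exists x => e e0; have eC : (0 : R[i]) < e%:C by rewrite ltcR.
have [N _ hN] := ux _ (nbhsx_ballx x _ eC).
by exists N => n /hN; rewrite -ball_normE /= nrmE ltcR.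
Qed.

(** Conversely, it suffices for completeness that sequences with steps bounded
    by 2^-n converge: such a sequence can be extracted from any Cauchy filter. *)
Lemma complete_of_rapid (V : normedModType R[i]) :
  (forall u : nat -> V, (forall n, nrm (u n.+1 - u n) <= 2^-1 ^+ n) ->
    exists x, tends u x) ->
  forall F : set_system V, ProperFilter F -> cauchy F -> cvg F.
Proof.
move=> rapid F FF cF.
(* The factor 1/4 puts consecutive terms of the sequence within 2^-n. *)
pose d n : R := 2^-1 ^+ n / 4.
have d0 n : 0 < d n by rewrite divr_gt0 // exprn_gt0 // invr_gt0.
have ex n : exists x, F [set y | nrm (x - y) < d n].
  have dC : (0 : R[i]) < (d n)%:C by rewrite ltcR.
  have [x Fx] := (cauchyP F).1 cF _ dC; exists x.
  by apply: filterS Fx => y; rewrite -ball_normE /= nrmE ltcR.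
have [u hu] := choice ex.
have near_u n m : nrm (u n - u m) < d n + d m.
  have [y [/= h1 h2]] := @filter_ex _ _ _ _ (filterI (hu n) (hu m)).
  have := ler_nrm_dist y (u n) (u m); rewrite [nrm (y - _)]nrmB; lra.
have [n|x ux] := rapid u.
  have := near_u n.+1 n; rewrite /d exprS.
  have : 0 < (2^-1 : R) ^+ n by rewrite exprn_gt0 // invr_gt0.
  set t := _ ^+ n; lra.
apply/cvg_ex; exists x => U /nbhs_ballP[e /= e0 sub].
have e0' := ltW e0; rewrite -(ge0_ReK e0') in sub e0; rewrite ltcR in e0.
have e2 : 0 < complex.Re e / 2 by rewrite divr_gt0.
have [N hN] := ux _ e2.
have [M hM] := inv_lt e2.
have dM : d (maxn N M) < complex.Re e / 2.
  apply: le_lt_trans (hM _ (leq_maxr N M)).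
  set k := maxn N M; rewrite /d.
  have : (2^-1 : R) ^+ k <= k.+1%:R^-1.
    rewrite exprVn lef_pV2 ?posrE ?exprn_gt0 // -natrX ler_nat.
    exact: ltn_expl.
  have : 0 < (2^-1 : R) ^+ k by rewrite exprn_gt0 // invr_gt0.
  by move: (_ ^+ k) (k.+1%:R^-1) => a b; lra.
apply: filterS (hu (maxn N M)) => y /= h; apply: sub.
rewrite -ball_normE /= nrmE ltcR.
have := hN _ (leq_maxl N M); have := ler_nrm_dist (u (maxn N M)) x y; lra.
Qed.

End Norms.

Lemma mono_tends (R : realType) (r : nat -> R) M : (forall n, r n <= r n.+1) ->
  (forall n, r n <= M) ->
  exists l, forall e, 0 < e -> exists N, forall n, (N <= n)%N -> `|l - r n| < e.
Proof.
move=> rS rM; exists (sup (range r)) => e e0.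
have hs : has_sup (range r).
  by split; [exists (r 0%N), 0%N | exists M => _ [n _ <-]].
have [_ [N _ <-] hN] := sup_adherent e0 hs.
exists N => n Nn; have h1 : r n <= sup (range r).
  by apply: sup_upper_bound => //; exists n.
have h2 : r N <= r n by apply: (nondecreasing_seqP r).1 Nn.
by rewrite ger0_norm; lra.
Qed.

Lemma real_rapid (R : realType) (r : nat -> R) :
  (forall n, `|r n.+1 - r n| <= 2^-1 ^+ n) ->
  exists l, forall e, 0 < e -> exists N, forall n, (N <= n)%N -> `|l - r n| < e.
Proof.
move=> rd; pose s n : R := - (2 * 2^-1 ^+ n).
have sS n : s n.+1 - s n = 2^-1 ^+ n by rewrite /s exprS; lra.
have sM n : s n <= 0 by rewrite oppr_le0 mulr_ge0 // exprn_ge0 // invr_ge0.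
have d n : - (s n.+1 - s n) <= r n.+1 - r n <= s n.+1 - s n.
  by rewrite -ler_norml sS rd.
have [n|n|l hl] := @mono_tends _ (fun n => r n + s n) (r 0%N - s 0%N).
- by have := d n; lra.
- suff : r n - s n <= r 0%N - s 0%N by have := sM n; lra.
  by elim: n => // n; have := d n; lra.
have sS' n : s n <= s n.+1 by have := d n; lra.
have [m hm] := mono_tends sS' sM.
exists (l - m) => e e0; have e2 : 0 < e / 2 by rewrite divr_gt0.
have [N hN] := hl _ e2; have [N' hN'] := hm _ e2.
exists (maxn N N') => n; rewrite geq_max => /andP[/hN h1 /hN' h2].
have -> : l - m - r n = (l - (r n + s n)) - (m - s n) by lra.
by apply: le_lt_trans (ler_normB _ _) _; lra.
Qed.

Lemma cabs_ReIm (R : realType) (c : R[i]) :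
  [/\ `|complex.Re c| <= cabs c, `|complex.Im c| <= cabs c &
      cabs c <= `|complex.Re c| + `|complex.Im c|].
Proof.
case: c => a b; rewrite /cabs normc_def /=.
split.
- by rewrite -sqrtr_sqr ler_wsqrtr // lerDl sqr_ge0.
- by rewrite -sqrtr_sqr ler_wsqrtr // lerDr sqr_ge0.
- rewrite -[leRHS]ger0_norm ?addr_ge0 // -sqrtr_sqr ler_wsqrtr //.
  rewrite sqrrD !real_normK ?num_real //.
  by rewrite addrAC lerDl mulrn_wge0 // mulr_ge0.
Qed.

(** Completeness of the scalars, for the scalar part of the unitization. *)
Lemma complex_rapid (R : realType) (u : nat -> R[i]) :
  (forall n, cabs (u n.+1 - u n) <= 2^-1 ^+ n) ->
  exists l, forall e, 0 < e -> exists N, forall n, (N <= n)%N -> cabs (l - u n) < e.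
Proof.
move=> ud.
have [n|a ha] := @real_rapid _ (fun n => complex.Re (u n)).
  rewrite -raddfB /=; apply: le_trans (ud n).
  by have [] := cabs_ReIm (u n.+1 - u n).
have [n|b hb] := @real_rapid _ (fun n => complex.Im (u n)).
  rewrite -raddfB /=; apply: le_trans (ud n).
  by have [] := cabs_ReIm (u n.+1 - u n).
exists (a +i* b) => e e0; have e2 : 0 < e / 2 by rewrite divr_gt0.
have [N hN] := ha _ e2; have [N' hN'] := hb _ e2.
exists (maxn N N') => n; rewrite geq_max => /andP[/hN h1 /hN' h2].
have [_ _] := cabs_ReIm ((a +i* b) - u n).
by case: (u n) h1 h2 => x y /=; lra.
Qed.

(** * C*-algebras, C*-seminorms and automatic continuity *)

Section Basics.
Variables (R : realType) (A : cstarAlgType R).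
Implicit Types x y z : A.

Lemma cmul0x x : 0 ** x = 0.
Proof. by apply: (addIr (0 ** x)); rewrite -cmulDl !add0r. Qed.

Lemma cmulx0 x : x ** 0 = 0.
Proof. by apply: (addIr (x ** 0)); rewrite -cmulDr !add0r. Qed.

Lemma cmulNx x y : (- x) ** y = - (x ** y).
Proof. by apply/eqP; rewrite -subr_eq0 opprK -cmulDl addNr cmul0x. Qed.

Lemma cmulxN x y : x ** (- y) = - (x ** y).
Proof. by apply/eqP; rewrite -subr_eq0 opprK -cmulDr addNr cmulx0. Qed.

Lemma cmulBl x y z : (x - y) ** z = x ** z - y ** z.
Proof. by rewrite cmulDl cmulNx. Qed.

Lemma cmulBr x y z : x ** (y - z) = x ** y - x ** z.
Proof. by rewrite cmulDr cmulxN. Qed.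

Lemma cstar0 : cstar (0 : A) = 0.
Proof. by rewrite -(scale0r (0 : A)) cstarZ conjC0 !scale0r. Qed.

Lemma cstarN x : cstar (- x) = - cstar x.
Proof. by apply/eqP; rewrite -subr_eq0 opprK -cstarD addNr cstar0. Qed.

Lemma cstarB x y : cstar (x - y) = cstar x - cstar y.
Proof. by rewrite cstarD cstarN. Qed.

Lemma conjR (r : R) : ((r%:C)^*)%R = r%:C.
Proof. by rewrite conj_Creal // complex_real eqxx. Qed.

Lemma cstarZR (r : R) x : cstar (r%:C *: x) = r%:C *: cstar x.
Proof. by rewrite cstarZ conjR. Qed.

Lemma nrm_cmul x y : nrm (x ** y) <= nrm x * nrm y.
Proof. by rewrite -lecR rmorphM /= -!nrmE cnormM. Qed.

Lemma nrm_starM x : nrm (cstar x ** x) = nrm x ^+ 2.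
Proof. by apply: (@complexI R); rewrite rmorphXn /= -!nrmE cnorm_star. Qed.

Lemma nrm_star_le x : nrm x <= nrm (cstar x).
Proof.
have [->|/eqP x0] := eqVneq x 0; first by rewrite cstar0.
have := nrm_cmul (cstar x) x; rewrite nrm_starM expr2 ler_pM2r //.
exact: nrm_gt0.
Qed.

Lemma nrm_star x : nrm (cstar x) = nrm x.
Proof.
apply/eqP; rewrite eq_le nrm_star_le andbT.
by rewrite -{2}[x]cstarK nrm_star_le.
Qed.

Lemma nrm_Mstar x : nrm (x ** cstar x) = nrm x ^+ 2.
Proof. by rewrite -{1}[x]cstarK nrm_starM nrm_star. Qed.

Lemma closed_subspace_ops (S : set A) : closed_subspace S ->
  [/\ closed S, S 0, forall x y, S x -> S y -> S (x + y),
      forall x, S x -> S (- x) & forall (c : R[i]) x, S x -> S (c *: x)].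
Proof.
case=> cS S0 SD; split=> // [x y Sx Sy|x Sx|c x Sx].
- by rewrite -[x]scale1r; apply: SD.
- by rewrite -scaleN1r -[_ *: x]addr0; apply: SD.
- by rewrite -[_ *: x]addr0; apply: SD.
Qed.

(** The fixed point y of y = (z + y^2)/2 satisfies (1 - y)^2 = 1 - z in
    the unitization: the square root of 1 - z without leaving the algebra.  The
    iteration from 0 is dominated by the same iteration for z = 1 in the reals,
    and T collects whatever closed conditions the iteration preserves. *)
Lemma half_sqrt z (T : set A) : nrm z <= 1 -> closed T -> T 0 ->
  (forall y, T y -> T ((2^-1)%:C *: (z + y ** y))) ->
  exists y, [/\ T y, nrm y <= 1 & 2%:R%:C *: y = z + y ** y].
Proof.
move=> z1 cT T0 Tf; pose f y := (2^-1)%:C *: (z + y ** y).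
pose u n := iter n f 0; pose r n := iter n (fun t : R => (1 + t ^+ 2) / 2) 0.
have uE n : u n.+1 = f (u n) by [].
have rE n : r n.+1 = (1 + r n ^+ 2) / 2 by [].
have f_dist x y : nrm (f x - f y) <= (nrm x + nrm y) / 2 * nrm (x - y).
  rewrite -scalerBr nrmZR opprD addrACA subrr add0r.
  have -> : x ** x - y ** y = x ** (x - y) + (x - y) ** y.
    by rewrite cmulBl cmulBr addrA subrK.
  rewrite ger0_norm ?invr_ge0 //.
  have := ler_nrmD (x ** (x - y)) ((x - y) ** y).
  have := nrm_cmul x (x - y); have := nrm_cmul (x - y) y.
  set a := nrm (x - y); nra.
have r01 n : 0 <= r n <= 1.
  elim: n => [|n /andP[h0 h1]]; first by rewrite lexx ler01.
  by rewrite rE !ler_pdivrMr ?divr_ge0 ?addr_ge0 ?sqr_ge0 //=; nra.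
have ur n : nrm (u n) <= r n.
  elim: n => [|n IH]; first by rewrite nrm0.
  rewrite uE rE {1}/f nrmZR ger0_norm ?invr_ge0 //.
  have := ler_nrmD z (u n ** u n); have := nrm_cmul (u n) (u n).
  have := nrm_ge0 (u n); nra.
have du n : nrm (u n.+1 - u n) <= r n.+1 - r n.
  elim: n => [|n IH].
    rewrite subr0 /= /f cmulx0 addr0 nrmZR ger0_norm ?invr_ge0 // expr0n /=.
    by rewrite addr0 mul1r subr0; have := nrm_ge0 z; nra.
  rewrite [u n.+2]uE {2}uE; apply: le_trans (f_dist _ _) _.
  rewrite [r n.+2]rE {2}rE.
  have := ur n; have := ur n.+1; have := nrm_ge0 (u n.+1 - u n).
  have := nrm_ge0 (u n); have := nrm_ge0 (u n.+1).
  move: (nrm (u n.+1 - u n)) (nrm _) (nrm _) (r n) (r n.+1) IH => d a b s t.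
  nra.
have [y uy] := dominated_tends du (fun n => proj2 (andP (r01 n))).
have Ty : T y.
  apply: closed_tends uy => // n; elim: n => [//|n IH]; rewrite uE; exact: Tf.
have y1 : nrm y <= 1.
  apply/ler_addgt0Pr => e e0; have [N hN] := uy e e0.
  have := hN N (leqnn N); have := ler_dist_nrm y (u N); have := ur N.
  by have /andP[_] := r01 N; lra.
exists y; split=> //.
suff fy : f y = y.
  by rewrite -{1}fy /f scalerA -rmorphM /= mulfV ?pnatr_eq0 // rmorph1 scale1r.
apply: (@tends_uniq _ _ (fun n => u n.+1)).
- suff fr n : nrm (f y - u n.+1) <= nrm (y - u n).
    by move=> e e0; have [N hN] := uy e e0; exists N => n /hN; exact: le_lt_trans.
  rewrite uE; apply: le_trans (f_dist _ _) _.
  by have := ur n; have /andP[_] := r01 n; have := nrm_ge0 (y - u n); nra.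
- by move=> e e0; have [N hN] := uy e e0; exists N => n Nn; apply/hN/leqW.
Qed.

Definition cstar_subalg (S : set A) : Prop :=
  [/\ closed_subspace S, forall x y, S x -> S y -> S (x ** y) &
      forall x, S x -> S (cstar x)].

(** A C*-seminorm on a *-subalgebra, not assumed to be continuous. *)
Definition cseminorm (S : set A) (p : A -> R) : Prop :=
  [/\ forall x y, S x -> S y -> p (x + y) <= p x + p y,
      forall (c : R[i]) x, S x -> p (c *: x) = cabs c * p x,
      forall x y, S x -> S y -> p (x ** y) <= p x * p y &
      forall x, S x -> p (cstar x ** x) = p x ^+ 2].

Lemma cseminorm_ge0 S p x : cstar_subalg S -> cseminorm S p -> S x -> 0 <= p x.
Proof.
move=> [/closed_subspace_ops [_ _ _ SN _] _ _] [pD pZ _ _] Sx.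
have := pD _ _ Sx (SN _ Sx); rewrite subrr -scaleN1r pZ //.
rewrite -[0](scale0r x) !pZ // cabsN1 cabs0; lra.
Qed.

Lemma cseminorm_star S p x : cstar_subalg S -> cseminorm S p -> S x ->
  p (cstar x) = p x.
Proof.
move=> hS hp.
have [_ _ pM pC] := hp; have [_ _ Ss] := hS.
have le y : S y -> p y <= p (cstar y).
  move=> Sy; have Sy' := Ss _ Sy; have := pM _ _ Sy' Sy; rewrite pC // expr2.
  have := cseminorm_ge0 hS hp Sy'; have := cseminorm_ge0 hS hp Sy.
  by rewrite le_eqVlt => /predU1P[<- //|y0] _; rewrite ler_pM2r.
move=> Sx; apply/eqP; rewrite eq_le (le _ Sx) andbT.
by rewrite -{2}[x]cstarK; apply/le/Ss.
Qed.

(** If x and y are commuting and self-adjoint, then x^2 + y^2 = z^* z for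
    z = x + iy, and x is the real part of z. *)
Lemma two_squares S p x y : cstar_subalg S -> cseminorm S p -> S x -> S y ->
  cstar x = x -> cstar y = y -> x ** y = y ** x ->
  p x ^+ 2 <= p (x ** x + y ** y).
Proof.
move=> hS hp Sx Sy xs ys xy.
have [/closed_subspace_ops [_ _ SD _ SZ] _ Ss] := hS.
pose z := x + 'i *: y.
have Sz : S z by apply/SD/SZ.
have zs : cstar z = x - 'i *: y.
  by rewrite cstarD cstarZ conjCi xs ys scaleNr.
have zz : cstar z ** z = x ** x + y ** y.
  rewrite zs cmulBl !cmulDr !cmulZl !cmulZr scalerA -expr2 sqrCi scaleN1r xy.
  by rewrite addrKA opprK.
have [pD pZ _ pC] := hp.
rewrite -zz pC // lerXn2r ?nnegrE ?(cseminorm_ge0 hS hp) //.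
have e : 2%:R%:C *: x = z + cstar z.
  by rewrite zs addrACA subrr addr0 rmorphD rmorph1 scalerDl scale1r.
have := pD _ _ Sz (Ss _ Sz); rewrite -e pZ // (cseminorm_star hS hp Sz) cabsR.
rewrite ger0_norm ?ler0n //; lra.
Qed.

Lemma nrm_cseminorm (S : set A) : cseminorm S (@nrm R A).
Proof.
split=> [x y _ _|c x _|x y _ _|x _]; first exact: ler_nrmD; first exact: nrmZ.
- exact: nrm_cmul.
- exact: nrm_starM.
Qed.

Lemma cstar_subalgT : cstar_subalg setT.
Proof. by split=> //; split=> //; exact: closedT. Qed.

Lemma nrm_two_squares x y : cstar x = x -> cstar y = y -> x ** y = y ** x ->
  nrm x ^+ 2 <= nrm (x ** x + y ** y).
Proof. by apply: (two_squares cstar_subalgT (nrm_cseminorm _)). Qed.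

Lemma bernoulli_pow (d : R) n : 0 <= d -> 1 + n%:R * d <= (1 + d) ^+ n.
Proof.
move=> d0; elim: n => [|n IH]; first by rewrite expr0 mul0r addr0.
rewrite exprS; apply: le_trans (ler_wpM2l _ IH); last by lra.
by rewrite -natr1; have := ler0n R n; nra.
Qed.

(** The constant 2 disappears on taking roots of order 2^n. *)
Lemma pow2_bound (a b : R) : 0 <= a -> 0 <= b ->
  (forall n, a ^+ (2 ^ n) <= 2 * b ^+ (2 ^ n)) -> a <= b.
Proof.
move=> a0 b0 h; rewrite leNgt; apply/negP => ab.
have := b0; rewrite le_eqVlt => /predU1P[e|bp].
  by have := h 0%N; rewrite -e !expr1 in ab *; lra.
pose d := a / b - 1.
have d0 : 0 < d by rewrite subr_gt0 ltr_pdivlMr // mul1r.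
have [N hN] := inv_lt d0.
have := bernoulli_pow (2 ^ N.+1) (ltW d0).
have -> : 1 + d = a / b by rewrite /d addrC subrK.
rewrite expr_div_n => /le_trans c2.
have : (a ^+ (2 ^ N.+1) / b ^+ (2 ^ N.+1)) <= 2.
  by rewrite ler_pdivrMr ?exprn_gt0.
move/c2; apply/negP; rewrite -ltNge.
have : N.+1%:R^-1 * N.+1%:R = 1 :> R by rewrite mulVf // pnatr_eq0.
have : N.+1%:R < (2 ^ N.+1)%:R :> R by rewrite ltr_nat ltn_expl.
have := hN N (leqnn N); have : (0 : R) < N.+1%:R by rewrite ltr0n.
have := d0; clear.
move: d (_^-1) ((2 ^ N.+1)%:R) => d i t; move: (N.+1%:R) => m.
nra.
Qed.

Lemma closed_commutant x : closed [set y | x ** y = y ** x].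
Proof.
apply/closedP => y h; apply/subr0_eq/nrm_eq0/eqP.
rewrite eq_le nrm_ge0 andbT; apply/ler_addgt0Pr => e e0; rewrite add0r.
have K0 : 0 < 2 * (nrm x + 1) by have := nrm_ge0 x; lra.
have [z /= xz yz] := h _ (divr_gt0 e0 K0).
have -> : x ** y - y ** x = x ** (y - z) - (y - z) ** x.
  by rewrite cmulBr cmulBl xz opprB addrA subrK.
have := ler_nrmB (x ** (y - z)) ((y - z) ** x).
have := nrm_cmul x (y - z); have := nrm_cmul (y - z) x.
move: yz; rewrite ltr_pdivlMr //; have := nrm_ge0 (y - z); have := nrm_ge0 x.
nra.
Qed.

Lemma closed_selfadj : closed [set y : A | cstar y = y].
Proof.
apply/closedP => y h; apply/subr0_eq/nrm_eq0/eqP.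
rewrite eq_le nrm_ge0 andbT; apply/ler_addgt0Pr => e e0; rewrite add0r.
have e2 : 0 < e / 2 by rewrite divr_gt0.
have [z /= zs yz] := h _ e2.
have := ler_nrm_dist z (cstar y) y; rewrite -{1}zs -cstarB nrm_star [nrm (z - y)]nrmB.
lra.
Qed.

(** A self-adjoint k with |k| <= 1 satisfies p k <= 2: the solution y of
    2y = k^2 + y^2 has p(y)^2 <= p(2y), so p(y) <= 2, and p(k)^2 <= p(2y).
    Applied to the powers of k this improves to p <= |.|. *)
Lemma cseminorm_le S p x : cstar_subalg S -> cseminorm S p -> S x -> p x <= nrm x.
Proof.
move=> hS hp.
have p0 y := @cseminorm_ge0 S p y hS hp.
have [sS SM Ss] := hS; have [cS S0 SD SN SZ] := closed_subspace_ops sS.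
have [pD pZ pM pC] := hp.
have le2 k : S k -> cstar k = k -> nrm k <= 1 -> p k <= 2.
  move=> Sk ks k1.
  have [||||y [[[Sy ys] yk] _ yE]] := @half_sqrt (k ** k)
      (S `&` [set y | cstar y = y] `&` [set y | k ** y = y ** k]).
  - by apply: le_trans (nrm_cmul _ _) _; have := nrm_ge0 k; nra.
  - exact (closedI (closedI cS closed_selfadj) (@closed_commutant k)).
  - by split; [split => //=; exact: cstar0|rewrite /= cmulx0 cmul0x].
  - move=> y [[Sy ys] yk]; split; first split.
    + by apply/SZ/SD/SM => //; exact: SM.
    + by rewrite /= cstarZR cstarD !cstarM /= ks ys.
    + by rewrite /= in yk *; rewrite cmulZr cmulZl cmulDr cmulDl !cmulA yk -!cmulA yk.
  rewrite /= in ys yk.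
  have h1 := two_squares hS hp Sk Sy ks ys yk.
  have h2 := two_squares hS hp Sy Sk ys ks (esym yk).
  rewrite addrC in h2; rewrite -yE pZ // cabsR ger0_norm ?ler0n // in h1 h2.
  have y2 : p y <= 2 by have := p0 _ Sy; nra.
  by have := p0 _ Sk; nra.
have le2n k : S k -> cstar k = k -> p k <= 2 * nrm k.
  move=> Sk ks; have [->|/eqP k0] := eqVneq k 0.
    by rewrite nrm0 -(scale0r 0) pZ // cabs0 mul0r mulr0.
  have kp := nrm_gt0 k0.
  have ki : 0 < (nrm k)^-1 by rewrite invr_gt0.
  have := le2 ((nrm k)^-1%:C *: k) (SZ _ _ Sk).
  rewrite cstarZR ks nrmZR pZ // cabsR gtr0_norm // mulVf ?gt_eqF // lexx.
  by move=> /(_ erefl isT); rewrite mulrC ler_pdivrMr.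
have lesa k : S k -> cstar k = k -> p k <= nrm k.
  move=> Sk ks; apply: pow2_bound; [exact: p0|exact: nrm_ge0|move=> n].
  suff [z [Sz zs <- <-]] : exists z, [/\ S z, cstar z = z,
      p z = p k ^+ (2 ^ n) & nrm z = nrm k ^+ (2 ^ n)] by exact: le2n.
  elim: n => [|n [z [Sz zs pz nz]]]; first by exists k.
  exists (z ** z); split; first exact: SM.
  - by rewrite cstarM zs.
  - by rewrite -{1}zs pC // pz -exprM -expnSr.
  - by rewrite -{1}zs nrm_starM nz -exprM -expnSr.
move=> Sx; have Sxx : S (cstar x ** x) by apply: SM => //; exact: Ss.
have := lesa _ Sxx; rewrite cstarM cstarK => /(_ erefl).
by rewrite pC // nrm_starM ler_pXn2r ?nnegrE ?nrm_ge0 ?p0.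
Qed.

End Basics.

(** * The unitization of a C*-algebra *)

Definition unitz (R : realType) (A : cstarAlgType R) : Type := (A * R[i]^o)%type.

HB.instance Definition _ (R : realType) (A : cstarAlgType R) :=
  GRing.Lmodule.copy (unitz A) (A * R[i]^o)%type.

Section Unitization.
Variables (R : realType) (A : cstarAlgType R).
Implicit Types (u v w : unitz A) (b : A).

Definition umul u v : unitz A :=
  (u.1 ** v.1 + u.2 *: v.1 + v.2 *: u.1, u.2 * v.2).
Definition ustar u : unitz A := (cstar u.1, (u.2^*)%R).
Definition uact u b : A := u.1 ** b + u.2 *: b.
Definition uact_norm u : R := sup [set nrm (uact u b) | b in [set b | nrm b <= 1]].
(** The C*-norm of the unitization; the scalar part is needed when the algebra
    has a unit already, since the action is not faithful then. *)
Definition unorm u : R := Num.max (cabs u.2) (uact_norm u).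

Lemma uactZ u c b : uact u (c *: b) = c *: uact u b.
Proof. by rewrite /uact cmulZr scalerDr !scalerA mulrC. Qed.

Lemma uactM u v b : uact (umul u v) b = uact u (uact v b).
Proof.
rewrite /uact /= !(cmulDl, cmulDr, cmulZl, cmulZr, cmulA) scalerDr scalerA.
by rewrite !addrA; congr (_ + _); rewrite -!addrA; congr (_ + _); rewrite addrC.
Qed.

Lemma uact_bounded u b : nrm (uact u b) <= (nrm u.1 + cabs u.2) * nrm b.
Proof.
apply: le_trans (ler_nrmD _ _) _; rewrite mulrDl nrmZ lerD2r.
exact: nrm_cmul.
Qed.

Lemma uact_has_sup u :
  has_sup [set nrm (uact u b) | b in [set b | nrm b <= 1]].
Proof.
split; first by exists (nrm (uact u 0)), 0 => //=; rewrite nrm0.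
exists (nrm u.1 + cabs u.2) => _ [b /= b1 <-].
apply: le_trans (uact_bounded _ _) _; rewrite ler_piMr //.
by rewrite addr_ge0 ?nrm_ge0 ?cabs_ge0.
Qed.

Lemma uact_le u b : nrm (uact u b) <= unorm u * nrm b.
Proof.
have [->|/eqP b0] := eqVneq b 0.
  by rewrite /uact cmulx0 scaler0 addr0 nrm0 mulr0.
have bp := nrm_gt0 b0; rewrite -ler_pdivrMr //.
rewrite /unorm le_max; apply/orP; right.
apply: sup_upper_bound (uact_has_sup u) _ _.
exists ((nrm b)^-1%:C *: b) => /=.
  by rewrite nrmZR gtr0_norm ?invr_gt0 // mulVf ?gt_eqF.
by rewrite uactZ nrmZR gtr0_norm ?invr_gt0 // mulrC.
Qed.

Lemma uscal_le u : cabs u.2 <= unorm u.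
Proof. by rewrite /unorm le_max lexx. Qed.

Lemma unorm_ge0 u : 0 <= unorm u.
Proof. exact: le_trans (cabs_ge0 _) (uscal_le u). Qed.

Lemma unorm_le u K : cabs u.2 <= K ->
  (forall b, nrm (uact u b) <= K * nrm b) -> unorm u <= K.
Proof.
move=> uK h; rewrite /unorm ge_max uK /=.
apply: sup_le_ub; first by case: (uact_has_sup u).
move=> _ [b /= b1 <-]; apply: le_trans (h b) _.
by rewrite ler_piMr //; exact: le_trans (cabs_ge0 _) uK.
Qed.

Lemma unormD u v : unorm (u + v) <= unorm u + unorm v.
Proof.
apply: unorm_le => [|b].
  apply: le_trans (lerD (uscal_le u) (uscal_le v)).
  by rewrite -lecR rmorphD /= -!cabsE ler_normD.
rewrite mulrDl; apply: le_trans (lerD (uact_le u b) (uact_le v b)).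
have -> : uact (u + v) b = uact u b + uact v b.
  by rewrite /uact /= cmulDl scalerDl addrACA.
exact: ler_nrmD.
Qed.

Lemma unormZ_le c u : unorm (c *: u) <= cabs c * unorm u.
Proof.
apply: unorm_le => [|b].
  by rewrite /= cabsM ler_wpM2l ?cabs_ge0 ?uscal_le.
have -> : uact (c *: u) b = c *: uact u b.
  by rewrite /uact /= cmulZl scalerDr scalerA.
by rewrite nrmZ -mulrA ler_wpM2l ?cabs_ge0 ?uact_le.
Qed.

Lemma unormZ c u : unorm (c *: u) = cabs c * unorm u.
Proof.
apply/eqP; rewrite eq_le unormZ_le /=.
have [->|c0] := eqVneq c 0; first by rewrite cabs0 mul0r unorm_ge0.
have := unormZ_le c^-1 (c *: u); rewrite scalerA mulVf // scale1r.
have : cabs c * cabs c^-1 = 1.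
  by rewrite -cabsM mulfV // -(rmorph1 (real_complex R)) cabsR normr1.
have := cabs_ge0 c; have := unorm_ge0 u; have := unorm_ge0 (c *: u).
by move: (cabs c) (cabs _) (unorm u) (unorm _) => s t x y; nra.
Qed.

Lemma unorm_eq0 u : unorm u = 0 -> u = 0.
Proof.
move=> u0; have l0 : u.2 = 0.
  by apply: cabs_eq0; apply/eqP; rewrite eq_le cabs_ge0 andbT -u0 uscal_le.
have := uact_le u (cstar u.1); rewrite u0 mul0r /uact l0 scale0r addr0 nrm_Mstar.
move=> h; have : nrm u.1 = 0 by have := nrm_ge0 u.1; nra.
by move/nrm_eq0; case: u l0 {u0 h} => a l /= -> ->.
Qed.

Lemma unormM u v : unorm (umul u v) <= unorm u * unorm v.
Proof.
apply: unorm_le => [|b].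
  by rewrite /= cabsM ler_pM ?cabs_ge0 ?uscal_le.
rewrite uactM; apply: le_trans (uact_le _ _) _.
by rewrite -mulrA ler_wpM2l ?unorm_ge0 ?uact_le.
Qed.

Lemma ustarK : involutive ustar.
Proof. by move=> [a l]; rewrite /ustar /= cstarK conjCK. Qed.

(** Bounds for the action give bounds for the norm: |u b|^2 = |b^* (u^* u) b|. *)
Lemma unorm_star_sqr u : unorm u ^+ 2 <= unorm (umul (ustar u) u).
Proof.
set N := unorm (umul _ _); have N0 : 0 <= N by exact: unorm_ge0.
rewrite -[leRHS](sqr_sqrtr N0) lerXn2r ?nnegrE ?unorm_ge0 ?sqrtr_ge0 //.
apply: unorm_le => [|b].
  rewrite -(ler_pXn2r (n := 2)) ?nnegrE ?cabs_ge0 ?sqrtr_ge0 // sqr_sqrtr //.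
  by apply: le_trans (uscal_le _); rewrite /= cabsM cabs_conj expr2.
rewrite -(ler_pXn2r (n := 2)) ?nnegrE ?nrm_ge0 ?mulr_ge0 ?nrm_ge0 ?sqrtr_ge0 //.
rewrite exprMn sqr_sqrtr // -nrm_starM.
have -> : cstar (uact u b) ** uact u b = cstar b ** uact (umul (ustar u) u) b.
  rewrite uactM; move: {2 3}(uact u b) => w.
  by rewrite /uact /= cstarD cstarM cstarZ cmulDl -cmulA cmulZl cmulDr cmulZr.
apply: le_trans (nrm_cmul _ _) _; rewrite nrm_star.
have := uact_le (umul (ustar u) u) b; rewrite -/N; have := nrm_ge0 b; nra.
Qed.

Lemma unorm_star u : unorm (ustar u) = unorm u.
Proof.
have le v : unorm v <= unorm (ustar v).
  have := unorm_star_sqr v; have := unormM (ustar v) v.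
  have := unorm_ge0 v; have := unorm_ge0 (ustar v); nra.
by apply/eqP; rewrite eq_le le andbT -{2}[u]ustarK le.
Qed.

Lemma unorm_starM u : unorm (umul (ustar u) u) = unorm u ^+ 2.
Proof.
apply/eqP; rewrite eq_le unorm_star_sqr andbT.
by apply: le_trans (unormM _ _) _; rewrite unorm_star.
Qed.

(** Acting on a^* recovers |a|. *)
Lemma unorm_inj (a : A) : unorm ((a, 0) : unitz A) = nrm a.
Proof.
apply/eqP; rewrite eq_le; apply/andP; split.
  apply: unorm_le => [|b] /=; first by rewrite cabs0 nrm_ge0.
  by rewrite /uact /= scale0r addr0 nrm_cmul.
have [->|/eqP a0] := eqVneq a 0; first by rewrite nrm0 unorm_ge0.
have := uact_le ((a, 0) : unitz A) (cstar a); rewrite /uact /= scale0r addr0.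
by rewrite nrm_Mstar nrm_star expr2 ler_pM2r // nrm_gt0.
Qed.

Lemma unorm_scal (l : R[i]) : unorm ((0, l) : unitz A) <= cabs l.
Proof.
by apply: unorm_le => [//|b]; rewrite /uact /= cmul0x add0r nrmZ.
Qed.

Definition unormC u : R[i] := (unorm u)%:C.

Lemma unormCD u v : unormC (u + v) <= unormC u + unormC v.
Proof. by rewrite -rmorphD lecR unormD. Qed.

Lemma unormCZ (c : R[i]) u : unormC (c *: u) = `|c| * unormC u.
Proof. by rewrite /unormC unormZ rmorphM /= cabsE. Qed.

Lemma unormC_eq0 u : unormC u = 0 -> u = 0.
Proof. by move=> /(@complexI R); exact: unorm_eq0. Qed.

HB.instance Definition _ := Lmodule_isNormed.Build R[i] (unitz A)
  unormCD unormCZ unormC_eq0.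

Lemma nrm_unitz u : nrm u = unorm u. Proof. by []. Qed.

Lemma unitz_complete (F : set_system (unitz A)) :
  ProperFilter F -> cauchy F -> cvg F.
Proof.
apply: complete_of_rapid => u ur.
have [n|l hl] := @complex_rapid _ (fun n => (u n).2).
  by apply: le_trans (ur n); exact: (uscal_le (u n.+1 - u n)).
have s_le n : nrm ((u n.+1).1 - (u n).1) <= 2 * 2^-1 ^+ n.
  rewrite -unorm_inj; set x := (X in unorm X).
  have -> : x = (u n.+1 - u n) + (0, (u n).2 - (u n.+1).2).
    rewrite /x; congr (_, _) => /=; first by rewrite addr0.
    by rewrite addrA subrK subrr.
  apply: le_trans (unormD _ _) _; have := ur n; rewrite nrm_unitz.
  have h := uscal_le (u n.+1 - u n).
  have := unorm_scal ((u n).2 - (u n.+1).2).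
  have -> : cabs ((u n).2 - (u n.+1).2) = cabs (u n.+1 - u n).2.
    by rewrite /cabs distrC.
  lra.
have [n||a ha] := @dominated_tends _ _ (fun n => (u n).1) (fun n => - (4 * 2^-1 ^+ n)) 0.
- by apply: le_trans (s_le n) _; rewrite exprS; lra.
- by move=> n; rewrite oppr_le0 mulr_ge0 // exprn_ge0 // invr_ge0.
exists (a, l) => e e0; have e2 : 0 < e / 2 by rewrite divr_gt0.
have [N hN] := ha _ e2; have [N' hN'] := hl _ e2.
exists (maxn N N') => n; rewrite geq_max => /andP[/hN h1 /hN' h2].
have -> : (a, l) - u n = ((a - (u n).1, 0) : unitz A) + (0, l - (u n).2).
  by congr (_, _) => /=; rewrite ?addr0 ?add0r.
apply: le_lt_trans (unormD _ _) _; rewrite unorm_inj.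
by have := unorm_scal (l - (u n).2); lra.
Qed.

HB.instance Definition _ := Uniform_isComplete.Build (unitz A) unitz_complete.

Lemma umulA : associative umul.
Proof.
move=> u v w; congr (_, _); last by rewrite /= mulrA.
rewrite /= !(cmulDl, cmulDr, cmulZl, cmulZr, scalerDr, scalerA, cmulA).
rewrite [w.2 * u.2]mulrC [w.2 * v.2]mulrC -!addrA; congr (_ + _).
by rewrite [RHS]addrCA; congr (_ + _); rewrite addrCA; congr (_ + _); rewrite addrCA.
Qed.

Lemma umulDl u v w : umul (u + v) w = umul u w + umul v w.
Proof.
congr (_, _); last by rewrite /= mulrDl.
rewrite /= !(cmulDl, scalerDl, scalerDr).
by rewrite [X in X + _ = _]addrACA [LHS]addrACA.
Qed.

Lemma umulDr u v w : umul u (v + w) = umul u v + umul u w.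
Proof.
congr (_, _); last by rewrite /= mulrDr.
rewrite /= !(cmulDr, scalerDl, scalerDr).
by rewrite [X in X + _ = _]addrACA [LHS]addrACA.
Qed.

Lemma umulZl (c : R[i]) u v : umul (c *: u) v = c *: umul u v.
Proof.
congr (_, _); last by rewrite /= -scalerAl.
rewrite /= cmulZl !scalerDr !scalerA; congr (_ + _ + _ *: _).
exact: mulrC.
Qed.

Lemma umulZr (c : R[i]) u v : umul u (c *: v) = c *: umul u v.
Proof.
congr (_, _); last by rewrite /= -scalerAr.
rewrite /= cmulZr !scalerDr !scalerA; congr (_ + _ *: _ + _).
exact: mulrC.
Qed.

Lemma ustarD u v : ustar (u + v) = ustar u + ustar v.
Proof. by congr (_, _); rewrite /= ?cstarD ?rmorphD. Qed.

Lemma ustarZ (c : R[i]) u : ustar (c *: u) = (c^*)%R *: ustar u.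
Proof. by congr (_, _); rewrite /= ?cstarZ ?rmorphM. Qed.

Lemma ustarM u v : ustar (umul u v) = umul (ustar v) (ustar u).
Proof.
congr (_, _); last by rewrite /= rmorphM mulrC.
by rewrite /= !cstarD cstarM !cstarZ addrAC.
Qed.

Lemma unormCM u v : `|umul u v| <= `|u| * `|v|.
Proof. by rewrite !nrmE -rmorphM lecR unormM. Qed.

Lemma unormC_starM u : `|umul (ustar u) u| = `|u| ^+ 2.
Proof. by rewrite !nrmE -rmorphXn /= nrm_unitz unorm_starM. Qed.

HB.instance Definition _ := isCStarAlgebra.Build R (unitz A)
  umulA umulDl umulDr umulZl umulZr ustarK ustarD ustarZ ustarM
  unormCM unormC_starM.

Definition uone : unitz A := (0, 1).

Lemma umul1u : left_id uone umul.
Proof.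
move=> [a l]; congr (_, _); last by rewrite /= mul1r.
by rewrite /= cmul0x add0r scale1r scaler0 addr0.
Qed.

Lemma umulu1 : right_id uone umul.
Proof.
move=> [a l]; congr (_, _); last by rewrite /= mulr1.
by rewrite /= cmulx0 add0r scale1r scaler0 add0r.
Qed.

Lemma uone_neq0 : uone != 0.
Proof. by apply/eqP => /(congr1 snd) /eqP; rewrite /= oner_eq0. Qed.

HB.instance Definition _ := GRing.Zmodule_isNzRing.Build (unitz A)
  umulA umul1u umulu1 umulDl umulDr uone_neq0.

HB.instance Definition _ := GRing.Lmodule_isLalgebra.Build R[i] (unitz A)
  (fun c u v => esym (umulZl c u v)).

HB.instance Definition _ := GRing.Lalgebra_isAlgebra.Build R[i] (unitz A)
  (fun c u v => esym (umulZr c u v)).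

Lemma ucmulE u v : cmul u v = u * v. Proof. by []. Qed.

End Unitization.

(** * Positive elements of a unitization *)

Section Positivity.
Variables (R : realType) (A : cstarAlgType R).
Local Notation U := (unitz A).
Implicit Types (x y u v w k m : U) (t : R).

Lemma ustarMr x y : cstar (x * y) = cstar y * cstar x.
Proof. exact: (cstarM x y). Qed.

Lemma ustar1 : cstar (1 : U) = 1.
Proof. by rewrite -[LHS]mulr1 -[X in _ * X]cstarK -ustarMr mulr1 cstarK. Qed.

Lemma nrmM x y : nrm (x * y) <= nrm x * nrm y.
Proof. exact: nrm_cmul. Qed.

Lemma nrm_ustarM x : nrm (cstar x * x) = nrm x ^+ 2.
Proof. exact: nrm_starM. Qed.

Lemma nrm1_le : nrm (1 : U) <= 1.
Proof.
apply: le_trans (unorm_scal A 1) _.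
by rewrite -(rmorph1 (real_complex R)) cabsR normr1.
Qed.

Lemma nrm_alg t : 0 <= t -> nrm (t%:C%:A : U) <= t.
Proof. by move=> t0; rewrite nrmZR ger0_norm // ler_piMr // nrm1_le. Qed.

Lemma sa_sqr w : cstar w = w -> nrm (w * w) = nrm w ^+ 2.
Proof. by move=> ws; rewrite -{1}ws nrm_ustarM. Qed.

Lemma sa_sqr_eq0 w : cstar w = w -> w * w = 0 -> w = 0.
Proof.
move=> ws /(congr1 (@nrm R U)); rewrite sa_sqr // nrm0 => /eqP.
by rewrite expf_eq0 => /eqP/nrm_eq0.
Qed.

Lemma algC t x : x * t%:C%:A = t%:C%:A * x.
Proof. by rewrite -scalerAr -scalerAl mulr1 mul1r. Qed.

(** The root is 1 - y with y from half_sqrt.  It commutes with everything that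
    commutes with x because commutants are closed. *)
Lemma sqrt_one_sub x : cstar x = x -> nrm x <= 1 ->
  exists w, [/\ cstar w = w, w * w = 1 - x, nrm (1 - w) <= 1 &
    forall c, c * x = x * c -> c * w = w * c].
Proof.
move=> xs x1.
pose T := [set y : U | cstar y = y] `&`
          [set y | forall c, c * x = x * c -> c * y = y * c].
have cT : closed T.
  apply/closedP => y h; split.
    have /closedP := @closed_selfadj R U; apply=> e /h[z [? _] ?]; by exists z.
  move=> c cx; have /closedP := @closed_commutant R U c; apply=> e /h[z [_ hz] ?].
  by exists z => //; exact: hz.
have [||y [[ys yc] y1 yE]] := @half_sqrt R U x T x1 cT.
- by split=> [|c _] /=; rewrite ?cstar0 ?mulr0 ?mul0r.
- move=> y [ys yc]; split; first by rewrite /= cstarZR cstarD cstarM xs ys.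
  move=> c cx; have cy := yc c cx.
  rewrite !ucmulE -scalerAr -scalerAl mulrDr mulrDl mulrA cy cx.
  by rewrite -!mulrA cy.
exists (1 - y); split.
- by rewrite cstarB ustar1 ys.
- move: yE; rewrite ucmulE rmorphD rmorph1 scalerDl scale1r => yE.
  have -> : x = y + y - y * y by rewrite yE addrK.
  by rewrite mulrBl mulrBr !mul1r mulrBr mulr1 -addrA -opprD addrA.
- by rewrite opprB addrC subrK.
- by move=> c cx; rewrite mulrBr mulrBl mulr1 mul1r yc.
Qed.

(** Squares of self-adjoint elements.  They agree with the self-adjoint x
    such that |t - x| <= t for some t, a description that is stable under sums. *)
Definition pos x := exists2 w : U, cstar w = w & x = w * w.

Lemma pos_sa x : pos x -> cstar x = x.
Proof. by move=> [w ws ->]; rewrite ustarMr ws. Qed.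

Lemma pos0 : pos 0.
Proof. by exists 0; rewrite ?cstar0 ?mulr0. Qed.

Lemma pos_sqr w : cstar w = w -> pos (w * w).
Proof. by move=> ws; exists w. Qed.

Lemma sqrtCM t : 0 <= t -> (Num.sqrt t)%:C * (Num.sqrt t)%:C = t%:C.
Proof. by move=> t0; rewrite -rmorphM -expr2 sqr_sqrtr. Qed.

Lemma posZ t x : 0 <= t -> pos x -> pos (t%:C *: x).
Proof.
move=> t0 [w ws ->]; exists ((Num.sqrt t)%:C *: w); first by rewrite cstarZR ws.
by rewrite -scalerAl -scalerAr scalerA sqrtCM.
Qed.

(** If w is a root of 1 - k^2 then w^2 + k^2 = 1, so two_squares bounds w. *)
Lemma nrm_one_sub_sqr k : cstar k = k -> nrm k <= 1 -> nrm (1 - k * k) <= 1.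
Proof.
move=> ks k1.
have kk1 : nrm (k * k) <= 1.
  by rewrite sa_sqr // expr_le1 ?nrm_ge0.
have [|//|w [ws wE _ wc]] := @sqrt_one_sub (k * k); first by rewrite ustarMr ks.
rewrite -wE sa_sqr //.
have kw : w * k = k * w by rewrite -wc // mulrA.
have := nrm_two_squares ws ks kw; rewrite !ucmulE wE subrK => /le_trans; apply.
exact: nrm1_le.
Qed.

Lemma nrm_alg_sub t x : pos x -> nrm x <= t -> nrm (t%:C%:A - x) <= t.
Proof.
move=> [w ws ->] xt; have t0 : 0 <= t := le_trans (nrm_ge0 _) xt.
move: t0 xt; rewrite le_eqVlt => /predU1P[<-|t0 xt].
  rewrite scale0r sub0r nrmN //.
have s0 : 0 < Num.sqrt t by rewrite sqrtr_gt0.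
pose k := (Num.sqrt t)^-1%:C *: w.
have ks : cstar k = k by rewrite cstarZR ws.
have kk : t%:C *: (k * k) = w * w.
  rewrite -scalerAl -scalerAr !scalerA -(sqrtCM (ltW t0)).
  rewrite fmorphV -mulrA mulrACA mulfV ?mulr1 ?scale1r //.
  by rewrite eq_complex /= eqxx andbT gt_eqF.
have k1 : nrm k <= 1.
  rewrite -(expr_le1 (n := 2)) ?nrm_ge0 // -sa_sqr //.
  by move: xt; rewrite -kk nrmZR gtr0_norm // -{2}[t]mulr1 ler_pM2l.
rewrite -kk -scalerBr nrmZR gtr0_norm // ler_piMr //; first exact: ltW.
exact: nrm_one_sub_sqr.
Qed.

(** The element z = 1 - x/t has norm at most 1, so x = t (1 - z) has a root; the
    norm bound on the root makes the root positive as well. *)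
Lemma root_of_nrm t x : 0 <= t -> cstar x = x -> nrm (t%:C%:A - x) <= t ->
  exists w, [/\ cstar w = w, w * w = x, nrm ((Num.sqrt t)%:C%:A - w) <= Num.sqrt t &
    forall c, c * x = x * c -> c * w = w * c].
Proof.
rewrite le_eqVlt => /predU1P[<-|t0] xs xt.
  move: xt; rewrite scale0r sub0r nrmN => x0.
  have -> : x = 0 by apply: nrm_eq0; apply/eqP; rewrite eq_le x0 nrm_ge0.
  exists 0; rewrite cstar0 mulr0 sqrtr0 scale0r subrr nrm0.
  by split=> // c _; rewrite mulr0 mul0r.
have ti : 0 < t^-1 by rewrite invr_gt0.
pose z := 1 - t^-1%:C *: x.
have tzE : t%:C *: z = t%:C%:A - x.
  by rewrite scalerBr scalerA -rmorphM mulfV ?gt_eqF // rmorph1 scale1r.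
have [||w [ws wE w1 wc]] := @sqrt_one_sub z.
- by rewrite cstarB ustar1 cstarZR xs.
- by move: xt; rewrite -tzE nrmZR gtr0_norm // -{2}[t]mulr1 ler_pM2l.
have s0 := sqrtr_ge0 t.
exists ((Num.sqrt t)%:C *: w); split.
- by rewrite cstarZR ws.
- rewrite -scalerAl -scalerAr scalerA sqrtCM ?ltW // wE.
  by rewrite scalerBr tzE opprB addrC subrK.
- by rewrite -scalerBr nrmZR ger0_norm // ler_piMr.
- move=> c cx; rewrite -scalerAr -scalerAl wc // mulrBr mulrBl mulr1 mul1r.
  by rewrite -scalerAr -scalerAl cx.
Qed.

Lemma pos_of_nrm t x : cstar x = x -> nrm (t%:C%:A - x) <= t -> pos x.
Proof.
move=> xs xt; have t0 := le_trans (nrm_ge0 _) xt.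
by have [w [ws <- _ _]] := root_of_nrm t0 xs xt; exists w.
Qed.

Lemma pos_root x : pos x -> exists w, [/\ pos w, w * w = x &
  forall c, c * x = x * c -> c * w = w * c].
Proof.
move=> px; have xs := pos_sa px.
have [w [ws wE w1 wc]] := root_of_nrm (nrm_ge0 x) xs (nrm_alg_sub px (lexx _)).
by exists w; split=> //; exact: pos_of_nrm w1.
Qed.

Lemma posD x y : pos x -> pos y -> pos (x + y).
Proof.
move=> px py; apply: (@pos_of_nrm (nrm x + nrm y)).
  by rewrite cstarD !pos_sa.
rewrite rmorphD scalerDl opprD addrACA; apply: le_trans (ler_nrmD _ _) _.
by apply: lerD; exact: nrm_alg_sub.
Qed.

Lemma pos_mul x y : pos x -> pos y -> x * y = y * x -> pos (x * y).
Proof.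
move=> /pos_root[w [pw wE wc]] /pos_root[v [pv vE vc]] xy.
have wv : w * v = v * w.
  by rewrite -wc // -vc // xy.
exists (w * v); first by rewrite ustarMr !pos_sa.
by rewrite -wE -vE -!mulrA; congr (_ * _); rewrite !mulrA wv.
Qed.

Lemma pos_alg_sub t x : pos x -> nrm x <= t -> pos (t%:C%:A - x).
Proof.
move=> px xt; apply: (@pos_of_nrm t); last by rewrite opprB addrC subrK.
by rewrite cstarB cstarZR ustar1 pos_sa.
Qed.

(** The roots w of x and v of t - x commute and w^2 + v^2 = t. *)
Lemma pos_nrm_le t x : 0 <= t -> pos x -> pos (t%:C%:A - x) -> nrm x <= t.
Proof.
move=> t0 /pos_root[w [pw wE wc]] /pos_root[v [pv vE vc]].
have xv : x * v = v * x by apply: vc; rewrite mulrBr mulrBl algC.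
have wv : w * v = v * w by rewrite -wc // xv.
have := nrm_two_squares (pos_sa pw) (pos_sa pv) wv.
rewrite !ucmulE wE vE addrC subrK -sa_sqr ?pos_sa // wE => /le_trans; apply.
exact: nrm_alg.
Qed.

(** With t = |x + y|, both t - (x + y) and y are positive, hence so is t - x. *)
Lemma pos_nrm_mono x y : pos x -> pos y -> nrm x <= nrm (x + y).
Proof.
move=> px py; apply: pos_nrm_le => //; first exact: nrm_ge0.
have /posD/(_ py) := pos_alg_sub (posD px py) (lexx _).
by rewrite opprD addrA subrK.
Qed.

Lemma pos_antisym x : pos x -> pos (- x) -> x = 0.
Proof.
move=> px pNx; apply: nrm_eq0; apply/eqP; rewrite eq_le nrm_ge0 andbT.
by have := pos_nrm_mono px pNx; rewrite subrr nrm0.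
Qed.

(** The difference e between |u| and u satisfies e (u + v) e = - |u| e^2, which
    is both positive and negative. *)
Lemma pos_orth u v : cstar u = u -> cstar v = v -> u * v = 0 -> pos (u + v) ->
  pos u.
Proof.
move=> us vs uv puv.
have vu : v * u = 0 by rewrite -us -vs -ustarMr uv cstar0.
have [s [ps sE sc]] := pos_root (pos_sqr us).
have su : u * s = s * u by apply: sc; rewrite mulrA.
have sv : v * s = s * v by apply: sc; rewrite mulrA vu mul0r -mulrA uv mulr0.
have ss := pos_sa ps.
have sv0 : s * v = 0.
  apply: sa_sqr_eq0; first by rewrite ustarMr ss vs.
  by rewrite -mulrA [v * (s * v)]mulrA sv !mulrA sE -[u * u * v]mulrA uv mulr0 mul0r.
pose e := s - u.
have es : cstar e = e by rewrite cstarB ss us.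
have ee : e * e = s * e + s * e.
  have -> : e * e = s * s - s * u - (u * s - u * u) by rewrite mulrBl !mulrBr.
  by rewrite su -sE opprB -mulrBr.
have ev : e * v = 0 by rewrite mulrBl sv0 uv subrr.
have eu : e * u = - (s * e) by rewrite mulrBl mulrBr -sE opprB.
have ec c : c * u = u * c -> c * s = s * c -> c * e = e * c.
  by move=> cu cs; rewrite mulrBr mulrBl cu cs.
have eE : e = s - u by [].
clearbody e; have pee := pos_sqr es.
have see : s * (e * e) = 0.
  apply: pos_antisym.
    have se : s * e = e * s by exact: ec.
    by apply: pos_mul => //; rewrite mulrA se -mulrA se mulrA.
  have -> : - (s * (e * e)) = (u + v) * (e * e).
    have ue : u * e = e * u by exact: ec.
    have ve : v * e = e * v by apply: ec; rewrite ?sv ?vu ?uv.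
    by rewrite mulrDl !mulrA ve ev mul0r addr0 ue eu mulNr.
  apply: pos_mul => //.
  have pe : (u + v) * e = e * (u + v).
    by rewrite mulrDl mulrDr; congr (_ + _); apply: ec; rewrite ?sv ?vu ?uv.
  by rewrite mulrA pe -mulrA pe mulrA.
have e3 : e * e * e = 0 by rewrite {1}ee mulrDl -mulrA see addr0.
have e0 : e = 0.
  apply: sa_sqr_eq0 => //; apply: sa_sqr_eq0; first exact: pos_sa.
  by rewrite mulrA e3 mul0r.
by rewrite -[u](subKr s) -eE e0 subr0.
Qed.

Lemma half_add x : (2^-1)%:C *: x + (2^-1)%:C *: x = x.
Proof.
rewrite -scalerDl -rmorphD /= (_ : 2^-1 + 2^-1 = 1) ?rmorph1 ?scale1r //; lra.
Qed.

(** With h = k/2 and m = |h|, the parts m + h and m - h have product 0 and the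
    positive sum 2m, so pos_orth makes them positive. *)
Lemma pos_parts k : cstar k = k -> exists f g, [/\ pos f, pos g, k = f - g,
  f * g = 0 & forall c, c * k = k * c -> c * f = f * c /\ c * g = g * c].
Proof.
move=> ks; pose h : U := (2^-1)%:C *: k.
have hs : cstar h = h by rewrite cstarZR ks.
have [m [pm mE mc]] := pos_root (pos_sqr hs).
have mh : h * m = m * h by apply: mc; rewrite mulrA.
have ms := pos_sa pm.
have orth : (m + h) * (m - h) = 0.
  by rewrite mulrBr !mulrDl mE mh [_ + h * h]addrC subrr.
have orth' : (m - h) * (m + h) = 0.
  by rewrite mulrDr !mulrBl mE mh addrA subrK subrr.
have sD : cstar (m + h) = m + h by rewrite cstarD ms hs.
have sB : cstar (m - h) = m - h by rewrite cstarB ms hs.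
exists (m + h), (m - h); split=> //.
- by apply: (pos_orth sD sB orth); rewrite addrACA subrr addr0; exact: posD.
- by apply: (pos_orth sB sD orth'); rewrite addrACA addNr addr0; exact: posD.
- by rewrite opprB addrC addrA subrK half_add.
- move=> c ck; have ch : c * h = h * c by rewrite -scalerAr -scalerAl ck.
  have cm : c * m = m * c by apply: mc; rewrite mulrA ch -mulrA ch mulrA.
  by rewrite mulrDr mulrBr mulrDl mulrBl ch cm.
Qed.

(** Kaplansky: with g the negative part of k = x^* x and y = x g, the element
    y^* y = - g^3 is negative, so w = y y^* is positive, as the sum of the two
    is a sum of squares.  Then (t - w) y = y (t + g^3) for t = |w| = |g^3|
    bounds 2t^3 by t^3. *)
Lemma pos_starM x : pos (cstar x * x).
Proof.
set k := cstar x * x; have ks : cstar k = k by rewrite ustarMr cstarK.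
have [f [g [pf pg kE fg _]]] := pos_parts ks.
have gs := pos_sa pg; have fs := pos_sa pf.
have gf : g * f = 0 by rewrite -gs -fs -ustarMr fg cstar0.
have gk : g * k = - (g * g) by rewrite kE mulrBr gf sub0r.
pose y := x * g; pose G := g * g * g.
have pG : pos G by apply: pos_mul => //; [exact: pos_sqr|rewrite mulrA].
have yy : cstar y * y = - G.
  by rewrite ustarMr gs mulrA -(mulrA g) -/k gk mulNr.
have psum : pos (y * cstar y + cstar y * y).
  pose p := y + cstar y; pose q := 'i%R *: (y - cstar y).
  have ps : cstar p = p by rewrite cstarD cstarK addrC.
  have qs : cstar q = q by rewrite cstarZ cstarB cstarK conjCi scaleNr -scalerN opprB.
  have qq : q * q = - ((y - cstar y) * (y - cstar y)).
    by rewrite -scalerAl -scalerAr scalerA -expr2 sqrCi scaleN1r.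
  suff -> : y * cstar y + cstar y * y = (2^-1)%:C *: (p * p + q * q).
    by apply: posZ; [rewrite invr_ge0|apply: posD; exact: pos_sqr].
  rewrite -[LHS]half_add -scalerDr; congr (_ *: _).
  have -> : p * p = (y * y + cstar y * cstar y) + (y * cstar y + cstar y * y).
    by rewrite mulrDr !mulrDl [y * cstar y + cstar y * cstar y]addrC addrACA [cstar y * y + _]addrC.
  have -> : q * q = (y * cstar y + cstar y * y) - (y * y + cstar y * cstar y).
    rewrite qq mulrBr !mulrBl opprB opprB addrACA -opprD; congr (_ - _).
    by rewrite addrC.
  by rewrite [RHS]addrC [RHS]addrA subrK.
pose w := y * cstar y.
have pw : pos w.
  by have := posD psum pG; rewrite yy subrK.
pose t := nrm w; have t0 : 0 <= t := nrm_ge0 w.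
have ny : nrm y ^+ 2 = t by rewrite /t -nrm_Mstar.
have nG : nrm G = t by rewrite -ny -nrm_ustarM yy nrmN.
have key : (t%:C%:A - w) * y = y * (t%:C%:A + G).
  by rewrite mulrBl -mulrA yy mulrN opprK mulrDr algC.
have up : nrm (y * (t%:C%:A + G)) ^+ 2 <= t ^+ 3.
  have -> : t ^+ 3 = (t * nrm y) ^+ 2 by rewrite exprMn ny -exprSr.
  rewrite -key lerXn2r ?nnegrE ?mulr_ge0 ?nrm_ge0 //.
  by apply: le_trans (nrmM _ _) _; rewrite ler_wpM2r ?nrm_ge0 // nrm_alg_sub.
have Gs := pos_sa pG.
have lo : 2 * t ^+ 3 <= nrm (y * (t%:C%:A + G)) ^+ 2.
  have -> : nrm (y * (t%:C%:A + G)) ^+ 2 =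
      nrm ((2 * t)%:C *: (G * G) + ((t ^+ 2)%:C *: G + G * (G * G))).
    rewrite -nrm_ustarM ustarMr cstarD cstarZR ustar1 Gs.
    rewrite -mulrA [cstar y * _]mulrA yy mulNr mulrN nrmN; congr nrm.
    rewrite mulrDl !mulrDr -!scalerAl !mul1r -!scalerAr mulr1 !scalerA -rmorphM -expr2.
    rewrite -addrA [RHS]addrCA; congr (_ + _); rewrite addrA; congr (_ + _).
    by rewrite -scalerDl -rmorphD; congr (_%:C *: _); lra.
  apply: le_trans (pos_nrm_mono _ _).
  - rewrite nrmZR ger0_norm ?mulr_ge0 // sa_sqr // nG exprS; lra.
  - by apply: posZ; [rewrite mulr_ge0|exact: pos_sqr].
  - apply: posD; first by apply: posZ => //; rewrite sqr_ge0.
    by apply: pos_mul => //; [exact: pos_sqr|rewrite mulrA].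
have t00 : t = 0.
  have t3 : t ^+ 3 = 0 by apply/eqP; rewrite eq_le exprn_ge0 // andbT; lra.
  by move/eqP: t3; rewrite expf_eq0 => /eqP.
have G0 : G = 0 by apply: nrm_eq0; rewrite nG.
have g0 : g = 0.
  apply: sa_sqr_eq0 => //; apply: sa_sqr_eq0; first by rewrite ustarMr gs.
  by rewrite mulrA -/G G0 mul0r.
by rewrite kE g0 subr0.
Qed.

End Positivity.

(** * Positivity, approximate units and ideals without a unit *)

Section Consequences.
Variables (R : realType) (A : cstarAlgType R).
Local Notation U := (unitz A).
Implicit Types (a b x y : A) (u : U).

Definition uin a : U := (a, 0).

Lemma uinD a b : uin (a + b) = uin a + uin b.
Proof. by congr (_, _); rewrite /= addr0. Qed.

Lemma uinN a : uin (- a) = - uin a.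
Proof. by congr (_, _); rewrite /= oppr0. Qed.

Lemma uinB a b : uin (a - b) = uin a - uin b.
Proof. by rewrite uinD uinN. Qed.

Lemma uinZ (c : R[i]) a : uin (c *: a) = c *: uin a.
Proof. by congr (_, _); rewrite /= scaler0. Qed.

Lemma uinM a b : uin (a ** b) = uin a * uin b.
Proof. by congr (_, _); rewrite /= ?mulr0 // !scale0r !addr0. Qed.

Lemma uin_star a : uin (cstar a) = cstar (uin a).
Proof. by congr (_, _); rewrite /= conjC0. Qed.

Lemma nrm_uin a : nrm (uin a) = nrm a.
Proof. exact: unorm_inj. Qed.

Lemma uin_inj : injective uin.
Proof. by move=> a b []. Qed.

Lemma uinK u : u.2 = 0 -> uin u.1 = u.
Proof. by case: u => a l /= ->. Qed.

Lemma usnd_mul (u v : U) : (u * v).2 = u.2 * v.2. Proof. by []. Qed.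

(** Positivity in an algebra that may have no unit, tested in the unitization. *)
Definition apos a := pos (uin a).

Lemma apos_starM a : apos (cstar a ** a).
Proof. rewrite /apos uinM uin_star; exact: pos_starM. Qed.

Lemma apos_Mstar a : apos (a ** cstar a).
Proof. by rewrite -{1}[a]cstarK; exact: apos_starM. Qed.

Lemma apos0 : apos 0.
Proof. exact: pos0. Qed.

Lemma aposD a b : apos a -> apos b -> apos (a + b).
Proof. by rewrite /apos uinD; exact: posD. Qed.

Lemma apos_nrm_mono a b : apos a -> apos b -> nrm a <= nrm (a + b).
Proof. by move=> pa pb; rewrite -!nrm_uin uinD; exact: pos_nrm_mono. Qed.

(** The norm description of positivity, with one t > |a| that serves all elements
    near a, passes to the limit. *)
Lemma closed_apos : closed [set a | apos a].
Proof.
apply/closedP => a h.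
have as_ : cstar a = a.
  have /closedP := @closed_selfadj R A; apply=> e /h[b /= pb ab].
  by exists b => //=; apply: uin_inj; rewrite uin_star pos_sa.
pose t := nrm a + 1.
apply: (@pos_of_nrm _ _ t); first by rewrite -uin_star as_.
apply/ler_addgt0Pr => e e0.
have e1 : 0 < Num.min e 1 by rewrite lt_min e0 ltr01.
have [b /= pb] := h _ e1; rewrite lt_min => /andP[ab ab1].
have bt : nrm (uin b) <= t.
  by rewrite nrm_uin /t; have := ler_dist_nrm b a; rewrite nrmB; lra.
have := nrm_alg_sub pb bt.
have -> : t%:C%:A - uin a = (t%:C%:A - uin b) - uin (a - b).
  by rewrite uinB opprB addrA subrK.
have := ler_nrmB (t%:C%:A - uin b) (uin (a - b)); rewrite nrm_uin; lra.
Qed.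

Lemma posX (u : U) n : pos u -> pos (u ^+ n).
Proof.
move=> pu; elim: n => [|n IH].
  by rewrite expr0 -[1]mulr1; apply: pos_sqr; exact: ustar1.
by rewrite exprS; apply: pos_mul => //; rewrite -exprS -exprSr.
Qed.

Lemma posMn (u : U) n : pos u -> pos (u *+ n).
Proof.
by move=> pu; elim: n => [|n IH]; [exact: pos0|rewrite mulrS; exact: posD].
Qed.

(** n x (1 - x)^n <= 1 for 0 <= x <= 1, since the left-hand side is at most
    the telescoping sum of the x (1 - x)^j. *)
Lemma decay_bound (u : U) n : pos u -> pos (1 - u) ->
  pos (1 - (u * (1 - u) ^+ n) *+ n).
Proof.
move=> pu pz; set z := 1 - u.
have uz : u * z = z * u by rewrite mulrBl mulrBr mulr1 mul1r.
have uzX k : u * z ^+ k = z ^+ k * u by apply: commrX.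
suff pe k : pos (1 - z ^+ k - (u * z ^+ k) *+ k).
  by have := posD (pe n) (posX n pz); rewrite addrAC subrK.
elim: k => [|k IH]; first by rewrite expr0 subrr mulr0n subr0; exact: pos0.
suff -> : 1 - z ^+ k.+1 - (u * z ^+ k.+1) *+ k.+1 =
    (1 - z ^+ k - (u * z ^+ k) *+ k) + (u * u * z ^+ k) *+ k.+1.
  apply: posD => //; apply: posMn; apply: pos_mul; [|exact: posX|].
    by apply: pos_sqr; exact: pos_sa.
  by rewrite -mulrA uzX [LHS]mulrA uzX -mulrA.
have zS : z ^+ k.+1 = z ^+ k - u * z ^+ k by rewrite exprS {1}/z mulrBl mul1r.
rewrite zS mulrBr mulrA mulrnBl [u * _ *+ _.+1]mulrS.
move: (z ^+ k) (u * z ^+ k) (u * z ^+ k *+ k) (_ *+ _) => a p P Q.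
rewrite opprB [1 + _]addrCA opprB [p + _]addrC addrACA opprD [p + _]addrA subrr.
by rewrite add0r addrAC.
Qed.

(** A local approximate unit.  With x = b b^* / |b|^2 and 1 - u = (1 - x)^n one has
    |b - u b|^2 = |b|^2 |x (1 - x)^(2n)| <= |b|^2 / n by decay_bound.  Being a
    polynomial in b b^* without constant term, u lies in every subspace S that
    contains b b^* and is stable under multiplication by it. *)
Lemma approx_unit b (S : set A) (e : R) : closed_subspace S -> S (b ** cstar b) ->
  (forall y, S y -> S (y ** (b ** cstar b))) -> 0 < e ->
  exists u : A, [/\ S u, cstar u = u, nrm (b - u ** b) < e &
    forall y, nrm (y - u ** y) <= nrm y].
Proof.
move=> /closed_subspace_ops [_ S0 SD SN SZ] Sb SM e0.
have [->|/eqP b0] := eqVneq b 0.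
  exists 0; split; [by []|exact: cstar0| |].
    by rewrite cmul0x subr0 nrm0.
  by move=> y; rewrite cmul0x subr0.
have bp := nrm_gt0 b0; pose t := nrm b ^+ 2; have tp : 0 < t by rewrite exprn_gt0.
pose x := t^-1%:C *: (b ** cstar b).
have tx : t%:C *: x = b ** cstar b.
  by rewrite scalerA -rmorphM mulfV ?gt_eqF // rmorph1 scale1r.
have px : pos (uin x).
  by rewrite uinZ; apply: posZ; [rewrite invr_ge0 ltW|exact: apos_Mstar].
have x1 : nrm (uin x) <= 1.
  rewrite nrm_uin nrmZR ger0_norm ?invr_ge0 ?(ltW tp) // nrm_Mstar mulVf //.
  by rewrite gt_eqF.
pose z : U := 1 - uin x.
have one : (1%R : R)%:C%:A = 1 :> U by rewrite rmorph1 scale1r.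
have pz : pos z by rewrite /z -one; exact: pos_alg_sub.
have z1 : nrm z <= 1 by rewrite /z -one; exact: nrm_alg_sub.
have zX1 n : nrm (z ^+ n) <= 1.
  elim: n => [|n IH]; first exact: nrm1_le.
  rewrite exprS; apply: le_trans (nrmM _ _) _.
  by have := nrm_ge0 z; have := nrm_ge0 (z ^+ n); nra.
have uex n : exists2 u : A, S u & uin u = 1 - z ^+ n.
  elim: n => [|n [u Su uE]]; first by exists 0; rewrite // expr0 subrr.
  exists (x + u - u ** x).
    apply: (SD); first by apply: (SD) => //; apply: SZ.
    by apply: SN; rewrite cmulZr; apply/SZ/SM.
  rewrite uinB uinD uinM uE exprSr; move: (z ^+ n) => c; rewrite /z.
  move: (uin x) => a; rewrite mulrBl mul1r mulrBr mulr1 !opprB.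
  by rewrite [a + (1 - c)]addrC -addrA [a + (_ - a)]addrC subrK [RHS]addrA [RHS]addrAC.
have decay n : nrm (uin x * z ^+ n) *+ n <= 1.
  have := decay_bound n px pz; rewrite -/z => h.
  have uzX : uin x * z ^+ n = z ^+ n * uin x.
    by apply: commrX; rewrite /GRing.comm mulrBl mulrBr mulr1 mul1r.
  have pn : pos (uin x * z ^+ n) by apply: pos_mul => //; exact: posX.
  have := pos_nrm_le ler01 (posMn n pn); rewrite one => /(_ h).
  by rewrite -scaler_nat -(rmorph_nat (real_complex R)) nrmZR normr_nat mulr_natl.
have [N hN] := inv_lt (divr_gt0 (exprn_gt0 2 e0) tp).
have [u Su uE] := uex N.+1.
have subE y : uin (y - u ** y) = z ^+ N.+1 * uin y.
  by rewrite uinB uinM uE mulrBl mul1r opprB addrC subrK.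
exists u; split=> //.
- apply: uin_inj; rewrite uin_star uE cstarB ustar1; congr (_ - _).
  by apply/pos_sa/posX.
- rewrite -(ltr_pXn2r (n := 2)) ?nnegrE ?nrm_ge0 ?(ltW e0) //.
  rewrite -nrm_uin subE -nrm_Mstar ucmulE ustarMr (pos_sa (posX _ pz)).
  rewrite -mulrA [uin b * _]mulrA -uin_star -uinM -tx uinZ -scalerAl -scalerAr.
  rewrite nrmZR gtr0_norm // mulrC -ltr_pdivlMr //; apply: le_lt_trans (hN N (leqnn N)).
  apply: le_trans (nrmM _ _) _; apply: le_trans (ler_piMl _ (zX1 _)) _; rewrite ?nrm_ge0 //.
  rewrite -[leRHS]mul1r ler_pdivlMr ?ltr0n // mulr_natr; exact: decay.
- move=> y; rewrite -nrm_uin subE -[nrm y]nrm_uin; apply: le_trans (nrmM _ _) _.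
  by rewrite ler_piMl ?nrm_ge0.
Qed.

(** The element a is the limit of u a, where u comes from approx_unit for a a^*. *)
Lemma ideal_of_Mstar (K : set A) a : cstar_ideal K -> K (a ** cstar a) -> K a.
Proof.
move=> [sK KM] Ka; have [/closedP cK _ _ _ _] := closed_subspace_ops sK.
have KMa y : K y -> K (y ** (a ** cstar a)) by move=> Ky; case: (KM (a ** cstar a) y Ky).
apply: cK => e e0; have [u [Ku _ ue _]] := approx_unit sK Ka KMa e0.
by exists (u ** a) => //; case: (KM a u Ku).
Qed.

Lemma ideal_star (K : set A) a : cstar_ideal K -> K a -> K (cstar a).
Proof.
move=> iK Ka; apply: ideal_of_Mstar => //; rewrite cstarK.
by have [_ KM] := iK; case: (KM (cstar a) a Ka).
Qed.

(** The power of exponent n + 1, as there is no unit to serve as the power 0. *)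
Definition cpow a n := iter n (cmul a) a.

Lemma uin_cpow a n : uin (cpow a n) = uin a ^+ n.+1.
Proof. by elim: n => [//|n IH]; rewrite exprS -IH -uinM. Qed.

(** If |h| > 1 then all powers of h dominate, up to one constant, the same
    nonzero square x^2 = P, the positive part of h - 1.  Indeed P (h - 1) = P^2
    gives P h^n >= P, and (t - P) h^n >= 0 for t = |P|.  The scalar parts of P
    and of the two roots vanish, so x and y lie in the algebra. *)
Lemma square_below_powers (h : A) : apos h -> 1 < nrm h ->
  exists x t, [/\ x <> 0, 0 <= t, cstar x = x & forall n, exists y,
    t%:C *: cpow h n = cstar x ** x + cstar y ** y].
Proof.
move=> ph h1; pose H := uin h.
have Hs : cstar (H - 1) = H - 1 by rewrite cstarB ustar1 pos_sa.
have [P [g [pP pg HE Pg Pc]]] := pos_parts Hs.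
have P0 : P <> 0.
  move=> P0; move: h1; rewrite ltNge => /negP; apply.
  rewrite -nrm_uin; apply: pos_nrm_le ler01 ph _.
  by rewrite rmorph1 scale1r -opprB HE P0 sub0r opprK.
have PH : P * (H - 1) = P * P by rewrite HE mulrBr Pg subr0.
have PcH : H * P = P * H.
  by have [|-> _] := Pc H; rewrite // mulrBl mulrBr mulr1 mul1r.
have [x [px xE xc]] := pos_root pP.
have xs := pos_sa px.
have P2 : P.2 * (H - 1).2 = P.2 * P.2 by rewrite -!usnd_mul PH.
(* The scalar part r of x is real and satisfies r^2 (1 + r^2) = 0. *)
have x20 : x.2 = 0.
  have xr : (x.2^*)%R = x.2 by have := congr1 snd xs.
  have : (x.2 * x.2) * (1 + (x.2 * x.2)) = 0.
    have := P2; rewrite -xE !usnd_mul /= sub0r mulrN1 => e.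
    by rewrite mulrDr mulr1 -e subrr.
  have -> : x.2 * x.2 = `|x.2| ^+ 2 by rewrite normCK xr.
  move/eqP; rewrite mulf_eq0 expf_eq0 /= normr_eq0 => /orP[/eqP//|/eqP e].
  have : (0 : R[i]) < 1 + `|x.2| ^+ 2 by rewrite ltr_pwDl // exprn_ge0.
  by rewrite e ltxx.
have P20 : P.2 = 0 by rewrite -xE usnd_mul x20 mulr0.
exists x.1, (nrm P); split.
- by move=> x0; apply: P0; rewrite -xE -[x]uinK // x0 mulr0.
- exact: nrm_ge0.
- by apply: uin_inj; rewrite uin_star uinK.
move=> n; set t := nrm P.
have pd : pos (t%:C *: H ^+ n.+1 - P).
  have -> : t%:C *: H ^+ n.+1 - P =
      (t%:C%:A - P) * H ^+ n.+1 + P * P * (\sum_(i < n.+1) H ^+ i).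
    rewrite -PH -mulrA -subrX1 mulrBl mulrBr mulr1 -scalerAl mul1r.
    by rewrite addrA subrK.
  have cHX m : H ^+ m * P = P * H ^+ m.
    by apply/esym/commrX; rewrite /GRing.comm PcH.
  apply: posD.
    apply: pos_mul; [exact: pos_alg_sub|exact: posX|].
    by rewrite mulrBl mulrBr cHX algC.
  apply: pos_mul; first by apply: pos_sqr; exact: pos_sa.
    by elim/big_ind: _ => [|u v pu pv|i _]; [exact: pos0|exact: posD|exact: posX].
  rewrite mulr_sumr mulr_suml; apply: eq_bigr => i _.
  by rewrite -mulrA -cHX mulrA -cHX mulrA.
have [y [py yE _]] := pos_root pd.
have y20 : y.2 = 0.
  apply/eqP; have := congr1 snd yE; rewrite usnd_mul /= P20 subr0.
  rewrite exprS usnd_mul /= mul0r scaler0 => /eqP.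
  by rewrite mulf_eq0 orbb.
exists y.1; apply: uin_inj.
rewrite uinZ uin_cpow uinD !uinM !uin_star !uinK // (pos_sa py) xs xE yE.
by rewrite addrC subrK.
Qed.

End Consequences.

(** * Subalgebras and quotients *)

Definition subalg (R : realType) (A : cstarAlgType R) (S : set A)
  (hS : cstar_subalg S) : Type := {x : A | `[< S x >]}.

HB.instance Definition _ (R : realType) (A : cstarAlgType R) (S : set A)
  (hS : cstar_subalg S) := Choice.copy (subalg hS) {x : A | `[< S x >]}.

Section Subalgebra.
Variables (R : realType) (A : cstarAlgType R) (S : set A) (hS : cstar_subalg S).
Local Notation T := (subalg hS).
Implicit Types a b d : T.

Definition sval_sub a : A := sval a.

Lemma sub_mem a : S (sval_sub a).
Proof. by case: a => x /= /asboolP. Qed.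

Definition mk_sub x (Sx : S x) : T := exist _ x (asboolT Sx).

Lemma sub_inj : injective sval_sub.
Proof. exact: val_inj. Qed.

Let sP := closed_subspace_ops (let: And3 h _ _ := hS in h).
Let S0 : S 0. Proof. by have [] := sP. Qed.
Let SD x y : S x -> S y -> S (x + y). Proof. by have [_ _ h _ _] := sP; exact: h. Qed.
Let SN x : S x -> S (- x). Proof. by have [_ _ _ h _] := sP; exact: h. Qed.
Let SZ c x : S x -> S (c *: x). Proof. by have [_ _ _ _ h] := sP; exact: h. Qed.
Let SM x y : S x -> S y -> S (x ** y). Proof. by have [_ h _] := hS; exact: h. Qed.
Let Ss x : S x -> S (cstar x). Proof. by have [_ _ h] := hS; exact: h. Qed.

Definition sub_zero : T := mk_sub S0.
Definition sub_add a b : T := mk_sub (SD (sub_mem a) (sub_mem b)).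
Definition sub_opp a : T := mk_sub (SN (sub_mem a)).
Definition sub_scale (c : R[i]) a : T := mk_sub (SZ c (sub_mem a)).
Definition sub_mul a b : T := mk_sub (SM (sub_mem a) (sub_mem b)).
Definition sub_star a : T := mk_sub (Ss (sub_mem a)).

Lemma sub_addA : associative sub_add.
Proof. by move=> a b d; apply: sub_inj; exact: addrA. Qed.
Lemma sub_addC : commutative sub_add.
Proof. by move=> a b; apply: sub_inj; exact: addrC. Qed.
Lemma sub_add0 : left_id sub_zero sub_add.
Proof. by move=> a; apply: sub_inj; exact: add0r. Qed.
Lemma sub_addN : left_inverse sub_zero sub_opp sub_add.
Proof. by move=> a; apply: sub_inj; exact: addNr. Qed.

HB.instance Definition _ :=
  GRing.isZmodule.Build T sub_addA sub_addC sub_add0 sub_addN.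

Lemma sub_scaleA (c d : R[i]) a : sub_scale c (sub_scale d a) = sub_scale (c * d) a.
Proof. by apply: sub_inj; exact: scalerA. Qed.
Lemma sub_scale1 : left_id 1 sub_scale.
Proof. by move=> a; apply: sub_inj; exact: scale1r. Qed.
Lemma sub_scaleDr : right_distributive sub_scale +%R.
Proof. by move=> c a b; apply: sub_inj; exact: scalerDr. Qed.
Lemma sub_scaleDl (a : T) : {morph sub_scale^~ a : c d / c + d}.
Proof. by move=> c d; apply: sub_inj; exact: scalerDl. Qed.

HB.instance Definition _ := GRing.Zmodule_isLmodule.Build R[i] T
  sub_scaleA sub_scale1 sub_scaleDr sub_scaleDl.

Lemma sub_normD a b : `|sval_sub (a + b)| <= `|sval_sub a| + `|sval_sub b|.
Proof. exact: ler_normD. Qed.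
Lemma sub_normZ (c : R[i]) a : `|sval_sub (c *: a)| = `|c| * `|sval_sub a|.
Proof. exact: normrZ. Qed.
Lemma sub_norm0 a : `|sval_sub a| = 0 -> a = 0.
Proof. by move=> /eqP; rewrite normr_eq0 => /eqP a0; apply: sub_inj. Qed.

HB.instance Definition _ := Lmodule_isNormed.Build R[i] T
  sub_normD sub_normZ sub_norm0.

Lemma nrm_sub a : nrm a = nrm (sval_sub a). Proof. by []. Qed.

Lemma sub_complete (F : set_system T) : ProperFilter F -> cauchy F -> cvg F.
Proof.
apply: complete_of_rapid => u ur.
have [n||x ux] := @dominated_tends _ A (fun n => sval_sub (u n))
    (fun n => - (2 * 2^-1 ^+ n)) 0.
- by apply: le_trans (ur n) _; rewrite exprS; lra.
- by move=> n; rewrite oppr_le0 mulr_ge0 // exprn_ge0 // invr_ge0.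
have Sx : S x.
  by have [cS _ _ _ _] := sP; apply: closed_tends cS _ ux => n; exact: sub_mem.
by exists (mk_sub Sx).
Qed.

HB.instance Definition _ := Uniform_isComplete.Build T sub_complete.

Lemma sub_mulA : associative sub_mul.
Proof. by move=> a b d; apply: sub_inj; exact: cmulA. Qed.
Lemma sub_mulDl a b d : sub_mul (a + b) d = sub_mul a d + sub_mul b d.
Proof. by apply: sub_inj; exact: cmulDl. Qed.
Lemma sub_mulDr a b d : sub_mul a (b + d) = sub_mul a b + sub_mul a d.
Proof. by apply: sub_inj; exact: cmulDr. Qed.
Lemma sub_mulZl (c : R[i]) a b : sub_mul (c *: a) b = c *: sub_mul a b.
Proof. by apply: sub_inj; exact: cmulZl. Qed.
Lemma sub_mulZr (c : R[i]) a b : sub_mul a (c *: b) = c *: sub_mul a b.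
Proof. by apply: sub_inj; exact: cmulZr. Qed.
Lemma sub_starK : involutive sub_star.
Proof. by move=> a; apply: sub_inj; exact: cstarK. Qed.
Lemma sub_starD a b : sub_star (a + b) = sub_star a + sub_star b.
Proof. by apply: sub_inj; exact: cstarD. Qed.
Lemma sub_starZ (c : R[i]) a : sub_star (c *: a) = (c^*)%R *: sub_star a.
Proof. by apply: sub_inj; exact: cstarZ. Qed.
Lemma sub_starM a b : sub_star (sub_mul a b) = sub_mul (sub_star b) (sub_star a).
Proof. by apply: sub_inj; exact: cstarM. Qed.
Lemma sub_normM a b : `|sub_mul a b| <= `|a| * `|b|.
Proof. exact: cnormM. Qed.
Lemma sub_norm_star a : `|sub_mul (sub_star a) a| = `|a| ^+ 2.
Proof. exact: cnorm_star. Qed.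

HB.instance Definition _ := isCStarAlgebra.Build R T
  sub_mulA sub_mulDl sub_mulDr sub_mulZl sub_mulZr sub_starK sub_starD sub_starZ
  sub_starM sub_normM sub_norm_star.

End Subalgebra.

(** Cosets are encoded by chosen representatives, so that the quotient is a
    subtype of the algebra and inherits its choice structure. *)
Definition coset_rep (R : realType) (A : cstarAlgType R) (K : set A) (x : A) : A :=
  get [set y | K (x - y)].

Definition quot (R : realType) (A : cstarAlgType R) (K : set A)
  (hK : cstar_ideal K) : Type := {x : A | coset_rep K x == x}.

HB.instance Definition _ (R : realType) (A : cstarAlgType R) (K : set A)
  (hK : cstar_ideal K) := Choice.copy (quot hK) {x : A | coset_rep K x == x}.

Section Quotient.
Variables (R : realType) (A : cstarAlgType R) (K : set A) (hK : cstar_ideal K).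
Local Notation Q := (quot hK).
Implicit Types (a b d : Q) (x y z : A).

Let kP := closed_subspace_ops (proj1 hK).
Let K0 : K 0. Proof. by have [] := kP. Qed.
Let KD x y : K x -> K y -> K (x + y). Proof. by have [_ _ h _ _] := kP; exact: h. Qed.
Let KN x : K x -> K (- x). Proof. by have [_ _ _ h _] := kP; exact: h. Qed.
Let KZ c x : K x -> K (c *: x). Proof. by have [_ _ _ _ h] := kP; exact: h. Qed.
Let KMl x y : K y -> K (x ** y). Proof. by have [_ h] := hK; move/(h x) => []. Qed.
Let KMr x y : K y -> K (y ** x). Proof. by have [_ h] := hK; move/(h x) => []. Qed.
Let Ks x : K x -> K (cstar x). Proof. exact: ideal_star. Qed.

Lemma coset_repP x : K (x - coset_rep K x).
Proof. by apply: (getI (P := [set y | K (x - y)]) (x := x)); rewrite /= subrr. Qed.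

Lemma coset_rep_eq x y : K (x - y) -> coset_rep K x = coset_rep K y.
Proof.
move=> Kxy; congr get; apply/seteqP; split=> z /= h.
  by have := KD (KN Kxy) h; rewrite opprB addrA subrK.
by have := KD Kxy h; rewrite addrA subrK.
Qed.

Lemma coset_rep_idem x : coset_rep K (coset_rep K x) == coset_rep K x.
Proof. by apply/eqP/esym/coset_rep_eq/coset_repP. Qed.

Definition qpi x : Q := exist _ (coset_rep K x) (coset_rep_idem x).
Definition qrep a : A := sval a.

Lemma qrepK a : qpi (qrep a) = a.
Proof. by apply: val_inj; case: a => x /= /eqP. Qed.

Lemma qpi_eq x y : qpi x = qpi y <-> K (x - y).
Proof.
split=> [/(congr1 val) /= e|h]; last by apply: val_inj; exact: coset_rep_eq.
have := KD (coset_repP x) (KN (coset_repP y)).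
by rewrite e opprB addrA subrK.
Qed.

Lemma qrepP x : K (qrep (qpi x) - x).
Proof. by rewrite -opprB; apply: KN; exact: coset_repP. Qed.

Definition qadd a b := qpi (qrep a + qrep b).
Definition qopp a := qpi (- qrep a).
Definition qscale (c : R[i]) a := qpi (c *: qrep a).
Definition qmul a b := qpi (qrep a ** qrep b).
Definition qstar a := qpi (cstar (qrep a)).

Lemma qaddE x y : qadd (qpi x) (qpi y) = qpi (x + y).
Proof. by apply/qpi_eq; rewrite opprD addrACA; apply: KD; exact: qrepP. Qed.
Lemma qoppE x : qopp (qpi x) = qpi (- x).
Proof. by apply/qpi_eq; rewrite -opprD; apply: KN; exact: qrepP. Qed.
Lemma qscaleE c x : qscale c (qpi x) = qpi (c *: x).
Proof. by apply/qpi_eq; rewrite -scalerBr; apply: KZ; exact: qrepP. Qed.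
Lemma qmulE x y : qmul (qpi x) (qpi y) = qpi (x ** y).
Proof.
apply/qpi_eq; set x' := qrep _; set y' := qrep _.
have -> : x' ** y' - x ** y = x' ** (y' - y) + (x' - x) ** y.
  by rewrite cmulBr cmulBl addrA subrK.
by apply: KD; [apply: KMl|apply: KMr]; exact: qrepP.
Qed.
Lemma qstarE x : qstar (qpi x) = qpi (cstar x).
Proof. by apply/qpi_eq; rewrite -cstarB; apply: Ks; exact: qrepP. Qed.

Lemma qaddA : associative qadd.
Proof.
by move=> a b d; rewrite -[a]qrepK -[b]qrepK -[d]qrepK !qaddE addrA.
Qed.
Lemma qaddC : commutative qadd.
Proof. by move=> a b; rewrite -[a]qrepK -[b]qrepK !qaddE addrC. Qed.
Lemma qadd0 : left_id (qpi 0) qadd.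
Proof. by move=> a; rewrite -[a]qrepK qaddE add0r. Qed.
Lemma qaddN : left_inverse (qpi 0) qopp qadd.
Proof. by move=> a; rewrite -[a]qrepK qoppE qaddE addNr. Qed.

HB.instance Definition _ := GRing.isZmodule.Build Q qaddA qaddC qadd0 qaddN.

Lemma qscaleA (c d' : R[i]) a : qscale c (qscale d' a) = qscale (c * d') a.
Proof. by rewrite -[a]qrepK !qscaleE scalerA. Qed.
Lemma qscale1 : left_id 1 qscale.
Proof. by move=> a; rewrite -[a]qrepK qscaleE scale1r. Qed.
Lemma qscaleDr : right_distributive qscale +%R.
Proof.
move=> c a b; rewrite -[a]qrepK -[b]qrepK.
by rewrite [_ + _]qaddE !qscaleE [RHS]qaddE scalerDr.
Qed.
Lemma qscaleDl a : {morph qscale^~ a : c d / c + d}.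
Proof.
by move=> c d; rewrite -[a]qrepK !qscaleE [RHS]qaddE scalerDl.
Qed.

HB.instance Definition _ := GRing.Zmodule_isLmodule.Build R[i] Q
  qscaleA qscale1 qscaleDr qscaleDl.

Lemma qpiD x y : qpi (x + y) = qpi x + qpi y.
Proof. by rewrite [RHS]qaddE. Qed.
Lemma qpiN x : qpi (- x) = - qpi x.
Proof. by rewrite [RHS]qoppE. Qed.
Lemma qpiB x y : qpi (x - y) = qpi x - qpi y.
Proof. by rewrite qpiD qpiN. Qed.
Lemma qpiZ (c : R[i]) x : qpi (c *: x) = c *: qpi x.
Proof. by rewrite [RHS]qscaleE. Qed.
Lemma qpi0P x : qpi x = 0 <-> K x.
Proof. by rewrite -[X in K X]subr0; exact: qpi_eq. Qed.

Definition qnorm a : R := inf [set nrm x | x in [set x | qpi x = a]].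

Lemma qnorm_has_inf a : has_inf [set nrm x | x in [set x | qpi x = a]].
Proof.
split; first by exists (nrm (qrep a)), (qrep a) => //; exact: qrepK.
by exists 0 => _ [x _ <-]; exact: nrm_ge0.
Qed.

Lemma qnorm_le x : qnorm (qpi x) <= nrm x.
Proof. by apply: inf_lbound (proj2 (qnorm_has_inf _)) _ _; exists x. Qed.

Lemma qnorm_lift a e : 0 < e -> exists2 x, qpi x = a & nrm x < qnorm a + e.
Proof.
move=> e0; have [_ [x xa <-] h] := inf_adherent e0 (qnorm_has_inf a).
by exists x.
Qed.

Lemma le_qnorm r a : (forall x, qpi x = a -> r <= nrm x) -> r <= qnorm a.
Proof.
move=> h; apply: lb_le_inf; first by have [] := qnorm_has_inf a.
by move=> _ [x /h ? <-].
Qed.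

Lemma qnorm_ge0 a : 0 <= qnorm a.
Proof. by apply: le_qnorm => x _; exact: nrm_ge0. Qed.

Lemma qnormD a b : qnorm (a + b) <= qnorm a + qnorm b.
Proof.
apply/ler_addgt0Pr => e e0; have e2 : 0 < e / 2 by rewrite divr_gt0.
have [x <- hx] := qnorm_lift a e2; have [y <- hy] := qnorm_lift b e2.
rewrite -qpiD; apply: le_trans (qnorm_le _) _.
by have := ler_nrmD x y; move: hx hy; lra.
Qed.

Lemma qnormZ_le (c : R[i]) a : qnorm (c *: a) <= cabs c * qnorm a.
Proof.
have [->|c0] := eqVneq c 0.
  rewrite cabs0 mul0r scale0r -[0]/(qpi 0); apply: le_trans (qnorm_le _) _.
  by rewrite nrm0.
have cp : 0 < cabs c.
  by rewrite lt_neqAle cabs_ge0 andbT eq_sym; apply/eqP => /cabs_eq0 /eqP; exact/negP.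
rewrite -ler_pdivrMl //; apply: le_qnorm => x <-.
rewrite ler_pdivrMl // -nrmZ -qpiZ; exact: qnorm_le.
Qed.

Lemma qnormZ (c : R[i]) a : qnorm (c *: a) = cabs c * qnorm a.
Proof.
apply/eqP; rewrite eq_le qnormZ_le /=.
have [->|c0] := eqVneq c 0; first by rewrite cabs0 mul0r qnorm_ge0.
have := qnormZ_le c^-1 (c *: a); rewrite scalerA mulVf // scale1r.
have : cabs c * cabs c^-1 = 1.
  by rewrite -cabsM mulfV // -(rmorph1 (real_complex R)) cabsR normr1.
have := cabs_ge0 c; have := qnorm_ge0 a; have := qnorm_ge0 (c *: a).
by move: (cabs c) (cabs _) (qnorm a) (qnorm _) => s t x y; nra.
Qed.

Lemma qnorm_eq0 a : qnorm a = 0 -> a = 0.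
Proof.
move=> a0; rewrite -[a]qrepK; apply/qpi0P.
have [/closedP cK _ _ _ _] := kP; apply: cK => e e0.
have [x xa] := qnorm_lift a e0; rewrite a0 add0r => xe.
exists (qrep a - x); last by rewrite subKr.
by apply/qpi_eq; rewrite qrepK.
Qed.

Definition qnormC a : R[i] := (qnorm a)%:C.

Lemma qnormCD a b : qnormC (a + b) <= qnormC a + qnormC b.
Proof. by rewrite -rmorphD lecR qnormD. Qed.
Lemma qnormCZ (c : R[i]) a : qnormC (c *: a) = `|c| * qnormC a.
Proof. by rewrite /qnormC qnormZ rmorphM /= cabsE. Qed.
Lemma qnormC_eq0 a : qnormC a = 0 -> a = 0.
Proof. by move=> /(@complexI R); exact: qnorm_eq0. Qed.

HB.instance Definition _ := Lmodule_isNormed.Build R[i] Q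
  qnormCD qnormCZ qnormC_eq0.

Lemma nrm_quot a : nrm a = qnorm a. Proof. by []. Qed.

(** The steps of a rapidly converging sequence lift to elements of almost the same
    norm, and the lifts are summable. *)
Lemma quot_complete (F : set_system Q) : ProperFilter F -> cauchy F -> cvg F.
Proof.
apply: complete_of_rapid => u ur.
have e0 n : 0 < (2^-1 : R) ^+ n by rewrite exprn_gt0 // invr_gt0.
have lift n : exists x, qpi x = u n.+1 - u n /\ nrm x <= 2 * 2^-1 ^+ n.
  have [x xE xn] := qnorm_lift (u n.+1 - u n) (e0 n); exists x; split=> //.
  by have := ur n; rewrite nrm_quot; move: xn; lra.
have [d hd] := choice lift.
pose y n := qrep (u 0%N) + \sum_(i < n) d i.
have yS n : y n.+1 = y n + d n by rewrite /y big_ord_recr addrA.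
have yE n : qpi (y n) = u n.
  elim: n => [|n IH]; first by rewrite /y big_ord0 addr0 qrepK.
  by rewrite yS qpiD IH (proj1 (hd n)) addrC subrK.
have [n||x yx] := @dominated_tends _ A y (fun n => - (4 * 2^-1 ^+ n)) 0.
- rewrite yS addrAC subrr add0r.
  by apply: le_trans (proj2 (hd n)) _; rewrite exprS; lra.
- by move=> n; rewrite oppr_le0 mulr_ge0 // ltW.
exists (qpi x) => e /yx[N hN]; exists N => n /hN.
rewrite -yE -qpiB; apply: le_lt_trans; exact: qnorm_le.
Qed.

HB.instance Definition _ := Uniform_isComplete.Build Q quot_complete.

Lemma qmulA : associative qmul.
Proof. by move=> a b d; rewrite -[a]qrepK -[b]qrepK -[d]qrepK !qmulE cmulA. Qed.
Lemma qmulDl a b d : qmul (a + b) d = qmul a d + qmul b d.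
Proof.
by rewrite -[a]qrepK -[b]qrepK -[d]qrepK -qpiD !qmulE -qpiD cmulDl.
Qed.
Lemma qmulDr a b d : qmul a (b + d) = qmul a b + qmul a d.
Proof.
by rewrite -[a]qrepK -[b]qrepK -[d]qrepK -qpiD !qmulE -qpiD cmulDr.
Qed.
Lemma qmulZl (c : R[i]) a b : qmul (c *: a) b = c *: qmul a b.
Proof. by rewrite -[a]qrepK -[b]qrepK -qpiZ !qmulE -qpiZ cmulZl. Qed.
Lemma qmulZr (c : R[i]) a b : qmul a (c *: b) = c *: qmul a b.
Proof. by rewrite -[a]qrepK -[b]qrepK -qpiZ !qmulE -qpiZ cmulZr. Qed.
Lemma qstarK : involutive qstar.
Proof. by move=> a; rewrite -[a]qrepK !qstarE cstarK. Qed.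
Lemma qstarD a b : qstar (a + b) = qstar a + qstar b.
Proof. by rewrite -[a]qrepK -[b]qrepK -qpiD !qstarE -qpiD cstarD. Qed.
Lemma qstarZ (c : R[i]) a : qstar (c *: a) = (c^*)%R *: qstar a.
Proof. by rewrite -[a]qrepK -qpiZ !qstarE -qpiZ cstarZ. Qed.
Lemma qstarM a b : qstar (qmul a b) = qmul (qstar b) (qstar a).
Proof. by rewrite -[a]qrepK -[b]qrepK qmulE !qstarE qmulE cstarM. Qed.

(** The product is estimated one factor at a time, dividing by the norm of a lift. *)
Lemma qnormM a b : qnorm (qmul a b) <= qnorm a * qnorm b.
Proof.
have h x y : qpi x = a -> qpi y = b -> qnorm (qmul a b) <= nrm x * nrm y.
  by move=> <- <-; rewrite qmulE; apply: le_trans (qnorm_le _) (nrm_cmul _ _).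
have h2 x : qpi x = a -> qnorm (qmul a b) <= nrm x * qnorm b.
  move=> xa; have := nrm_ge0 x; rewrite le_eqVlt => /predU1P[x0|xp].
    by rewrite -x0 mul0r; have := h _ _ xa (qrepK b); rewrite -x0 mul0r.
  by rewrite -ler_pdivrMl //; apply: le_qnorm => y yb; rewrite ler_pdivrMl // h.
have := qnorm_ge0 b; rewrite le_eqVlt => /predU1P[b0|bp].
  by rewrite -b0 mulr0; have := h2 _ (qrepK a); rewrite -b0 mulr0.
by rewrite -ler_pdivrMr //; apply: le_qnorm => x xa; rewrite ler_pdivrMr // h2.
Qed.

Lemma qnorm_star a : qnorm (qstar a) = qnorm a.
Proof.
have le b : qnorm (qstar b) <= qnorm b.
  apply: le_qnorm => x <-; rewrite qstarE -nrm_star; exact: qnorm_le.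
by apply/eqP; rewrite eq_le le -{1}[a]qstarK le.
Qed.

(** If z lifts a^* a, then i = z - x^* x is in the ideal, and cutting x by an
    approximate unit adapted to i alone gives lifts of a whose squared norm
    exceeds |z| by arbitrarily little. *)
Lemma qnorm_starM a : qnorm (qmul (qstar a) a) = qnorm a ^+ 2.
Proof.
apply/eqP; rewrite eq_le; apply/andP; split.
  by apply: le_trans (qnormM _ _) _; rewrite qnorm_star.
apply: le_qnorm => z zE; pose x := qrep a; pose i := z - cstar x ** x.
have Ki : K i by apply/qpi_eq; rewrite zE -[a]qrepK qstarE qmulE.
apply/ler_addgt0Pr => e e0.
have KMi y : K y -> K (y ** (i ** cstar i)) by move=> Ky; exact: KMr.
have [u [Ku us ui ul]] := approx_unit (proj1 hK) (KMr _ Ki) KMi e0.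
have ur w : nrm (w - w ** u) <= nrm w.
  by have := ul (cstar w); rewrite -{1}us -cstarM -cstarB !nrm_star.
pose y := x - x ** u.
have ya : qpi y = a.
  rewrite -[RHS]qrepK; apply/qpi_eq.
  by rewrite /y addrAC subrr add0r; apply: KN; exact: KMl.
apply: (@le_trans _ _ (nrm y ^+ 2)).
  by rewrite lerXn2r ?nnegrE ?nrm_ge0 ?qnorm_ge0 // -ya qnorm_le.
rewrite -nrm_starM.
pose r w := w - w ** u; have rE w : r w = w - w ** u by [].
have rB v w : r (v - w) = r v - r w.
  by rewrite /r cmulBl !opprB [LHS]addrACA [RHS]addrACA [- w + _]addrC.
clearbody r; pose W w := r w - u ** r w.
have WB v w : W (v - w) = W v - W w.
  by rewrite /W rB cmulBr !opprB [LHS]addrACA [RHS]addrACA [- r w + _]addrC.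
have Wi : W i = r (i - u ** i).
  by rewrite rB /W !rE cmulBr cmulA.
have -> : cstar y ** y = W z - W i.
  by rewrite -WB opprB addrC subrK /W !rE /y cstarB cstarM us cmulBl !cmulBr !cmulA.
apply: le_trans (ler_nrmB _ _) _; apply: lerD.
  by rewrite /W; apply: le_trans (ul _) _; rewrite rE; exact: ur.
rewrite Wi rE; apply: le_trans (ur _) _; exact: ltW.
Qed.

Lemma qnormCM a b : `|qmul a b| <= `|a| * `|b|.
Proof. by rewrite !nrmE -rmorphM lecR qnormM. Qed.
Lemma qnormC_star a : `|qmul (qstar a) a| = `|a| ^+ 2.
Proof. by rewrite !nrmE -rmorphXn /= nrm_quot qnorm_starM. Qed.

HB.instance Definition _ := isCStarAlgebra.Build R Q
  qmulA qmulDl qmulDr qmulZl qmulZr qstarK qstarD qstarZ qstarM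
  qnormCM qnormC_star.

Lemma qpiM x y : qpi (x ** y) = cmul (qpi x) (qpi y).
Proof. by rewrite [RHS]qmulE. Qed.

Lemma qpi_star x : qpi (cstar x) = cstar (qpi x).
Proof. by rewrite [RHS]qstarE. Qed.

End Quotient.

(** * Direct sums of Fell bundles and topologically graded norms *)

Section DirectSum.
Variables (R : realType) (G : groupType) (A : cstarAlgType R).
Implicit Types (B J : G -> set A) (f g : G -> A) (s t : G) (a b : A).

Lemma fsum_seq (F : G -> A) (r : seq G) : uniq r ->
  (forall s, F s <> 0 -> s \in r) ->
  \sum_(s \in [set: G]) F s = \sum_(s <- r) F s.
Proof.
move=> ur Fr; rewrite (fsbigE r) //; first by apply: eq_bigl => s; rewrite in_setT.
by move=> s _ sr; apply: contrapT => Fs; move/negP: sr; apply; exact: Fr.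
Qed.

Lemma fsum1 (F : G -> A) s : (forall r, r <> s -> F r = 0) ->
  \sum_(r \in [set: G]) F r = F s.
Proof.
move=> h; rewrite (@fsum_seq _ [:: s]) ?big_seq1 // => r Fr.
by rewrite inE; apply/eqP; apply: contrapT => rs; exact/Fr/h.
Qed.

Lemma dsum_mul_singlel s b f t : dsum_mul (dsum_single s b) f t = b ** f (s^-1 * t)%g.
Proof.
rewrite /dsum_mul (@fsum1 _ s) /dsum_single ?eqxx // => r /eqP/negbTE ->.
exact: cmul0x.
Qed.

Lemma dsum_mul_singler s b f t : dsum_mul f (dsum_single s b) t = f (t * s^-1)%g ** b.
Proof.
rewrite /dsum_mul (@fsum1 _ (t * s^-1)%g) /dsum_single.
  by rewrite invgM invgK mulgVK eqxx.
move=> r rs; case: eqP => [e|_]; last exact: cmulx0.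
by case: rs; rewrite -e invgM invgK mulVKg.
Qed.

Lemma dsum_star_single s b : dsum_star (dsum_single s b) = dsum_single s^-1%g (cstar b).
Proof.
apply/funext => t; rewrite /dsum_star /dsum_single.
by rewrite -{1}[s]invgK eqg_inv; case: eqP => // _; rewrite cstar0.
Qed.

Lemma dsum_mul_single s t a b :
  dsum_mul (dsum_single s a) (dsum_single t b) = dsum_single (s * t)%g (a ** b).
Proof.
apply/funext => r; rewrite dsum_mul_singlel /dsum_single.
rewrite -(inj_eq (mulgI s)) mulVKg; case: eqP => // _; exact: cmulx0.
Qed.

Lemma dsum_single0 s : dsum_single s (0 : A) = 0.
Proof. by apply/funext => t; rewrite /dsum_single; case: eqP. Qed.

Lemma dsum_singleD s a b : dsum_single s (a + b) = dsum_single s a + dsum_single s b.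
Proof.
by apply/funext => t; rewrite addrfctE /dsum_single; case: eqP => // _; rewrite addr0.
Qed.

Lemma dsum_singleZ s (c : R[i]) b : dsum_single s (c *: b) = c *: dsum_single s b.
Proof.
by apply/funext => t; rewrite scalrfctE /dsum_single; case: eqP => // _; rewrite scaler0.
Qed.

Lemma dsum_supp B f : dsum B f -> exists r : seq G, uniq r /\ forall s, f s <> 0 -> s \in r.
Proof.
case=> _ ff; exists (fset_set [set t | f t != 0]); split; first exact: fset_uniq.
by move=> s /eqP fs; rewrite in_fset_set //; exact: mem_set.
Qed.

Lemma dsum_of_supp B f (r : seq G) : (forall t, B t (f t)) ->
  (forall s, f s <> 0 -> s \in r) -> dsum B f.
Proof.
move=> Bf fr; split=> //; apply: (@sub_finite_set _ _ [set` r]).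
  by move=> s /= /eqP; exact: fr.
exact: finite_seq.
Qed.

(** The value at the unit of f^* f is the sum of the f_t^* f_t. *)
Lemma dsum_gram B f : dsum B f ->
  apos (dsum_mul (dsum_star f) f 1%g) /\
  forall t, apos (dsum_mul (dsum_star f) f 1%g - cstar (f t) ** f t).
Proof.
move=> /dsum_supp [r [ur fr]].
pose F s := cstar (f s) ** f s.
have FE : dsum_mul (dsum_star f) f 1%g = \sum_(s <- r) F s.
  rewrite /dsum_mul /dsum_star (@fsum_seq _ [seq s^-1%g | s <- r]).
  - by rewrite big_map; apply: eq_bigr => s _; rewrite invgK mulg1.
  - by rewrite map_inj_uniq //; exact: invg_inj.
  - move=> s h; rewrite -[s]invgK map_f //; apply: fr => fs; apply: h.
    by rewrite fs cstar0 cmul0x.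
have pF (q : seq G) : apos (\sum_(s <- q) F s).
  by elim/big_ind: _ => [|x y|s _]; [exact: apos0|exact: aposD|exact: apos_starM].
split=> [|t]; first by rewrite FE.
have [tr|tr] := boolP (t \in r); last first.
  suff -> : f t = 0 by rewrite cmulx0 subr0 FE.
  by apply: contrapT => /fr; exact/negP.
by rewrite FE (big_rem t) //= addrAC subrr add0r.
Qed.

Section Bundle.
Variables (B : G -> set A) (hB : fell_bundle B).

Lemma fell_subspace t : [/\ closed (B t), B t 0, forall x y, B t x -> B t y -> B t (x + y),
  forall x, B t x -> B t (- x) & forall (c : R[i]) x, B t x -> B t (c *: x)].
Proof. by apply: closed_subspace_ops; case: hB. Qed.

Lemma fell_mul s t a b : B s a -> B t b -> B (s * t)%g (a ** b).
Proof. by case: hB => _ _; exact. Qed.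

Lemma fell_star t a : B t a -> B t^-1%g (cstar a).
Proof. by case: hB => _ h _ Ba; rewrite -h; exists a. Qed.

Lemma fell_unit : cstar_subalg (B 1%g).
Proof.
split; first by case: hB.
- by move=> x y Bx By; rewrite -[1%g]mulg1; exact: fell_mul.
- by move=> x Bx; rewrite -[1%g]invg1; exact: fell_star.
Qed.

Lemma dsum_lin (c : R[i]) f g : dsum B f -> dsum B g -> dsum B (c *: f + g).
Proof.
move=> hf hg; have [rf [_ fr]] := dsum_supp hf; have [rg [_ gr]] := dsum_supp hg.
apply: (@dsum_of_supp _ _ (rf ++ rg)) => [t|s h].
  have [_ _ BD _ BZ] := fell_subspace t.
  by apply: (BD); [apply: (BZ); case: hf|case: hg].
rewrite mem_cat; apply/orP; apply: contrapT => /not_orP[h1 h2]; apply: h.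
rewrite addrfctE scalrfctE.
have -> : f s = 0 by apply: contrapT => /fr.
have -> : g s = 0 by apply: contrapT => /gr.
by rewrite scaler0 addr0.
Qed.

Lemma dsum0 : dsum B 0.
Proof.
by apply: (@dsum_of_supp _ _ [::]) => // t; have [] := fell_subspace t.
Qed.

Lemma dsumZ (c : R[i]) f : dsum B f -> dsum B (c *: f).
Proof. by move=> hf; rewrite -[_ *: _]addr0; apply: dsum_lin => //; exact: dsum0. Qed.

Lemma dsumD f g : dsum B f -> dsum B g -> dsum B (f + g).
Proof. by move=> hf hg; rewrite -[f]scale1r; exact: dsum_lin. Qed.

Lemma dsumB f g : dsum B f -> dsum B g -> dsum B (f - g).
Proof.
by move=> hf hg; rewrite addrC -scaleN1r; exact: dsum_lin.
Qed.

Lemma dsum_singleP t b : B t b -> dsum B (dsum_single t b).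
Proof.
move=> Bb; apply: (@dsum_of_supp _ _ [:: t]) => [s|s]; rewrite /dsum_single.
  by case: eqP => [->//|_]; have [] := fell_subspace s.
by case: eqP => [-> _|//]; rewrite inE.
Qed.

Lemma dsum_starP f : dsum B f -> dsum B (dsum_star f).
Proof.
move=> hf; have [rf [_ fr]] := dsum_supp hf.
apply: (@dsum_of_supp _ _ [seq s^-1%g | s <- rf]) => [t|s h].
  by rewrite -{1}[t]invgK; apply: fell_star; case: hf.
rewrite -[s]invgK map_f //; apply: fr => fs; apply: h.
by rewrite /dsum_star fs cstar0.
Qed.

Lemma dsum_mulP f g : dsum B f -> dsum B g -> dsum B (dsum_mul f g).
Proof.
move=> hf hg; have [rf [uf fr]] := dsum_supp hf; have [rg [_ gr]] := dsum_supp hg.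
have E t : dsum_mul f g t = \sum_(s <- rf) (f s ** g (s^-1 * t)%g).
  apply: fsum_seq => // s h; apply: fr => fs; apply: h.
  by rewrite fs cmul0x.
apply: (@dsum_of_supp _ _ [seq (s * t)%g | s <- rf, t <- rg]) => [t|t h].
  have [_ B0 BD _ _] := fell_subspace t.
  rewrite E; elim/big_ind: _ => [//|x y|s _]; first exact: BD.
  by rewrite -{1}[t](mulVKg s); apply: fell_mul; [case: hf|case: hg].
apply: contrapT => nt; apply: h; rewrite E big1_seq // => s /= sr.
have -> : g (s^-1 * t)%g = 0; last exact: cmulx0.
apply: contrapT => /gr h; apply: nt; apply/allpairsP.
by exists (s, (s^-1 * t)%g); rewrite /= mulVKg.
Qed.

Lemma dsum_ind (S : set (G -> A)) : S 0 ->
  (forall t b, B t b -> S (dsum_single t b)) ->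
  (forall f g, dsum B f -> dsum B g -> S f -> S g -> S (f + g)) ->
  forall f, dsum B f -> S f.
Proof.
move=> S0 Ss SD f hf; have [r [_ fr]] := dsum_supp hf.
elim: r f hf fr => [|t r IH] f hf fr.
  suff -> : f = 0 by [].
  by apply/funext => s; apply: contrapT => /fr.
have Bt : B t (f t) by case: hf.
have h1 := dsum_singleP Bt.
rewrite -[f](subrK (dsum_single t (f t))).
apply: SD => //; [exact: dsumB| |exact: Ss].
apply: IH; first exact: dsumB.
move=> s; rewrite addrfctE opprfctE /dsum_single; case: (eqVneq s t) => [->|st].
  by rewrite subrr.
by rewrite subr0 => /fr; rewrite inE (negbTE st).
Qed.

(** The real-valued form of topologically_graded_norm; definiteness is a
    consequence of tgnorm_coef. *)
Definition tgnorm (p : (G -> A) -> R) : Prop :=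
  [/\ forall f g, dsum B f -> dsum B g -> p (f + g) <= p f + p g,
      forall (c : R[i]) f, dsum B f -> p (c *: f) = cabs c * p f,
      forall f g, dsum B f -> dsum B g -> p (dsum_mul f g) <= p f * p g,
      forall f, dsum B f -> p (dsum_mul (dsum_star f) f) = p f ^+ 2 &
      forall f, dsum B f -> nrm (f 1%g) <= p f].

Lemma tgnorm_ge0 p f : tgnorm p -> dsum B f -> 0 <= p f.
Proof. by case=> _ _ _ _ h /h; apply: le_trans; exact: nrm_ge0. Qed.

Lemma tgnorm_of_complex (p : (G -> A) -> R[i]) : topologically_graded_norm B p ->
  tgnorm (fun f => complex.Re (p f)) /\
  forall f, dsum B f -> p f = (complex.Re (p f))%:C.
Proof.
move=> [[pD pZ _ pM pC] p1].
have pR f : dsum B f -> p f = (complex.Re (p f))%:C.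
  by move=> hf; rewrite ge0_ReK //; exact: le_trans (p1 _ hf).
split=> //; split=> [f g hf hg|c f hf|f g hf hg|f hf|f hf].
- by rewrite -lecR rmorphD /= -!pR ?pD //; exact: dsumD.
- apply: (@complexI R); rewrite rmorphM /= -cabsE -!pR ?pZ //; exact: dsumZ.
- by rewrite -lecR rmorphM /= -!pR ?pM //; exact: dsum_mulP.
- apply: (@complexI R); rewrite rmorphXn /= -!pR ?pC //.
  by apply: dsum_mulP => //; exact: dsum_starP.
- by rewrite -lecR -pR // -nrmE p1.
Qed.

(** On the unit fibre this is automatic continuity of C*-seminorms; the other
    fibres reduce to it by p(b)^2 = p(b^* b). *)
Lemma tgnorm_single p t b : tgnorm p -> B t b -> p (dsum_single t b) <= nrm b.
Proof.
move=> hp Bb; have [pD pZ pM pC _] := hp.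
have cs : cseminorm (B 1%g) (fun b => p (dsum_single 1%g b)).
  split=> [x y Bx By|c x Bx|x y Bx By|x Bx].
  - by rewrite dsum_singleD; apply: pD; exact: dsum_singleP.
  - by rewrite dsum_singleZ; apply: pZ; exact: dsum_singleP.
  - have -> : dsum_single (1%g : G) (x ** y) =
        dsum_mul (dsum_single 1%g x) (dsum_single 1%g y).
      by rewrite dsum_mul_single mulg1.
    by apply: (pM); exact: dsum_singleP.
  - have -> : dsum_single (1%g : G) (cstar x ** x) =
        dsum_mul (dsum_star (dsum_single 1%g x)) (dsum_single 1%g x).
      by rewrite dsum_star_single dsum_mul_single invg1 mulg1.
    by rewrite pC //; exact: dsum_singleP.
have hd := dsum_singleP Bb.
have p0 := tgnorm_ge0 hp hd.
rewrite -(ler_pXn2r (n := 2)) ?nnegrE ?nrm_ge0 // -pC // -nrm_starM.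
rewrite dsum_star_single dsum_mul_single mulVg.
apply: (cseminorm_le fell_unit cs).
by rewrite -[1%g](mulVg t); apply: fell_mul => //; exact: fell_star.
Qed.

(** The product of f_t^*, placed at t^-1, with f has unit coefficient f_t^* f_t. *)
Lemma tgnorm_coef p f t : tgnorm p -> dsum B f -> nrm (f t) <= p f.
Proof.
move=> hp hf; have [_ _ pM _ p1] := hp.
have Bf : B t (f t) by case: hf.
have h1 := dsum_singleP (fell_star Bf).
have := p1 _ (dsum_mulP h1 hf); rewrite dsum_mul_singlel invgK mulg1 nrm_starM.
have := pM _ _ h1 hf; have := tgnorm_single hp (fell_star Bf); rewrite nrm_star.
have := tgnorm_ge0 hp hf; have := tgnorm_ge0 hp h1; have := nrm_ge0 (f t).
move: (p (dsum_mul _ _)) (p _) (p f) (nrm _) => x y z w w0 y0 z0 yw xyz wx.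
have : w * w <= w * z by rewrite -expr2; nra.
by move: w0; rewrite le_eqVlt => /predU1P[<- //|w0]; rewrite ler_pM2l.
Qed.

Lemma tgnorm_complex (p : (G -> A) -> R) : tgnorm p ->
  topologically_graded_norm B (fun f => (p f)%:C).
Proof.
move=> hp; have [pD pZ pM pC p1] := hp.
split; last by move=> f hf; rewrite nrmE lecR p1.
split=> [f g hf hg|c f hf|f hf p0|f g hf hg|f hf].
- by rewrite -rmorphD lecR pD.
- by rewrite pZ // rmorphM /= cabsE.
- apply/funext => t; apply: nrm_eq0; apply/eqP; rewrite eq_le nrm_ge0 andbT.
  by move/(@complexI R): p0 => <-; exact: tgnorm_coef.
- by rewrite -rmorphM lecR pM.
- by rewrite pC // rmorphXn.
Qed.

End Bundle.
End DirectSum.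

(** * Coefficients and the reduced norm *)

Section GradedRep.
Variables (R : realType) (G : groupType) (A : cstarAlgType R) (B : G -> set A).

(** A completion of the direct sum for a topologically graded norm, which may or
    may not be the minimal one. *)
Definition graded_rep (C : cstarAlgType R) (iota : (G -> A) -> C) : Prop :=
  [/\ forall (c : R[i]) f g, dsum B f -> dsum B g ->
        iota (c *: f + g) = c *: iota f + iota g,
      forall f g, dsum B f -> dsum B g ->
        iota (dsum_mul f g) = cmul (iota f) (iota g),
      forall f, dsum B f -> iota (dsum_star f) = cstar (iota f),
      tgnorm B (fun f => nrm (iota f)) &
      closure (iota @` dsum B) = setT].

Hypothesis hB : fell_bundle B.

Lemma reduced_graded_rep (C : cstarAlgType R) (iota : (G -> A) -> C) :
  reduced_algebra B iota -> graded_rep iota.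
Proof.
case=> h1 h2 h3 [/(tgnorm_of_complex hB)[h4 _] _] h5; split=> //.
Qed.

Section Coef.
Variables (C : cstarAlgType R) (iota : (G -> A) -> C) (hC : graded_rep iota).

Lemma rep_lin (c : R[i]) f g : dsum B f -> dsum B g ->
  iota (c *: f + g) = c *: iota f + iota g.
Proof. by case: hC => h _ _ _ _; exact: h. Qed.

Lemma rep0 : iota 0 = 0.
Proof.
have := rep_lin 1 (dsum0 hB) (dsum0 hB); rewrite !scale1r addr0.
by move/(congr1 (fun x => x - iota 0)); rewrite subrr addrK.
Qed.

Lemma repZ (c : R[i]) f : dsum B f -> iota (c *: f) = c *: iota f.
Proof. by move=> hf; have := rep_lin c hf (dsum0 hB); rewrite rep0 !addr0. Qed.

Lemma repD f g : dsum B f -> dsum B g -> iota (f + g) = iota f + iota g.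
Proof. by move=> hf hg; have := rep_lin 1 hf hg; rewrite !scale1r. Qed.

Lemma repB f g : dsum B f -> dsum B g -> iota (f - g) = iota f - iota g.
Proof.
move=> hf hg; rewrite addrC -scaleN1r rep_lin //.
by rewrite scaleN1r addrC.
Qed.

Lemma repM f g : dsum B f -> dsum B g -> iota (dsum_mul f g) = iota f ** iota g.
Proof. by case: hC => _ h _ _ _; exact: h. Qed.

Lemma rep_star f : dsum B f -> iota (dsum_star f) = cstar (iota f).
Proof. by case: hC => _ _ h _ _; exact: h. Qed.

Lemma rep_tgnorm : tgnorm B (fun f => nrm (iota f)).
Proof. by case: hC. Qed.

Lemma rep_dense x e : 0 < e -> exists2 f, dsum B f & nrm (x - iota f) < e.
Proof.
move=> e0; have : closure (iota @` dsum B) x by case: hC => _ _ _ _ ->.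
by move=> /closureP/(_ e e0)[_ [f hf <-] xf]; exists f.
Qed.

Lemma rep_single_nrm t b : B t b -> nrm (iota (dsum_single t b)) = nrm b.
Proof.
move=> Bb; apply/eqP; rewrite eq_le (tgnorm_single hB rep_tgnorm Bb) /=.
have := tgnorm_coef hB t rep_tgnorm (dsum_singleP hB Bb).
by rewrite /dsum_single eqxx.
Qed.

Lemma rep_single_lin t (c : R[i]) a b : B t a -> B t b ->
  iota (dsum_single t (c *: a + b)) = c *: iota (dsum_single t a) + iota (dsum_single t b).
Proof.
move=> Ba Bb; rewrite -rep_lin; [|exact: dsum_singleP|exact: dsum_singleP].
by congr iota; rewrite dsum_singleD dsum_singleZ.
Qed.

Lemma rep_singleB t a b : B t a -> B t b ->
  iota (dsum_single t (a - b)) = iota (dsum_single t a) - iota (dsum_single t b).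
Proof.
by move=> Ba Bb; rewrite addrC -scaleN1r rep_single_lin // scaleN1r addrC.
Qed.

(** Extension by density: a map T on the direct sum that does not increase
    distances has a value at x that is at least as close to each T f as x is to
    f; this property determines the value. *)
Lemma extend_approx (V : completeNormedModType R[i]) (T : (G -> A) -> V) :
  (forall f g, dsum B f -> dsum B g -> nrm (T f - T g) <= nrm (iota f - iota g)) ->
  forall x, exists a, closure (T @` dsum B) a /\
    forall f, dsum B f -> nrm (a - T f) <= nrm (x - iota f).
Proof.
move=> lip x.
have e0 n : 0 < (2^-1 : R) ^+ n by rewrite exprn_gt0 // invr_gt0.
have [u hu] := choice (fun n => (let: ex_intro2 f a b := rep_dense x (e0 n) in
  ex_intro (fun f => dsum B f /\ nrm (x - iota f) < 2^-1 ^+ n) f (conj a b))).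
have du n : dsum B (u n) by case: (hu n).
have coef f g : dsum B f -> dsum B g ->
    nrm (T f - T g) <= nrm (x - iota f) + nrm (x - iota g).
  move=> hf hg; apply: (le_trans (lip _ _ hf hg)).
  rewrite [nrm (x - iota f)]nrmB; exact: ler_nrm_dist.
have [n||a ua] := @dominated_tends _ V (T \o u) (fun n => - (4 * 2^-1 ^+ n)) 0.
- apply: le_trans (coef _ _ (du _) (du _)) _.
  have := proj2 (hu n); have := proj2 (hu n.+1); have := e0 n; rewrite exprS; lra.
- by move=> n; rewrite oppr_le0 mulr_ge0 // ltW.
exists a; split.
  apply: closed_tends (@closed_closure _ _) _ ua => n.
  by apply: subset_closure; exists (u n).
move=> f hf; apply/ler_addgt0Pr => e e1; have e2 : 0 < e / 2 by rewrite divr_gt0.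
have [N hN] := ua _ e2; have [M hM] := inv_lt e2.
set n := maxn N M; have h1 := hN n (leq_maxl _ _); have h2 := hM n (leq_maxr _ _).
have : (2^-1 : R) ^+ n <= n.+1%:R^-1.
  by rewrite exprVn lef_pV2 ?posrE ?exprn_gt0 // -natrX ler_nat ltn_expl.
have := ler_nrm_dist (T (u n)) a (T f); have := coef _ _ (du n) hf.
have := proj2 (hu n); rewrite /= in h1.
move: (n.+1%:R^-1) h2 (_ ^+ n) => i h2 j; lra.
Qed.

Lemma coef_approx t x : exists a, B t a /\
  forall f, dsum B f -> nrm (a - f t) <= nrm (x - iota f).
Proof.
have [f g hf hg|a [ca ha]] := @extend_approx A (fun f => f t) _ x.
  rewrite -repB //; exact: (tgnorm_coef hB t rep_tgnorm (dsumB hB hf hg)).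
exists a; split=> //; have [cB _ _ _ _] := fell_subspace hB t; apply: cB.
move: ca; apply: closureS => _ [f hf <-]; by case: hf.
Qed.

Lemma coef_exists t : exists F : C -> A,
  [/\ linear F, forall x, `|F x| <= `|x|, forall x, B t (F x) &
      forall f, dsum B f -> F (iota f) = f t].
Proof.
have [F hF] := choice (coef_approx t).
have FB x : B t (F x) by case: (hF x).
have Fa x f : dsum B f -> nrm (F x - f t) <= nrm (x - iota f).
  by case: (hF x) => _; exact.
exists F; split=> // [c x y|x|f hf].
- apply/subr0_eq/nrm_eq0/eqP; rewrite eq_le nrm_ge0 andbT.
  apply/ler_addgt0Pr => e e0; rewrite add0r.
  have k0 : 0 < 4 * (cabs c + 1) by rewrite mulr_gt0 // ltr_wpDl // cabs_ge0.
  have [f hf xf] := rep_dense x (divr_gt0 e0 k0).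
  have [g hg yg] := rep_dense y (divr_gt0 e0 k0).
  rewrite ltr_pdivlMr // in xf; rewrite ltr_pdivlMr // in yg.
  have h1 := Fa (c *: x + y) _ (dsum_lin hB c hf hg).
  have h2 := Fa x _ hf; have h3 := Fa y _ hg.
  have E1 : c *: x + y - (c *: iota f + iota g) = c *: (x - iota f) + (y - iota g).
    by rewrite scalerBr opprD addrACA.
  rewrite rep_lin // E1 in h1.
  have h4 := ler_nrmD (c *: (x - iota f)) (y - iota g).
  have -> : F (c *: x + y) - (c *: F x + F y) =
      (F (c *: x + y) - (c *: f + g) t) - (c *: (F x - f t) + (F y - g t)).
    have -> : (c *: f + g) t = c *: f t + g t by [].
    by rewrite scalerBr [_ + (F y - _)]addrACA -opprD opprB addrA subrK.
  have h5 := ler_nrmB (F (c *: x + y) - (c *: f + g) t) (c *: (F x - f t) + (F y - g t)).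
  have h6 := ler_nrmD (c *: (F x - f t)) (F y - g t).
  rewrite !nrmZ in h4 h6.
  have c0 := cabs_ge0 c.
  have h7 : cabs c * nrm (F x - f t) <= cabs c * nrm (x - iota f) by rewrite ler_wpM2l.
  have := mulr_ge0 c0 (nrm_ge0 (y - iota g)); have := nrm_ge0 (x - iota f).
  have := nrm_ge0 (y - iota g).
  lra.
- by rewrite nrm_le; have := Fa x _ (dsum0 hB); rewrite rep0 !subr0.
- apply/subr0_eq/nrm_eq0/eqP; rewrite eq_le nrm_ge0 andbT.
  by have := Fa (iota f) _ hf; rewrite subrr nrm0.
Qed.

Local Notation F := (fourier_coef B iota).

Lemma coefP t : [/\ linear (F t), forall x, `|F t x| <= `|x|, forall x, B t (F t x) &
  forall f, dsum B f -> F t (iota f) = f t].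
Proof. exact: (getPex (coef_exists t)). Qed.

Lemma coef_lin t (c : R[i]) x y : F t (c *: x + y) = c *: F t x + F t y.
Proof. by have [h _ _ _] := coefP t; exact: h. Qed.

Lemma coefD t x y : F t (x + y) = F t x + F t y.
Proof. by have := coef_lin t 1 x y; rewrite !scale1r. Qed.

Lemma coef0 t : F t 0 = 0.
Proof.
by apply: (addIr (F t 0)); rewrite -coefD !add0r.
Qed.

Lemma coefZ t (c : R[i]) x : F t (c *: x) = c *: F t x.
Proof. by have := coef_lin t c x 0; rewrite coef0 !addr0. Qed.

Lemma coefB t x y : F t (x - y) = F t x - F t y.
Proof. by rewrite coefD -scaleN1r coefZ scaleN1r. Qed.

Lemma coef_nrm t x : nrm (F t x) <= nrm x.
Proof. by have [_ h _ _] := coefP t; rewrite -nrm_le. Qed.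

Lemma coef_mem t x : B t (F t x).
Proof. by have [_ _ h _] := coefP t. Qed.

Lemma coef_rep t f : dsum B f -> F t (iota f) = f t.
Proof. by have [_ _ _ h] := coefP t; exact: h. Qed.

Lemma coef_uniq t x a :
  (forall f, dsum B f -> nrm (a - f t) <= nrm (x - iota f)) -> F t x = a.
Proof.
move=> h; apply/subr0_eq/nrm_eq0/eqP; rewrite eq_le nrm_ge0 andbT.
apply/ler_addgt0Pr => e e0; rewrite add0r.
have e2 : 0 < e / 2 by rewrite divr_gt0.
have [f hf xf] := rep_dense x e2.
have := ler_nrm_dist (f t) (F t x) a; rewrite [nrm (f t - a)]nrmB.
have := h f hf; have := coef_nrm t (x - iota f); rewrite coefB coef_rep //; lra.
Qed.

Lemma dense_ind (S : set C) : closed_subspace S ->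
  (forall t b, B t b -> S (iota (dsum_single t b))) -> forall x, S x.
Proof.
move=> /closed_subspace_ops [/closedP cS S0 SD _ _] Ss x; apply: cS => e e0.
have [f hf xf] := rep_dense x e0; exists (iota f) => //.
move: f hf {xf}; apply: (dsum_ind hB (S := [set f | S (iota f)])) => //=.
  by rewrite rep0.
by move=> f g hf hg; rewrite repD //; exact: SD.
Qed.

Lemma dense_zero (V : normedModType R[i]) (phi : C -> V) K :
  (forall (c : R[i]) x y, phi (c *: x + y) = c *: phi x + phi y) ->
  (forall x, nrm (phi x) <= K * nrm x) ->
  (forall t b, B t b -> phi (iota (dsum_single t b)) = 0) -> forall x, phi x = 0.
Proof.
move=> lin bd; apply: dense_ind.
have p0 : phi 0 = 0.
  have := lin 1 0 0; rewrite !scale1r addr0 => /(congr1 (fun x => x - phi 0)).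
  by rewrite subrr addrK.
split=> //; last by move=> c x y /= px py; rewrite lin px py scaler0 addr0.
apply/closedP => x h; apply: nrm_eq0; apply/eqP; rewrite eq_le nrm_ge0 andbT.
apply/ler_addgt0Pr => e e0; rewrite add0r.
have K1 : 0 < `|K| + 1 by rewrite ltr_wpDl.
have [y /= py xy] := h _ (divr_gt0 e0 K1).
rewrite ltr_pdivlMr // in xy.
have := lin (- 1) y x; rewrite py scaler0 add0r scaleN1r addrC => <-.
apply: le_trans (bd _) _.
have : K * nrm (x - y) <= (`|K| + 1) * nrm (x - y).
  by rewrite ler_wpM2r ?nrm_ge0 // ler_wpDr // ler_norm.
lra.
Qed.

Lemma coef_mull s t b x : B s b ->
  F t (iota (dsum_single s b) ** x) = b ** F (s^-1 * t)%g x.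
Proof.
move=> Bb; apply/subr0_eq; move: x.
apply: (@dense_zero _ _ (2 * nrm b)) => [c x y|x|r d Bd].
- rewrite cmulDr cmulZr !coef_lin cmulDr cmulZr opprD addrACA -scalerN -scalerDr.
  by [].
- have := ler_nrmB (F t (iota (dsum_single s b) ** x)) (b ** F (s^-1 * t)%g x).
  have := coef_nrm t (iota (dsum_single s b) ** x).
  have := nrm_cmul (iota (dsum_single s b)) x; rewrite rep_single_nrm //.
  have := nrm_cmul b (F (s^-1 * t)%g x); have := coef_nrm (s^-1 * t)%g x.
  have := nrm_ge0 b; nra.
- have h1 := dsum_singleP hB Bb; have h2 := dsum_singleP hB Bd.
  rewrite -repM // !coef_rep //; last exact: dsum_mulP.
  by rewrite dsum_mul_singlel subrr.
Qed.

Lemma coef_mulr s t b x : B s b ->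
  F t (x ** iota (dsum_single s b)) = F (t * s^-1)%g x ** b.
Proof.
move=> Bb; apply/subr0_eq; move: x.
apply: (@dense_zero _ _ (2 * nrm b)) => [c x y|x|r d Bd].
- rewrite cmulDl cmulZl !coef_lin cmulDl cmulZl opprD addrACA -scalerN -scalerDr.
  by [].
- have := ler_nrmB (F t (x ** iota (dsum_single s b))) (F (t * s^-1)%g x ** b).
  have := coef_nrm t (x ** iota (dsum_single s b)).
  have := nrm_cmul x (iota (dsum_single s b)); rewrite rep_single_nrm //.
  have := nrm_cmul (F (t * s^-1)%g x) b; have := coef_nrm (t * s^-1)%g x.
  have := nrm_ge0 b; nra.
- have h1 := dsum_singleP hB Bb; have h2 := dsum_singleP hB Bd.
  rewrite -repM // !coef_rep //; last exact: dsum_mulP.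
  by rewrite dsum_mul_singler subrr.
Qed.

(** The kernel of the map onto the reduced algebra of the quotient bundle B/J. *)
Definition coef_ideal (J : G -> set A) : set C := [set x | forall t, J t (F t x)].

Lemma bundle_ideal_subspace J t : bundle_ideal B J -> [/\ closed (J t), J t 0,
  forall x y, J t x -> J t y -> J t (x + y),
  forall x, J t x -> J t (- x) & forall (c : R[i]) x, J t x -> J t (c *: x)].
Proof. by move=> [h _ _]; apply: closed_subspace_ops. Qed.

Lemma closed_mul_preim (D : cstarAlgType R) (S : set D) x :
  closed S -> closed [set y | S (x ** y)] /\ closed [set y | S (y ** x)].
Proof.
move=> /closedP cS; split; apply/closedP => y h; apply: cS => e e0.
  have k0 : 0 < nrm x + 1 by rewrite ltr_wpDl // nrm_ge0.
  have [z /= Sz yz] := h _ (divr_gt0 e0 k0); exists (x ** z) => //.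
  rewrite -cmulBr; apply: le_lt_trans (nrm_cmul _ _) _.
  by move: yz; rewrite ltr_pdivlMr //; have := nrm_ge0 (y - z); nra.
have k0 : 0 < nrm x + 1 by rewrite ltr_wpDl // nrm_ge0.
have [z /= Sz yz] := h _ (divr_gt0 e0 k0); exists (z ** x) => //.
rewrite -cmulBl; apply: le_lt_trans (nrm_cmul _ _) _.
by move: yz; rewrite ltr_pdivlMr //; have := nrm_ge0 (y - z); nra.
Qed.

(** The elements that multiply a closed subspace into itself form a closed
    subspace, which is everything as soon as it contains the fibres. *)
Lemma ideal_of_fibres (S : set C) : closed_subspace S ->
  (forall t b x, B t b -> S x -> S (iota (dsum_single t b) ** x) /\
     S (x ** iota (dsum_single t b))) -> cstar_ideal S.
Proof.
move=> sS SB; split=> // x y Sy; move: x.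
have [cS S0 SD _ SZ] := closed_subspace_ops sS.
apply: dense_ind; last by move=> t b Bb; exact: SB.
split=> [|/=|c x z /= [h1 h2] [h3 h4]].
- have [h1 h2] := closed_mul_preim y cS.
  exact: (closedI h2 h1).
- by rewrite cmul0x cmulx0.
- by rewrite cmulDl cmulDr cmulZl cmulZr; split; apply: (SD) => //; apply: SZ.
Qed.

Lemma coef_ideal_subspace J : bundle_ideal B J -> closed_subspace (coef_ideal J).
Proof.
move=> hJ; split=> [|t|c x y hx hy t]; have sJ t := bundle_ideal_subspace t hJ.
- apply/closedP => x h t; have [/closedP cJ _ _ _ _] := sJ t.
  apply: cJ => e /h[y Jy xy]; exists (F t y) => //.
  by rewrite -coefB; apply: le_lt_trans (coef_nrm _ _) xy.
- by rewrite coef0; have [] := sJ t.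
- by rewrite coef_lin; have [_ _ JD _ JZ] := sJ t; apply: JD => //; exact: JZ.
Qed.

Lemma coef_ideal_ideal J : bundle_ideal B J -> cstar_ideal (coef_ideal J).
Proof.
move=> hJ; apply: ideal_of_fibres => [|s b x Bb Jx]; first exact: coef_ideal_subspace.
have [_ _ JM] := hJ; split=> t.
  rewrite coef_mull // -[t in J t](mulVKg s).
  by have [h _] := JM s (s^-1 * t)%g b (F (s^-1 * t)%g x); exact: h.
rewrite coef_mulr // -[t in J t](mulgVK s).
by have [_ h] := JM (t * s^-1)%g s (F (t * s^-1)%g x) b; exact: h.
Qed.

(** On C the unit coefficient is positive and dominates the others: this is a
    sum of the f_t^* f_t on the direct sum, and the positive elements form a
    closed set. *)
Lemma coef_gram x : apos (F 1%g (cstar x ** x)) /\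
  forall t, apos (F 1%g (cstar x ** x) - cstar (F t x) ** F t x).
Proof.
have sqd (D : cstarAlgType R) (a b : D) :
    nrm (cstar a ** a - cstar b ** b) <= (nrm a + nrm b) * nrm (a - b).
  have -> : cstar a ** a - cstar b ** b = cstar a ** (a - b) + cstar (a - b) ** b.
    by rewrite cmulBr cstarB cmulBl addrA subrK.
  apply: le_trans (ler_nrmD _ _) _.
  have := nrm_cmul (cstar a) (a - b); have := nrm_cmul (cstar (a - b)) b.
  rewrite !nrm_star; lra.
have approx e : 0 < e -> exists f, [/\ dsum B f,
    nrm (cstar x ** x - cstar (iota f) ** iota f) < e &
    forall t, nrm (cstar (F t x) ** F t x - cstar (f t) ** f t) < e].
  move=> e0; have k0 : 0 < 2 * nrm x + 1 by have := nrm_ge0 x; lra.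
  have [|f hf] := @rep_dense x (Num.min 1 (e / (2 * nrm x + 1))).
    by rewrite lt_min ltr01 divr_gt0.
  rewrite lt_min => /andP[f1]; rewrite ltr_pdivlMr // => fe.
  have fx : nrm (iota f) <= nrm x + 1.
    by have := ler_dist_nrm (iota f) x; rewrite nrmB; lra.
  exists f; split=> // [|t].
    apply: le_lt_trans (sqd _ _ _) _; have := nrm_ge0 (x - iota f); nra.
  rewrite -(coef_rep t hf); apply: le_lt_trans (sqd _ _ _) _.
  rewrite -coefB; have := coef_nrm t (x - iota f); have := coef_nrm t x.
  have := coef_nrm t (iota f); have := nrm_ge0 (F t (x - iota f)).
  have := nrm_ge0 (x - iota f); have := nrm_ge0 (F t x); have := nrm_ge0 (F t (iota f)).
  move: (nrm (F t (x - iota f))) (nrm (F t x)) (nrm (F t (iota f))) => a b c.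
  move: (nrm (x - iota f)) (nrm x) (nrm (iota f)) fe fx k0 f1 => d y z.
  move=> h1 h2 h3 h4 c0 b0 d0 a0 cz b_y ad.
  apply: (@le_lt_trans _ _ ((y + z) * d)); last by nra.
  by apply: ler_pM => //; lra.
have gr f : dsum B f -> cstar (iota f) ** iota f = iota (dsum_mul (dsum_star f) f).
  by move=> hf; rewrite repM ?rep_star //; exact: dsum_starP.
have dgr f : dsum B f -> dsum B (dsum_mul (dsum_star f) f).
  by move=> hf; apply: dsum_mulP => //; exact: dsum_starP.
have /closedP cl := @closed_apos R A.
split=> [|t]; apply: cl => e e0.
  have [f [hf xf _]] := approx _ e0.
  exists (F 1%g (iota (dsum_mul (dsum_star f) f))) => /=.
    by rewrite coef_rep; [have [] := dsum_gram hf|exact: dgr].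
  by rewrite -coefB -gr //; apply: le_lt_trans (coef_nrm _ _) xf.
have e2 : 0 < e / 2 by rewrite divr_gt0.
have [f [hf xf tf]] := approx _ e2.
exists (F 1%g (iota (dsum_mul (dsum_star f) f)) - cstar (f t) ** f t) => /=.
  by rewrite coef_rep; [have [_] := dsum_gram hf; exact|exact: dgr].
have alg (a b d g : A) : a - b - (d - g) = (a - d) - (b - g).
  by rewrite !opprB [LHS]addrACA [RHS]addrACA [- b + _]addrC.
rewrite alg -coefB -gr //; apply: le_lt_trans (ler_nrmB _ _) _.
have := tf t; have := coef_nrm 1%g (cstar x ** x - cstar (iota f) ** iota f); lra.
Qed.

(** All coefficients of x vanish as soon as the unit coefficient of x^* x does. *)
Lemma coef_nrm_sqr t x : nrm (F t x) ^+ 2 <= nrm (F 1%g (cstar x ** x)).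
Proof.
have [_ h] := coef_gram x; rewrite -nrm_starM.
by have := apos_nrm_mono (apos_starM (F t x)) (h t); rewrite addrC subrK.
Qed.

Definition faithful_coef : Prop := forall x, (forall t, F t x = 0) -> x = 0.

Lemma geometric_bound (a t s : R) : 0 <= s -> s < 1 -> 0 <= t ->
  (forall n, a <= t * s ^+ n.+1) -> a <= 0.
Proof.
move=> s0 s1 t0 h; rewrite leNgt; apply/negP => a0.
move: s0; rewrite le_eqVlt => /predU1P[e|sp].
  by have := h 0%N; rewrite -e expr1 mulr0; lra.
pose d := s^-1 - 1.
have d0 : 0 < d by rewrite subr_gt0 invf_gt1.
have td : 0 < a * d / (t + 1) by rewrite divr_gt0 ?mulr_gt0 // ltr_wpDl.
have [N hN] := inv_lt td; have := hN N (leqnn N).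
have N0 : (0 : R) < N.+1%:R by rewrite ltr0n.
rewrite -[X in X < _]mul1r ltr_pdivrMr // mulrAC ltr_pdivlMr; last by rewrite ltr_wpDl.
rewrite mul1r => h1.
have := bernoulli_pow N.+1 (ltW d0).
have -> : 1 + d = s^-1 by rewrite /d addrC subrK.
rewrite exprVn => h2.
have sN : 0 < s ^+ N.+1 by rewrite exprn_gt0.
have h3 := h N.
have : s ^+ N.+1 * (1 + N.+1%:R * d) <= 1 by rewrite mulrC -ler_pdivlMr // mul1r.
move: (s ^+ N.+1) (N.+1%:R : R) sN h3 h1 N0 {h hN h2} => u m u0 h3 h1 m0 h4.
have : t * u * (1 + m * d) <= t by rewrite -mulrA ler_piMr.
have : a * (1 + m * d) <= t * u * (1 + m * d).
  by rewrite ler_wpM2r // addr_ge0 // mulr_ge0 // ltW.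
nra.
Qed.

(** Faithfulness of the coefficients makes the norm minimal.  Otherwise, after
    scaling, some f has q(f) < 1 < |f|.  The powers of h = f^* f dominate a
    fixed square x^2 <> 0 in C, while their unit coefficients are bounded by
    q(f)^(2n) and tend to 0; hence all coefficients of x vanish. *)
Lemma faithful_minimal : faithful_coef ->
  forall q, tgnorm B q -> forall f, dsum B f -> nrm (iota f) <= q f.
Proof.
move=> faith q hq f hf; rewrite leNgt; apply/negP => qf.
have q0 g : dsum B g -> 0 <= q g by exact: tgnorm_ge0.
have [qD qZ qM qC q1] := hq.
wlog {qf} : f hf / q f < 1 /\ 1 < nrm (iota f).
  (* Divide f by a number r strictly between q(f) and |f|. *)
  pose r := (q f + nrm (iota f)) / 2.
  have rq : q f < r by rewrite /r; lra.
  have rn : r < nrm (iota f) by rewrite /r; lra.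
  have r0 : 0 < r by have := q0 _ hf; lra.
  move=> /(_ (r^-1%:C *: f)); apply; first exact: dsumZ.
  rewrite repZ // nrmZR qZ // cabsR gtr0_norm ?invr_gt0 //.
  by rewrite ltr_pdivrMl // ltr_pdivlMl // mulr1.
move=> [qf1 nf1].
pose g := dsum_mul (dsum_star f) f; pose h := cstar (iota f) ** iota f.
have hg : dsum B g by apply: dsum_mulP => //; exact: dsum_starP.
have gh : iota g = h by rewrite repM ?rep_star //; exact: dsum_starP.
have qg : q g = q f ^+ 2 by exact: qC.
have qg1 : q g < 1 by rewrite qg; have := q0 _ hf; nra.
have h1 : 1 < nrm h by rewrite nrm_starM; nra.
have [x [t [x0 t0 xs xy]]] := square_below_powers (apos_starM (iota f)) h1.
pose gn n := iter n (dsum_mul g) g.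
have hgn n : dsum B (gn n) by elim: n => // n; exact: dsum_mulP.
have gnh n : iota (gn n) = cpow h n.
  by elim: n => [//|n IH]; rewrite [gn _]/(dsum_mul g (gn n)) repM // IH gh.
have qgn n : q (gn n) <= q g ^+ n.+1.
  elim: n => [|n IH]; first by rewrite expr1.
  rewrite exprS; apply: le_trans (qM _ _ hg (hgn n)) _.
  by rewrite ler_wpM2l ?q0.
apply: x0; apply: faith => r.
have Fx : nrm (F 1%g (cstar x ** x)) <= 0.
  apply: (@geometric_bound _ t (q g)) => // [|n]; first exact: q0.
  have [y yE] := xy n.
  have := apos_nrm_mono (proj1 (coef_gram x)) (proj1 (coef_gram y)).
  rewrite -coefD -yE -gnh coefZ coef_rep // nrmZR ger0_norm // => /le_trans; apply.
  by rewrite ler_wpM2l //; apply: le_trans (q1 _ (hgn n)) (qgn n).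
apply: nrm_eq0; have := coef_nrm_sqr r x; have := nrm_ge0 (F r x); nra.
Qed.

Lemma faithful_reduced : faithful_coef -> reduced_algebra B iota.
Proof.
move=> faith; have [h1 h2 h3 h4 h5] := hC; split=> //; split.
  have := tgnorm_complex hB h4.
  by rewrite (_ : (fun f => _) = (fun f => `|iota f|)) //; apply/funext => f; rewrite nrmE.
move=> q hq f hf; have [tq qE] := tgnorm_of_complex hB hq.
by rewrite qE // nrmE lecR; exact: (faithful_minimal faith tq hf).
Qed.

Lemma zero_bundle_ideal : bundle_ideal B (fun=> [set 0]).
Proof.
split=> [t|t _ ->|s t a b]; last by split=> [_ ->|-> _]; rewrite ?cmulx0 ?cmul0x.
- split=> // [|c x y -> ->]; last by rewrite scaler0 addr0.
  apply/closedP => x h; apply: nrm_eq0; apply/eqP; rewrite eq_le nrm_ge0 andbT.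
  by apply/ler_addgt0Pr => e /h[y ->]; rewrite subr0 add0r => /ltW.
- by have [] := fell_subspace hB t.
Qed.

(** The quotient by the elements without nonzero coefficients is again
    topologically graded, so it does not decrease the minimal norm. *)
Lemma reduced_faithful : reduced_algebra B iota -> faithful_coef.
Proof.
move=> [_ _ _ [_ qmin] _] x x0.
have hK := coef_ideal_ideal zero_bundle_ideal.
pose p f := nrm (qpi hK (iota f)).
have hp : tgnorm B p.
  rewrite /p; split=> [f g hf hg|c f hf|f g hf hg|f hf|f hf].
  - by rewrite repD // qpiD ler_nrmD.
  - by rewrite repZ // qpiZ nrmZ.
  - by rewrite repM // qpiM nrm_cmul.
  - by rewrite repM ?rep_star // ?qpiM ?qpi_star ?nrm_starM //; exact: dsum_starP.
  - apply: le_qnorm => y /qpi_eq/(_ 1%g) /= /eqP.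
    by rewrite coefB subr_eq0 coef_rep // => /eqP <-; exact: coef_nrm.
have Kx : qpi hK x = 0 by apply/qpi0P => t /=.
apply: nrm_eq0; apply/eqP; rewrite eq_le nrm_ge0 andbT.
apply/ler_addgt0Pr => e e0; rewrite add0r; have e2 : 0 < e / 2 by rewrite divr_gt0.
have [f hf xf] := rep_dense x e2.
have := qmin _ (tgnorm_complex hB hp) f hf; rewrite nrmE lecR /p.
have -> : qpi hK (iota f) = qpi hK (iota f - x) by rewrite qpiB Kx subr0.
have := qnorm_le hK (iota f - x); rewrite -nrm_quot nrmB.
have := ler_dist_nrm x (iota f); lra.
Qed.

End Coef.

Lemma reduced_uniq (C C' : cstarAlgType R) (iota : (G -> A) -> C)
    (iota' : (G -> A) -> C') : reduced_algebra B iota -> reduced_algebra B iota' ->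
  forall f, dsum B f -> nrm (iota f) = nrm (iota' f).
Proof.
move=> [_ _ _ [h1 m1] _] [_ _ _ [h2 m2] _] f hf; apply/eqP.
rewrite eq_le -!nrm_le; apply/andP; split; [exact: (m1 _ h2 f hf)|exact: (m2 _ h1 f hf)].
Qed.

End GradedRep.

(** * Exactness implies that Fourier ideals are graded *)

Section BundleIdeals.
Variables (R : realType) (G : groupType) (A : cstarAlgType R).
Variables (B J : G -> set A) (hB : fell_bundle B) (hJ : bundle_ideal B J).

Lemma ideal_sub t b : J t b -> B t b.
Proof. by case: hJ => _ h _; exact: h. Qed.

Lemma ideal_mull s t a b : B s a -> J t b -> J (s * t)%g (a ** b).
Proof. by case: hJ => _ _ h; case: (h s t a b). Qed.

Lemma ideal_mulr s t a b : J s a -> B t b -> J (s * t)%g (a ** b).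
Proof. by case: hJ => _ _ h; case: (h s t a b). Qed.

(** Bundle ideals are self-adjoint for the same reason as ideals of C*-algebras:
    b = a^* is the limit of u b with u in the unit fibre of the ideal. *)
Lemma bundle_ideal_star t a : J t a -> J t^-1%g (cstar a).
Proof.
move=> Ja; have Ba := ideal_sub Ja; have Bs := fell_star hB Ba.
have J1 : J 1%g (cstar a ** cstar (cstar a)).
  by rewrite cstarK -[1%g](mulVg t); exact: ideal_mull.
have JM y : J 1%g y -> J 1%g (y ** (cstar a ** cstar (cstar a))).
  by move=> Jy; rewrite -[X in J X]mulg1; apply: ideal_mulr => //; exact: ideal_sub.
have [/closedP cJ _ _ _ _] := bundle_ideal_subspace t^-1%g hJ.
apply: cJ => e e0.
have sJ : closed_subspace (J 1%g) by case: hJ.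
have [u [Ju _ ub _]] := approx_unit sJ J1 JM e0.
by exists (u ** cstar a) => //; rewrite -[X in J X]mul1g; exact: ideal_mulr.
Qed.

Lemma bundle_ideal_fell : fell_bundle J.
Proof.
split=> [t|t|s t a b Ja Jb]; first by case: hJ.
- apply/seteqP; split=> [_ [a Ja <-]|a Ja]; first exact: bundle_ideal_star.
  by exists (cstar a); [rewrite -[t]invgK; exact: bundle_ideal_star|exact: cstarK].
- by apply: ideal_mulr => //; exact: ideal_sub.
Qed.

Lemma dsum_ideal_sub f : dsum J f -> dsum B f.
Proof. by case=> h ff; split=> // t; exact/ideal_sub/h. Qed.

End BundleIdeals.

Section Exact_to_graded.
Variables (R : realType) (G : groupType) (A : cstarAlgType R).
Variables (B : G -> set A) (C : cstarAlgType R) (iota : (G -> A) -> C).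
Hypotheses (hB : fell_bundle B) (hC : reduced_algebra B iota).

Let hrep : graded_rep B iota := reduced_graded_rep hB hC.

Definition fibre_part (I : set C) (t : G) : set A :=
  [set b | B t b /\ I (iota (dsum_single t b))].

Lemma fibre_part_ideal I : cstar_ideal I -> bundle_ideal B (fibre_part I).
Proof.
move=> [sI IM]; have [/closedP cI I0 ID IN IZ] := closed_subspace_ops sI.
have sg t b : B t b -> dsum B (dsum_single t b) by exact: dsum_singleP.
split=> [t|t b []//|s t a b].
  have [/closedP cB B0 BD BN BZ] := fell_subspace hB t; split.
  - apply/closedP => b h; have Bb : B t b.
      by apply: cB => e /h[b' [? _] ?]; exists b'.
    split=> //; apply: cI => e /h[b' [Bb' Ib'] bb'].
    exists (iota (dsum_single t b')) => //.
    rewrite -(rep_singleB hB hrep) //.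
    by rewrite (rep_single_nrm hB hrep) //; apply: (BD) => //; exact: BN.
  - by split=> //; rewrite dsum_single0 (rep0 hB hrep).
  - move=> c x y [Bx Ix] [By Iy]; split; first by apply: (BD) => //; exact: BZ.
    rewrite (rep_single_lin hB hrep) //.
    by apply: (ID) => //; exact: IZ.
split=> [Ba [Bb Ib]|[Ba Ia] Bb]; split; try exact: (fell_mul hB).
- rewrite -dsum_mul_single (repM hrep) //; [|exact: sg|exact: sg].
  by case: (IM (iota (dsum_single s a)) _ Ib).
- rewrite -dsum_mul_single (repM hrep) //; [|exact: sg|exact: sg].
  by case: (IM (iota (dsum_single t b)) _ Ia).
Qed.

(** Let J be the fibrewise part of the Fourier ideal I.  Then psi vanishes on I:
    the coefficients of psi(x) are the classes of those of x, and coefficients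
    are faithful on the reduced algebra of the quotient.  By exactness I lies in
    the closure of the direct sum of J, whose elements lie in every ideal that
    contains the unit fibre of J. *)
Lemma exact_graded : exact_bundle B ->
  forall I, fourier_ideal B iota I -> graded_ideal B iota I.
Proof.
move=> ex I [hI four]; split=> //.
pose J := fibre_part I; have hJ : bundle_ideal B J := fibre_part_ideal hI.
have fJ := bundle_ideal_fell hB hJ.
have [D [Q [q [CJ [CB [CQ [iJ [iB [iQ [phi [psi]]]]]]]]]]] := ex J hJ.
move=> [[fQ qlin qim qnorm qmul] [rJ rB rQ] [sphi phiE] [spsi psiE]].
move=> [phi_inj ker_psi _].
have gJ := reduced_graded_rep fJ rJ; have gB := reduced_graded_rep hB rB.
have gQ := reduced_graded_rep fQ rQ.
have contr (E E' : cstarAlgType R) (h : E -> E') : star_hom h ->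
    (forall x, nrm (h x) <= nrm x) /\ forall x y, h (x - y) = h x - h y.
  move=> [hl hM hs]; have hB' x y : h (x - y) = h x - h y.
    by rewrite addrC -scaleN1r hl scaleN1r addrC.
  split=> // x.
  apply: (@cseminorm_le R E setT (fun x => nrm (h x))) => //.
  have h0 : h 0 = 0 by rewrite -(subrr (0 : E)) hB' subrr.
  split=> [a b _ _|c a _|a b _ _|a _].
  - have := hl 1 a b; rewrite !scale1r => ->; exact: ler_nrmD.
  - by have := hl c a 0; rewrite h0 !addr0 => ->; exact: nrmZ.
  - by rewrite hM nrm_cmul.
  - by rewrite hM hs nrm_starM.
have [phi_le phiB] := contr _ _ _ sphi; have [psi_le psiB] := contr _ _ _ spsi.
have same := reduced_uniq hC rB.
have qB t a b : B t a -> B t b -> q t (a - b) = q t a - q t b.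
  by move=> Ba Bb; rewrite addrC -scaleN1r qlin // scaleN1r addrC.
have q0 t : q t 0 = 0.
  have [_ B0 _ _ _] := fell_subspace hB t.
  by rewrite -(subrr (0 : A)) qB // subrr.
have q_le t b j : B t b -> J t j -> nrm (q t b) <= nrm (b - j).
  move=> Bb Jj; have [_ qn _] := qnorm t b Bb.
  rewrite /nrm qn; apply: inf_lbound; last by exists j.
  by exists 0 => _ [k _ <-]; exact: nrm_ge0.
have qdsum f : dsum B f -> dsum Q (fun t => q t (f t)).
  move=> hf; have [r [_ fr]] := dsum_supp hf.
  apply: (@dsum_of_supp _ _ _ _ _ r) => [t|t h].
    by rewrite -qim; exists (f t) => //; case: hf.
  by apply: fr => ft; apply: h; rewrite ft q0.
have FJ x t : I x -> J t (fourier_coef B iota t x).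
  by move=> Ix; split; [exact: (coef_mem hB hrep)|exact: four].
have approx x : I x -> forall e, 0 < e -> exists2 g, dsum J g & nrm (x - iota g) < e.
  move=> Ix e e0.
  (* x' is the element of the other copy CB of the algebra corresponding to x. *)
  have [|x' [_ hx']] := @extend_approx _ _ _ _ _ _ hrep CB iB _ x.
    by move=> f g hf hg; rewrite -(repB gB) // -(repB hrep) // same //; exact: dsumB.
  have px' : psi x' = 0.
    apply: (reduced_faithful fQ gQ rQ) => t; apply: nrm_eq0; apply/eqP.
    rewrite eq_le nrm_ge0 andbT; apply/ler_addgt0Pr => d d0; rewrite add0r.
    have d2 : 0 < d / 2 by rewrite divr_gt0.
    have [f hf xf] := rep_dense hrep x d2.
    have h1 := hx' f hf.
    have Bf : B t (f t) by case: hf.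
    have h2 := q_le t (f t) _ Bf (FJ x t Ix).
    rewrite -(coef_rep hB hrep t hf) -(coefB hB hrep) in h2.
    have h3 := coef_nrm hB hrep t (iota f - x); rewrite [X in _ <= X]nrmB in h3.
    have h4 := coef_nrm fQ gQ t (psi (x' - iB f)).
    rewrite psiB psiE // (coefB fQ gQ) (coef_rep fQ gQ _ (qdsum _ hf)) in h4.
    have h5 := psi_le (x' - iB f); rewrite psiB psiE // in h5.
    have := ler_dist_nrm (fourier_coef Q iQ t (psi x')) (q t (f t)).
    rewrite (coef_rep hB hrep) // in h2; lra.
  have [w _ wx] : range phi x' by rewrite ker_psi.
  have e4 : 0 < e / 4 by rewrite divr_gt0.
  have [g hg wg] := rep_dense gJ w e4; exists g => //.
  have h1 := phi_le (w - iJ g); rewrite phiB phiE // wx in h1.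
  have [f hf xf] := rep_dense hrep x e4.
  have hg' := dsum_ideal_sub hJ hg.
  have := same _ (dsumB hB hf hg'); rewrite (repB hrep) // (repB gB) // => h2.
  have := ler_nrm_dist (iota f) x (iota g); have := hx' f hf.
  have := ler_nrm_dist x' (iB f) (iB g); rewrite [nrm (iB f - x')]nrmB; lra.
apply/seteqP; split; last by apply: smallest_sub => // x [].
move=> x Ix K [hK KI].
have KJ t j : J t j -> K (iota (dsum_single t j)).
  move=> [Bj Ij]; apply: ideal_of_Mstar => //.
  have sj := dsum_singleP hB Bj.
  have IM : I (iota (dsum_single t j) ** cstar (iota (dsum_single t j))).
    by case: hI => _ h; case: (h (cstar (iota (dsum_single t j))) _ Ij).
  have E : iota (dsum_single t j) ** cstar (iota (dsum_single t j)) =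
      iota (dsum_single 1%g (j ** cstar j)).
    rewrite -(rep_star hrep) // -(repM hrep) //; last exact: (dsum_starP hB).
    by rewrite dsum_star_single dsum_mul_single mulgV.
  apply: KI; split=> //; rewrite E; exists (j ** cstar j) => //.
  by rewrite -[1%g](mulgV t); apply: (fell_mul hB) => //; exact: (fell_star hB).
have [sK _] := hK; have [/closedP cK K0 KD _ _] := closed_subspace_ops sK.
apply: cK => e e0; have [g hg xg] := approx x Ix e e0; exists (iota g) => //.
move: g hg {xg}; apply: (dsum_ind fJ (S := [set g | K (iota g)])) => //=.
- by rewrite (rep0 hB hrep).
- move=> f g hf hg Kf Kg; rewrite (repD hrep); first exact: KD.
    exact: (dsum_ideal_sub hJ).
  exact: (dsum_ideal_sub hJ).
Qed.

End Exact_to_graded.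

(** * Graded kernels give exactness *)

Section Graded_to_exact.
Variables (R : realType) (G : groupType) (A : cstarAlgType R).
Variables (B : G -> set A) (C : cstarAlgType R) (iota : (G -> A) -> C).
Hypotheses (hB : fell_bundle B) (hC : reduced_algebra B iota).
Variables (J : G -> set A) (hJ : bundle_ideal B J).

Let hrep : graded_rep B iota := reduced_graded_rep hB hC.
Local Notation F := (fourier_coef B iota).
Local Notation fibre t b := (iota (dsum_single t b)).

Let K : set C := coef_ideal B iota J.
Let hK : cstar_ideal K := coef_ideal_ideal hB hrep hJ.
Let fJ : fell_bundle J := bundle_ideal_fell hB hJ.

Let BP t := fell_subspace hB t.
Let JP t := bundle_ideal_subspace t hJ.

Lemma coef_single t b s : B t b -> F s (fibre t b) = if s == t then b else 0.
Proof. by move=> Bb; rewrite (coef_rep hB hrep) //; exact: dsum_singleP. Qed.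

Lemma kernel_single t b : B t b -> K (fibre t b) <-> J t b.
Proof.
move=> Bb; split=> [/(_ t)|Jb s]; rewrite coef_single ?eqxx //.
by case: eqP => [->//|_]; have [] := JP s.
Qed.

Lemma kernel_fourier : fourier_ideal B iota K.
Proof.
split=> // t x Kx; apply/kernel_single; first exact: (coef_mem hB hrep).
exact: Kx.
Qed.

Lemma kernel_dsum f : dsum J f -> K (iota f).
Proof.
move=> hf t; rewrite (coef_rep hB hrep); first by case: hf.
exact: (dsum_ideal_sub hJ).
Qed.

Definition dsum_closure : set C := closure (iota @` dsum J).

(** Multiplication by an element of a fibre maps the direct sum of J to itself and
    is Lipschitz. *)
Lemma dsum_closure_ideal : cstar_ideal dsum_closure.
Proof.
have JB f := @dsum_ideal_sub _ _ _ _ _ hJ f.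
have lift x : dsum_closure x -> forall e, 0 < e -> exists2 f, dsum J f & nrm (x - iota f) < e.
  by move=> /closureP h e /h[_ [f hf <-] xf]; exists f.
have unlift x : (forall e, 0 < e -> exists2 f, dsum J f & nrm (x - iota f) < e) ->
    dsum_closure x.
  by move=> h; apply/closureP => e /h[f hf xf]; exists (iota f) => //; exists f.
have absorb (T : C -> C) x M : 0 <= M ->
    (forall y z, nrm (T y - T z) <= M * nrm (y - z)) ->
    (forall f, dsum J f -> exists2 g, dsum J g & T (iota f) = iota g) ->
    dsum_closure x -> dsum_closure (T x).
  move=> M0 TM TJ cx; apply: unlift => e e0.
  have M1 : 0 < M + 1 by rewrite ltr_wpDl.
  have [f hf xf] := lift _ cx _ (divr_gt0 e0 M1).
  have [g hg fg] := TJ f hf; exists g => //; rewrite -fg.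
  apply: le_lt_trans (TM _ _) _; move: xf; rewrite ltr_pdivlMr //.
  by have := nrm_ge0 (x - iota f); nra.
apply: (ideal_of_fibres hB hrep) => [|t b x Bb cx].
  split; first exact: closed_closure.
    by apply: subset_closure; exists 0; [exact: (dsum0 fJ)|exact: (rep0 hB hrep)].
  move=> c x y cx cy; apply: unlift => e e0; have e2 : 0 < e / 2 by rewrite divr_gt0.
  have k1 : 0 < cabs c + 1 by rewrite ltr_wpDl // cabs_ge0.
  have [f hf xf] := lift _ cx _ (divr_gt0 e2 k1).
  have [g hg yg] := lift _ cy _ e2.
  exists (c *: f + g); first exact: (dsum_lin fJ).
  rewrite (rep_lin hrep); [|exact: JB|exact: JB].
  rewrite opprD addrACA -scalerBr; apply: le_lt_trans (ler_nrmD _ _) _.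
  rewrite nrmZ; move: xf; rewrite ltr_pdivlMr // => xf.
  have := nrm_ge0 (x - iota f); nra.
have sb := dsum_singleP hB Bb.
split.
- apply: (absorb (fun x => (fibre t b) ** x) x (nrm (fibre t b))) => //; first exact: nrm_ge0.
    by move=> y z; rewrite -cmulBr nrm_cmul.
  move=> f hf; exists (dsum_mul (dsum_single t b) f).
    split; last by case: (dsum_mulP hB sb (JB _ hf)).
    move=> s; rewrite dsum_mul_singlel -{1}[s](mulVKg t).
    by apply: (ideal_mull hJ) => //; case: hf.
  by rewrite (repM hrep) //; exact: JB.
- apply: (absorb (fun x => x ** (fibre t b)) x (nrm (fibre t b))) => //; first exact: nrm_ge0.
    by move=> y z; rewrite -cmulBl mulrC nrm_cmul.
  move=> f hf; exists (dsum_mul f (dsum_single t b)).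
    split; last by case: (dsum_mulP hB (JB _ hf) sb).
    move=> s; rewrite dsum_mul_singler -{1}[s](mulgVK t).
    by apply: (ideal_mulr hJ) => //; case: hf.
  by rewrite (repM hrep) //; exact: JB.
Qed.

Hypothesis graded : graded_ideal B iota K.

(** Gradedness enters here: the closure of the direct sum of J is an ideal that
    contains the unit fibre of K, hence contains the ideal generated by it. *)
Lemma kernel_closure : K `<=` dsum_closure.
Proof.
have [_ ->] := graded; apply: smallest_sub; first exact: dsum_closure_ideal.
move=> y [Ky [b Bb bx]]; rewrite -{}bx in Ky *; apply: subset_closure.
exists (dsum_single 1%g b) => //; apply: (dsum_singleP fJ).
by apply/(kernel_single Bb).
Qed.

Let sK : cstar_subalg K.
Proof.
split; first by case: hK.
- by move=> x y Kx Ky; case: hK => _ h; case: (h x y Ky).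
- by move=> x; exact: ideal_star.
Qed.

Local Notation CJ := (subalg sK).

(** The reduced algebra of J is realized as K itself, so that phi is the inclusion;
    the default value is taken outside the direct sum only. *)
Definition iotaJ (f : G -> A) : CJ :=
  if pselect (K (iota f)) is left h then mk_sub sK h else 0.

Lemma iotaJE f : dsum J f -> sval_sub (iotaJ f) = iota f.
Proof. by move=> hf; rewrite /iotaJ; case: pselect => // /(_ (kernel_dsum hf)). Qed.

Lemma iotaJ_rep : graded_rep J iotaJ.
Proof.
have JB f := @dsum_ideal_sub _ _ _ _ _ hJ f.
have [pD pZ pM pC p1] := rep_tgnorm hrep.
have nE f : dsum J f -> nrm (iotaJ f) = nrm (iota f).
  by move=> hf; rewrite nrm_sub iotaJE.
split=> [c f g hf hg|f g hf hg|f hf||].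
- apply: sub_inj; rewrite iotaJE; last exact: (dsum_lin fJ).
  rewrite (rep_lin hrep) //; [|exact: JB|exact: JB].
  by rewrite -(iotaJE hf) -(iotaJE hg).
- apply: sub_inj; rewrite iotaJE; last exact: (dsum_mulP fJ).
  rewrite (repM hrep) //; [|exact: JB|exact: JB].
  by rewrite -(iotaJE hf) -(iotaJE hg).
- apply: sub_inj; rewrite iotaJE; last exact: (dsum_starP fJ).
  by rewrite (rep_star hrep); [rewrite -(iotaJE hf)|exact: JB].
- split=> [f g hf hg|c f hf|f g hf hg|f hf|f hf].
  + by rewrite !nE //; [apply: pD; exact: JB|exact: (dsumD fJ)].
  + by rewrite !nE //; [apply: pZ; exact: JB|exact: (dsumZ fJ)].
  + by rewrite !nE //; [apply: pM; exact: JB|exact: (dsum_mulP fJ)].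
  + rewrite !nE //; first by apply: pC; exact: JB.
    by apply: (dsum_mulP fJ) => //; exact: (dsum_starP fJ).
  + by rewrite nE //; apply: p1; exact: JB.
- apply/seteqP; split=> // w _; apply/closureP => e e0.
  have /closureP/(_ e e0)[_ [f hf <-] wf] := kernel_closure (sub_mem w).
  by exists (iotaJ f); [exists f|rewrite nrm_sub; move: wf; rewrite -(iotaJE hf)].
Qed.

(** The coefficients on K are the restrictions of those on C, which are faithful. *)
Lemma iotaJ_reduced : reduced_algebra J iotaJ.
Proof.
apply: (faithful_reduced fJ iotaJ_rep) => w w0; apply: sub_inj.
apply: (reduced_faithful hB hrep hC) => t; rewrite -(w0 t); apply/esym.
apply: (coef_uniq fJ iotaJ_rep) => f hf.
have hf' := dsum_ideal_sub hJ hf.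
rewrite nrm_sub -(coef_rep hB hrep t hf') -(coefB hB hrep).
apply: le_trans (coef_nrm hB hrep _ _) _.
by rewrite -(iotaJE hf).
Qed.


Local Notation D := (quot hK).
Local Notation pi := (qpi hK).

(** The fibre B_t/J_t is realized inside C/K, which will also be the reduced algebra
    of the quotient bundle. *)
Definition qmap (t : G) (b : A) : D := pi (fibre t b).
Definition qfibre (t : G) : set D := qmap t @` B t.

Lemma qmap_lin t (c : R[i]) a b : B t a -> B t b ->
  qmap t (c *: a + b) = c *: qmap t a + qmap t b.
Proof. by move=> Ba Bb; rewrite /qmap (rep_single_lin hB hrep) // qpiD qpiZ. Qed.

Lemma qmapB t a b : B t a -> B t b -> qmap t (a - b) = qmap t a - qmap t b.
Proof. by move=> Ba Bb; rewrite /qmap (rep_singleB hB hrep) // qpiB. Qed.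

Lemma qmap_eq0 t b : B t b -> qmap t b = 0 <-> J t b.
Proof.
move=> Bb; split=> [/qpi0P/(kernel_single Bb)//|Jb].
by apply/qpi0P/(kernel_single Bb).
Qed.

Lemma qmap0 t : qmap t 0 = 0.
Proof. by have [_ B0 _ _ _] := BP t; apply/qmap_eq0 => //; have [] := JP t. Qed.

Lemma qmap_star t b : B t b -> qmap t^-1%g (cstar b) = cstar (qmap t b).
Proof.
move=> Bb; rewrite /qmap -qpi_star -(rep_star hrep) ?dsum_star_single //.
exact: dsum_singleP.
Qed.

Lemma qmapM s t a b : B s a -> B t b ->
  qmap (s * t)%g (a ** b) = qmap s a ** qmap t b.
Proof.
move=> Ba Bb; rewrite /qmap -dsum_mul_single (repM hrep) ?qpiM //; exact: dsum_singleP.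
Qed.

Lemma qmap_le t b j : B t b -> J t j -> nrm (qmap t b) <= nrm (b - j).
Proof.
move=> Bb Jj; have Bj := ideal_sub hJ Jj; have [_ _ BD BN _] := BP t.
have -> : qmap t b = qmap t (b - j).
  by rewrite qmapB // (_ : qmap t j = 0) ?subr0 //; apply/qmap_eq0.
apply: le_trans (qnorm_le _ _) _.
by rewrite (rep_single_nrm hB hrep) //; apply: (BD) => //; exact: BN.
Qed.

(** All lifts y of pi x have the same t-th coefficient modulo J_t, and
    |F_t y| <= |y|: coefficients descend to the quotient as contractions. *)
Lemma qmap_coef_le t x : nrm (qmap t (F t x)) <= nrm (pi x).
Proof.
apply: le_qnorm => y /qpi_eq Kyx.
have := qmap_le (coef_mem hB hrep t x) (_ : J t (F t x - F t y)).
rewrite subKr => h; apply: le_trans (h _) (coef_nrm hB hrep _ _).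
have [_ _ _ JN _] := JP t; rewrite -opprB; apply: JN.
by rewrite -(coefB hB hrep); exact: Kyx.
Qed.

Lemma qmap_coef_dist t x b : B t b ->
  nrm (qmap t (F t x) - qmap t b) <= nrm (pi x - qmap t b).
Proof.
move=> Bb; have := qmap_coef_le t (x - (fibre t b)).
rewrite (coefB hB hrep) coef_single // eqxx qpiB qmapB //.
exact: (coef_mem hB hrep).
Qed.

(** The map taking pi x to the class of F_t x is a contraction that fixes the fibre,
    so a limit of elements of the fibre is fixed as well. *)
Lemma qfibre_closed t : closed (qfibre t).
Proof.
apply/closedP => y h; exists (F t (qrep y)); first exact: (coef_mem hB hrep).
apply/subr0_eq/nrm_eq0/eqP; rewrite eq_le nrm_ge0 andbT.
apply/ler_addgt0Pr => e e0; rewrite add0r; have e2 : 0 < e / 2 by rewrite divr_gt0.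
have [_ [b Bb <-] yb] := h _ e2.
have := qmap_coef_dist (qrep y) Bb; rewrite qrepK => hd.
have := ler_nrm_dist (qmap t b) (qmap t (F t (qrep y))) y.
rewrite [nrm (qmap t b - y)]nrmB; lra.
Qed.

Lemma qfibre_fell : fell_bundle qfibre.
Proof.
split=> [t|t|s t _ _ [a Ba <-] [b Bb <-]].
- have [_ B0 BD _ BZ] := BP t; split; first exact: qfibre_closed.
    by exists 0 => //; exact: qmap0.
  move=> c _ _ [a Ba <-] [b Bb <-]; exists (c *: a + b); last exact: qmap_lin.
  by apply: (BD) => //; exact: BZ.
- have sub u : cstar @` qfibre u `<=` qfibre u^-1%g.
    move=> _ [_ [b Bb <-] <-]; exists (cstar b); first exact: (fell_star hB).
    exact: qmap_star.
  apply/seteqP; split=> [|_ [b Bb <-]]; first exact: sub.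
  exists (cstar (qmap t^-1%g b)); last by rewrite cstarK.
  have := sub t^-1%g (cstar (qmap t^-1%g b)); rewrite invgK; apply.
  by exists (qmap t^-1%g b) => //; exists b.
- by exists (a ** b); [exact: (fell_mul hB)|exact: qmapM].
Qed.

(** For the quotient norm: a lift y of the class of b has F_t y in b + J_t and
    |F_t y| <= |y|, so |y| is at least the distance from b to J_t. *)
Lemma qbundle : quotient_bundle B J qfibre qmap.
Proof.
split=> [|t c a b||t b Bb|]; [exact: qfibre_fell|exact: qmap_lin|by []| |exact: qmapM].
split; [exact: qmap_eq0| |exact: qmap_star].
rewrite -/(nrm _); apply/eqP; rewrite eq_le; apply/andP; split.
  apply: lb_le_inf.
    by have [_ J0 _ _ _] := JP t; exists (nrm (b - 0)), 0.
  by move=> _ [j Jj <-]; exact: qmap_le.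
apply: le_qnorm => y /qpi_eq/(_ t); rewrite (coefB hB hrep) coef_single // eqxx => Jy.
apply: (@le_trans _ _ (nrm (F t y))); last exact: (coef_nrm hB hrep).
apply: inf_lbound; first by exists 0 => _ [j _ <-]; exact: nrm_ge0.
exists (b - F t y); last by rewrite subKr.
by rewrite -opprB; have [_ _ _ JN _] := JP t; exact: JN.
Qed.

Let fQ := qfibre_fell.

Lemma qdsum f : dsum B f -> dsum qfibre (fun t => qmap t (f t)).
Proof.
move=> hf; have [r [_ fr]] := dsum_supp hf.
apply: (@dsum_of_supp _ _ _ _ _ r) => [t|t h]; first by exists (f t) => //; case: hf.
by apply: fr => ft; apply: h; rewrite ft qmap0.
Qed.

Lemma qlift g : exists f, dsum qfibre g -> dsum B f /\ forall t, qmap t (f t) = g t.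
Proof.
have [hg|] := pselect (dsum qfibre g); last by exists 0.
have ex t : exists b, [/\ B t b, qmap t b = g t & g t = 0 -> b = 0].
  have [g0|g0] := pselect (g t = 0); last by have [b Bb bg] := hg.1 t; exists b.
  by exists 0; split=> //; [have [] := BP t|rewrite g0 qmap0].
have [f hf] := choice ex; exists f => _.
split=> [|t]; last by case: (hf t).
have [r [_ gr]] := dsum_supp hg.
apply: (@dsum_of_supp _ _ _ _ _ r) => [t|t ft]; first by case: (hf t).
by apply: gr => gt; apply: ft; case: (hf t) => _ _; exact.
Qed.

Definition slift g : G -> A := sval (cid (qlift g)).

Lemma slift_dsum g : dsum qfibre g -> dsum B (slift g).
Proof. by move=> hg; case: (svalP (cid (qlift g)) hg). Qed.

Lemma sliftE g t : dsum qfibre g -> qmap t (slift g t) = g t.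
Proof. by move=> hg; case: (svalP (cid (qlift g)) hg). Qed.

Definition iotaQ (g : G -> D) : D := pi (iota (slift g)).

(** Two lifts of a section differ by a section of J, which iota maps into K; so any
    lift computes iotaQ. *)
Lemma iotaQE g f : dsum qfibre g -> dsum B f -> (forall t, qmap t (f t) = g t) ->
  iotaQ g = pi (iota f).
Proof.
move=> hg hf fg; apply/qpi_eq; have hl := slift_dsum hg.
rewrite -(repB hrep) // => t; rewrite (coef_rep hB hrep); last exact: (dsumB hB).
have Bl : B t (slift g t) by case: hl.
have Bf : B t (f t) by case: hf.
have [_ _ BD BN _] := BP t.
have : qmap t (slift g t - f t) = 0 by rewrite qmapB // sliftE // fg subrr.
by move/qmap_eq0; apply; apply: (BD) => //; exact: BN.
Qed.

Lemma qmap_mul f f' t : dsum B f -> dsum B f' ->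
  qmap t (dsum_mul f f' t) =
  dsum_mul (fun s => qmap s (f s)) (fun s => qmap s (f' s)) t.
Proof.
move=> hf hf'; have [r [ur fr]] := dsum_supp hf.
rewrite /dsum_mul (fsum_seq ur); last first.
  by move=> s h; apply: fr => fs; apply: h; rewrite fs cmul0x.
rewrite (fsum_seq ur); last first.
  by move=> s h; apply: fr => fs; apply: h; rewrite fs qmap0 cmul0x.
have Bs s : B t (f s ** f' (s^-1 * t)%g).
  by rewrite -{1}[t](mulVKg s); apply: (fell_mul hB); [case: hf|case: hf'].
have [_ B0 BD _ _] := BP t.
elim: (r) => [|s q IH]; first by rewrite !big_nil qmap0.
rewrite !big_cons -IH -[f s ** _]scale1r qmap_lin //; last first.
  by elim/big_ind: _ => [//|x y|i _]; [exact: BD|exact: Bs].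
rewrite scale1r; congr (_ + _); rewrite -{1}[t](mulVKg s) qmapM //.
  by case: hf.
by case: hf'.
Qed.

Lemma iotaQ_rep : graded_rep qfibre iotaQ.
Proof.
have lin (c : R[i]) g g' : dsum qfibre g -> dsum qfibre g' ->
    iotaQ (c *: g + g') = c *: iotaQ g + iotaQ g'.
  move=> hg hg'; have hl := slift_dsum hg; have hl' := slift_dsum hg'.
  rewrite (@iotaQE _ (c *: slift g + slift g')).
  - by rewrite (rep_lin hrep) // qpiD qpiZ.
  - exact: (dsum_lin fQ).
  - exact: (dsum_lin hB).
  - move=> t; rewrite qmap_lin; [|by case: hl|by case: hl'].
    by rewrite !sliftE.
have mul g g' : dsum qfibre g -> dsum qfibre g' ->
    iotaQ (dsum_mul g g') = iotaQ g ** iotaQ g'.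
  move=> hg hg'; have hl := slift_dsum hg; have hl' := slift_dsum hg'.
  rewrite (@iotaQE _ (dsum_mul (slift g) (slift g'))).
  - by rewrite (repM hrep) // qpiM.
  - exact: (dsum_mulP fQ).
  - exact: (dsum_mulP hB).
  - move=> t; rewrite qmap_mul //.
    have slE h : dsum qfibre h -> (fun s => qmap s (slift h s)) = h.
      by move=> hh; apply/funext => s; rewrite sliftE.
    by rewrite (slE _ hg) (slE _ hg').
have star g : dsum qfibre g -> iotaQ (dsum_star g) = cstar (iotaQ g).
  move=> hg; have hl := slift_dsum hg.
  rewrite (@iotaQE _ (dsum_star (slift g))).
  - by rewrite (rep_star hrep) // qpi_star.
  - exact: (dsum_starP fQ).
  - exact: (dsum_starP hB).
  - move=> t; rewrite /dsum_star -{1}[t]invgK qmap_star ?sliftE //; by case: hl.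
have z0 : iotaQ 0 = 0.
  by rewrite (@iotaQE _ 0 (dsum0 fQ) (dsum0 hB)) ?(rep0 hB hrep) -?[0]/(pi 0) // => t; exact: qmap0.
split=> //.
- split=> [f g hf hg|c f hf|f g hf hg|f hf|f hf].
  + by have := lin 1 f g hf hg; rewrite !scale1r => ->; exact: ler_nrmD.
  + have := lin c f 0 hf (dsum0 fQ); rewrite z0 !addr0 => ->; exact: nrmZ.
  + by rewrite mul // nrm_cmul.
  + by rewrite mul ?star ?nrm_starM //; exact: (dsum_starP fQ).
  + rewrite -(sliftE 1%g hf) -(coef_rep hB hrep 1%g (slift_dsum hf)).
    exact: qmap_coef_le.
- apply/seteqP; split=> // y _; apply/closureP => e e0.
  have [f hf yf] := rep_dense hrep (qrep y) e0.
  exists (pi (iota f)).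
    exists (fun t => qmap t (f t)); first exact: qdsum.
    by apply: iotaQE => //; exact: qdsum.
  rewrite -{1}[y]qrepK -qpiB; apply: le_lt_trans yf; exact: qnorm_le.
Qed.

(** The t-th coefficient of pi x is the class of F_t x; if all of them vanish then
    x lies in K by the definition of K. *)
Lemma iotaQ_reduced : reduced_algebra qfibre iotaQ.
Proof.
apply: (faithful_reduced fQ iotaQ_rep) => y y0; rewrite -[y]qrepK; apply/qpi0P => t.
apply/qmap_eq0; first exact: (coef_mem hB hrep).
rewrite -(y0 t); apply/esym/(coef_uniq fQ iotaQ_rep) => g hg.
have hl := slift_dsum hg.
rewrite -{1}(sliftE t hg) -(coef_rep hB hrep t hl).
rewrite -qmapB; [|exact: (coef_mem hB hrep)|exact: (coef_mem hB hrep)].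
rewrite -(coefB hB hrep); apply: le_trans (qmap_coef_le _ _) _.
by rewrite qpiB qrepK.
Qed.

(** The maps phi and psi are the inclusion of K and the quotient map of C by K, whose
    sequence is exact by construction. *)
Lemma graded_exact_at : exists (D : cstarAlgType R) (Q : G -> set D) (q : G -> A -> D)
    (CJ CB CQ : cstarAlgType R) (iJ : (G -> A) -> CJ) (iB : (G -> A) -> CB)
    (iQ : (G -> D) -> CQ) (phi : CJ -> CB) (psi : CB -> CQ),
  [/\ quotient_bundle B J Q q,
      [/\ reduced_algebra J iJ, reduced_algebra B iB & reduced_algebra Q iQ],
      star_hom phi /\ (forall f, dsum J f -> phi (iJ f) = iB f),
      star_hom psi /\
        (forall f, dsum B f -> psi (iB f) = iQ (fun t => q t (f t))) &
      short_exact phi psi].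
Proof.
exists D, qfibre, qmap, CJ, C, D, iotaJ, iota, iotaQ, (@sval_sub _ _ _ sK), pi.
split.
- exact: qbundle.
- by split=> //; [exact: iotaJ_reduced|exact: iotaQ_reduced].
- by split; [split|exact: iotaJE].
- split; first split=> [c x y|x y|x].
  + by rewrite qpiD qpiZ.
  + exact: qpiM.
  + exact: qpi_star.
  + by move=> f hf; apply/esym/iotaQE => //; exact: qdsum.
- split; first exact: sub_inj.
    apply/seteqP; split=> [_ [w _ <-]|x /qpi0P Kx].
      by apply/qpi0P; exact: sub_mem.
    by exists (mk_sub sK Kx).
  by apply/seteqP; split=> // y _; exists (qrep y) => //; exact: qrepK.
Qed.

End Graded_to_exact.

Theorem proposition3p7 (R : realType) (G : groupType) (A : cstarAlgType R)
    (B : G -> set A) (Cr : cstarAlgType R) (iota : (G -> A) -> Cr) :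
  fell_bundle B -> reduced_algebra B iota ->
  exact_bundle B <->
  (forall I : set Cr, fourier_ideal B iota I -> graded_ideal B iota I).
Proof.
move=> hB hC; split=> [|gr J hJ]; first exact: exact_graded.
apply: (graded_exact_at hB hC hJ); apply: gr; exact: kernel_fourier.
Qed.
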